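(* Let $X$ be an $E$-valued $\mathcal P$-polynomial process with action $T$, and suppose that Assumption (F) (stated in the context) holds. Assume that $\mathbb E\left[\int_0^t |\mathcal G p(X_r)|\,dr\right]<\infty$ for any $t\geq 0$ and $p\in\mathcal L$. Define $b:=(\mathcal G^{(0,1)})^*1\in B$, $\mathcal A:=(\mathcal G^{(1)})^*:B\to B$, $U_h:=(T^{(1)}_h)^*:B\to B$ for $h\ge 0$, and $$ M_t := \tilde X_t - \tilde X_0 - \int_0^t (b+\mathcal A\tilde X_s)\, ds,\quad t\geq 0, $$ where the integral is a weak*-integral. Then $M$ is a $B$-valued weak*-martingale (i.e. $M(p)$ is a martingale for every $p\in\mathcal L$) with $$ M_t(p) = p(X_t)-p(X_0) - \int_0^t \mathcal Gp(X_s)\, ds, \quad t\geq 0,\ p\in\mathcal L, $$ and we have $$ \tilde X_t = U_t\tilde X_0 + \int_0^t U_{t-s}b\,ds + \int_0^t U_{t-s}\,dM_s, \quad t\geq 0, $$ where the first integral is a weak*-integral and the second is the integral with respect to a weak*-semimartingale described in the context. In particular, $p(X)$ is a semimartingale for any $p\in\mathcal P_1$.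
   Context: $\mathbb F$ is $\mathbb R$ or $\mathbb C$, $\mathbb N=\{0,1,2,\dots\}$, $\mathbb R_+=[0,\infty)$. $(\Omega,\mathfrak A,(\mathcal F_t)_{t\ge 0},P)$ is a filtered probability space and $E$ is a non-empty set. Polynomials: $\mathcal P$ is a vector space of functions $E\to\mathbb F$ containing all constant functions, together with a degree function $\deg:\mathcal P\to\mathbb N$ such that $\deg(p+q)\le\max\{\deg(p),\deg(q)\}$, $\deg(\lambda p)=\deg(p)$ for $p,q\in\mathcal P$, $\lambda\in\mathbb F\setminus\{0\}$, and $\deg(p)=0$ iff $p$ is constant. $\mathcal P_n:=\{p\in\mathcal P:\deg(p)\le n\}$. $\mathcal L$ is a fixed vector space complement of $\mathcal P_0$ in $\mathcal P_1$. Polynomial action: a family $T=(T_h)_{h\ge0}$ of linear operators on $\mathcal P$ with $\deg(T_hp)\le\deg(p)$, $T_0p=p$, $T_hT_k=T_{h+k}$ for $h,k\ge0$, and $h\mapsto (T_hp)(x)$ right-continuous for all $p\in\mathcal P$, $x\in E$. Its generator $\mathcal G$ has domain $\mathcal D$ consisting of all $p\in\mathcal P$ for which there is $q\in\mathcal P$ with $\lim_{h\searrow0}\frac{T_hp(x)-p(x)}{h}=q(x)$ for all $x\in E$, and then $\mathcal Gp:=q$. Polynomial process: a function $X:\Omega\times\mathbb R_+\to E$ is an $E$-valued $\mathcal P$-polynomial process with action $T$ if for all $p\in\mathcal P$: $\mathbb E[|p(X_t)|]<\infty$ for $t\ge0$; $\mathbb E[p(X_{t+h})|\mathcal F_t]=T_hp(X_t)$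 for $t,h\ge0$; $t\mapsto p(X_t)$ has càdlàg paths; $p(X_t)$ is $\mathcal F_t$-measurable for $t\ge0$. Let $\Pi_0,\Pi_1$ be the projections of $\mathcal P_1=\mathcal P_0\oplus\mathcal L$ onto $\mathcal P_0$ and $\mathcal L$, and $T^{(1)}_h:=\Pi_1T_h|_{\mathcal L}$ (a semigroup on $\mathcal L$). Assumption (F): for every $p\in\mathcal L$ there is a finite dimensional subspace $V_p\subseteq\mathcal L$ with $p\in V_p$ and $T^{(1)}_hV_p\subseteq V_p$ for any $h\ge0$. Under (F) one has $\mathcal P_1\subseteq\mathcal D$ and $\mathcal G\mathcal P_1\subseteq\mathcal P_1$; put $\mathcal G^{(0,1)}:=\Pi_0\mathcal G|_{\mathcal L}:\mathcal L\to\mathcal P_0$ and $\mathcal G^{(1)}:=\Pi_1\mathcal G|_{\mathcal L}:\mathcal L\to\mathcal L$. $B$ is the algebraic dual space of $\mathcal L$, and ${}^*$ denotes the algebraic adjoint. $\tilde X_t\in B$ is given by $\tilde X_t(p):=p(X_t)$, $p\in\mathcal L$. The symbol $1\in\mathcal P_0^*$ denotes the functional $p\mapsto p(e)$ for any $e\in E$, so $b(p)$ is the value of the constant function $\mathcal G^{(0,1)}p$. The weak*-integral of a $B$-valued function $Y$ is the element of $B$ given by $p\mapsto\int_0^tY_s(p)\,ds$. Integral with respect to a weak*-semimartingale: a $B$-valued process $Y$ is a weak*-semimartingale if $Y(p)$ is a semimartingale for every $p\in\mathcal L$. For $p\in\mathcal L$ let $U^p_h:=(T^{(1)}_h|_{V_p})^*$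 on the finite-dimensional space $V_p^*$. Then $\int_0^tU_{t-s}\,dY_s:=Z_t$, where $Z$ is the $B$-valued process (unique up to $P\otimes\lambda$-a.e. equality of $Z(p)$ for each $p\in\mathcal L$, $\lambda$ being Lebesgue measure on $\mathbb R_+$) such that for every $p\in\mathcal L$ one has $Z_t|_{V_p}=\int_0^tU^p_{t-s}\,d(Y_s|_{V_p})$, $t\ge0$, the right-hand side being the ordinary stochastic integral in $V_p^*$. *)

(* Defs.v *)
From HB Require Import structures.
From mathcomp Require Import all_boot all_order all_algebra.
From mathcomp Require Import complex.
From mathcomp Require Import all_classical all_reals all_analysis.
Set Implicit Arguments.
Unset Strict Implicit.
Unset Printing Implicit Defensive.
Import Order.TTheory GRing.Theory Num.Theory.
Import numFieldNormedType.Exports.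
Local Open Scope classical_set_scope.
Local Open Scope ring_scope.

(* Statements over "the field R or C" quantify over (k : scalar_kind); the
   scalar field is then scalars R k. *)
Inductive scalar_kind := RealScalars | ComplexScalars.

Definition scalars (R : realType) (k : scalar_kind) : numFieldType :=
  match k with RealScalars => R | ComplexScalars => R[i]%C end.

Section scalars.
Context {R : realType} {k : scalar_kind}.

Definition sRe : scalars R k -> R :=
  match k return scalars R k -> R with
  | RealScalars => id
  | ComplexScalars => @complex.Re R
  end.

Definition sIm : scalars R k -> R :=
  match k return scalars R k -> R with
  | RealScalars => fun=> 0
  | ComplexScalars => @complex.Im R
  end.

(* a + ib; the second argument is ignored over the reals *)
Definition mkS : R -> R -> scalars R k :=
  match k return R -> R -> scalars R k with
  | RealScalars => fun a _ => a
  | ComplexScalars => @complex.Complex R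
  end.

(* The norm of scalars R k takes its (nonnegative real) values in scalars R k
   itself. *)
Definition modulus (z : scalars R k) : R := sRe `|z|.

Definition sint d (T : measurableType d) (mu : {measure set T -> \bar R})
    (D : set T) (f : T -> scalars R k) : scalars R k :=
  mkS (\int[mu]_(x in D) sRe (f x)) (\int[mu]_(x in D) sIm (f x)).

Definition smeasurable (T : Type) (G : set (set T)) (f : T -> scalars R k) :=
  forall B : set R, measurable B ->
    G ((sRe \o f) @^-1` B) /\ G ((sIm \o f) @^-1` B).

Definition cadlag (x : R -> scalars R k) :=
  (forall t, 0 <= t -> x s @[s --> t^'+] --> x t) /\
  (forall t, 0 < t -> cvg (x s @[s --> t^'-])).

Definition caglad_upto (t : R) (x : R -> scalars R k) :=
  (forall s, 0 < s <= t -> x r @[r --> s^'-] --> x s) /\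
  (forall s, 0 <= s < t -> cvg (x r @[r --> s^'+])).

End scalars.

Inductive submod (K : fieldType) (V : lmodType K) (S : submodClosed V)
  : predArgType := Submod u of u \in S.

Section submod.
Context (K : fieldType) (V : lmodType K) (S : submodClosed V).

Definition submod_val (u : submod S) : V := let: Submod v _ := u in v.

HB.instance Definition _ := [isSub of submod S for submod_val].
HB.instance Definition _ := [Choice of submod S by <:].
HB.instance Definition _ := [SubChoice_isSubLmodule of submod S by <:].

(* the restriction of f to S, for f mapping S into itself *)
Definition restr (f : V -> V) (v : submod S) : submod S :=
  insubd 0 (f (val v)).

End submod.

Section finite_dimension.
Context (K : fieldType) (W : lmodType K).

Definition is_basis n (e : 'I_n -> W) :=
  forall w, exists! c : 'I_n -> K, w = \sum_i c i *: e i.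

Definition dual_basis n (e : 'I_n -> W) (j : 'I_n) (w : W) : K :=
  (xget (fun=> 0) [set c : 'I_n -> K | w = \sum_i c i *: e i]) j.

Definition fin_dim := exists n (e : 'I_n -> W), is_basis e.

End finite_dimension.

(* Elements of the algebraic dual of U are functions phi : U -> K with
   linear phi; the adjoint of a linear map is precomposition. *)
Definition adjoint (U V K : Type) (f : U -> V) (phi : V -> K) : U -> K :=
  phi \o f.

Section stochastic_processes.
Context {R : realType} {k : scalar_kind}.
Local Notation F := (scalars R k).
Context {d : measure_display} {Omega : measurableType d}.
Variable Pr : probability Omega R.
Variable Ft : R -> set (set Omega).

Definition filtration :=
  (forall t, 0 <= t -> sigma_algebra [set: Omega] (Ft t)) /\
  (forall t, 0 <= t -> Ft t `<=` measurable) /\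
  (forall s t, 0 <= s -> s <= t -> Ft s `<=` Ft t).

Definition sintegrable (f : Omega -> F) :=
  smeasurable measurable f /\
  (\int[Pr]_w (modulus (f w))%:E < +oo)%E.

(* Z is a version of E[Y | G] *)
Definition cond_exp (G : set (set Omega)) (Y Z : Omega -> F) :=
  smeasurable G Z /\ sintegrable Z /\
  forall A, G A -> sint Pr A Y = sint Pr A Z.

Definition adapted (Y : Omega -> R -> F) :=
  forall t, 0 <= t -> smeasurable (Ft t) (Y^~ t).

Definition martingale (Y : Omega -> R -> F) :=
  adapted Y /\
  (forall w, cadlag (Y w)) /\
  (forall t, 0 <= t -> sintegrable (Y^~ t)) /\
  (forall s t, 0 <= s -> s <= t -> cond_exp (Ft s) (Y^~ t) (Y^~ s)).

Definition stopping_time (tau : Omega -> \bar R) :=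
  (forall w, (0 <= tau w)%E) /\
  (forall t : R, 0 <= t -> Ft t [set w | (tau w <= t%:E)%E]).

Definition stopped_sigma_algebra (tau : Omega -> \bar R) : set (set Omega) :=
  [set A | measurable A /\
    forall t : R, 0 <= t -> Ft t (A `&` [set w | (tau w <= t%:E)%E])].

Definition stopped (Y : Omega -> R -> F) (tau : Omega -> \bar R) w (t : R) :=
  Y w (fine (Order.min t%:E (tau w))).

Definition local_martingale (Y : Omega -> R -> F) :=
  adapted Y /\
  (forall w, cadlag (Y w)) /\
  exists tau : nat -> Omega -> \bar R,
    (forall n, stopping_time (tau n)) /\
    (forall n w, (tau n w <= tau n.+1 w)%E) /\
    {ae Pr, forall w, (tau n w) @[n --> \oo] --> +oo%E} /\
    (forall n, martingale (stopped Y (tau n))).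

Definition finite_variation (Y : Omega -> R -> F) :=
  adapted Y /\
  (forall w, cadlag (Y w)) /\
  (forall w t, 0 <= t -> bounded_variation 0 t (sRe \o Y w) /\
                         bounded_variation 0 t (sIm \o Y w)).

Definition semimartingale (Y : Omega -> R -> F) :=
  smeasurable (Ft 0) (Y^~ 0) /\
  exists M A : Omega -> R -> F,
    local_martingale M /\ (forall w, M w 0 = 0) /\
    finite_variation A /\ (forall w, A w 0 = 0) /\
    (forall w t, 0 <= t -> Y w t = Y w 0 + M w t + A w t).

(* sum_(i < n) c_i 1_(]tau_i, tau_(i+1)]] for stopping times
   tau_0 <= ... <= tau_n and c_i measurable for the sigma-algebra at tau_i *)
Record simple_predictable := SimplePredictable {
  sp_size : nat;
  sp_time : nat -> Omega -> R;
  sp_coef : nat -> Omega -> F;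
  sp_stopping : forall i, (i <= sp_size)%N ->
    stopping_time (fun w => (sp_time i w)%:E);
  sp_nondecreasing : forall i w, (i < sp_size)%N ->
    sp_time i w <= sp_time i.+1 w;
  sp_measurable : forall i, (i < sp_size)%N ->
    smeasurable (stopped_sigma_algebra (fun w => (sp_time i w)%:E))
      (sp_coef i)
}.

Definition simple_at (S : simple_predictable) (w : Omega) (s : R) : F :=
  \sum_(i < sp_size S | sp_time S i w < s <= sp_time S i.+1 w) sp_coef S i w.

Definition simple_int (S : simple_predictable) (Y : Omega -> R -> F)
    (w : Omega) (t : R) : F :=
  \sum_(i < sp_size S) sp_coef S i w *
    (Y w (Order.min (sp_time S i.+1 w) t) - Y w (Order.min (sp_time S i w) t)).

(* zeta is a version of the stochastic integral over ]0, t] of the adapted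
   caglad process H against the semimartingale Y. As usual, the integral is
   the continuous extension of simple_int from simple predictable processes
   with the topology of uniform convergence on ]0, t] in probability to random
   variables with convergence in probability; its graph is the closure of the
   graph of simple_int (semimartingales being good integrators, zeta is
   determined up to a null set). Bounds on s are strict so that, by left
   continuity, the sets below are events. *)
Definition stoch_int (H Y : Omega -> R -> F) (t : R) (zeta : Omega -> F) :=
  semimartingale Y /\
  (forall s, 0 < s <= t -> smeasurable (Ft s) (H^~ s)) /\
  (forall w, caglad_upto t (H w)) /\
  smeasurable measurable zeta /\
  exists S : nat -> simple_predictable, forall eps : R, 0 < eps ->
    Pr [set w | exists s, 0 < s <= t /\
          eps < modulus (simple_at (S n) w s - H w s)] @[n --> \oo] --> 0%E /\
    Pr [set w | eps < modulus (simple_int (S n) Y w t - zeta w)]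
      @[n --> \oo] --> 0%E.

(* The stochastic integral over ]0, t] of a (deterministic) operator-valued H
   against a semimartingale Y with values in the dual of a finite-dimensional
   W. If (e_j^* ) is the dual basis of (e_j), then
     H_s Y_s (e_i) = sum_j (H_s e_j^* )(e_i) Y_s(e_j),
   and the integral is taken entrywise. *)
Definition dual_stoch_int (W : lmodType F) (H : R -> (W -> F) -> (W -> F))
    (Y : Omega -> R -> W -> F) (t : R) (zeta : Omega -> W -> F) :=
  fin_dim W /\
  forall n (e : 'I_n -> W), is_basis e ->
    exists I : 'I_n -> 'I_n -> Omega -> F,
      (forall i j, stoch_int (fun _ s => H s (dual_basis e j) (e i))
                             (fun w s => Y w s (e j)) t (I i j)) /\
      {ae Pr, forall w, forall i, zeta w (e i) = \sum_j I i j w}.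

Section weak_star.
Context {L : lmodType F}.

Definition dual_valued (Y : Omega -> R -> L -> F) :=
  forall w t, 0 <= t -> linear (Y w t).

Definition weak_martingale (Y : Omega -> R -> L -> F) :=
  forall p, martingale (fun w t => Y w t p).

Definition weak_semimartingale (Y : Omega -> R -> L -> F) :=
  forall p, semimartingale (fun w t => Y w t p).

Definition weak_int (Y : R -> L -> F) (t : R) : L -> F :=
  fun p => sint lebesgue_measure `[0, t] (fun s => Y s p).

(* Z is a version of the integral of U_(t-s) against dY_s, where U_h is the
   adjoint of S_h and V_p a finite-dimensional S-invariant subspace
   containing p *)
Definition weak_stoch_int (S : R -> L -> L) (V : L -> submodClosed L)
    (Y Z : Omega -> R -> L -> F) :=
  weak_semimartingale Y /\
  dual_valued Z /\
  (forall p t, 0 <= t -> smeasurable measurable (fun w => Z w t p)) /\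
  forall p t, 0 <= t ->
    @dual_stoch_int (submod (V p)) (fun s => adjoint (restr (S (t - s))))
      (fun w s v => Y w s (val v)) t (fun w v => Z w t (val v)).

End weak_star.
End stochastic_processes.

Section polynomials.
Context {R : realType} {k : scalar_kind} {E : Type}.
Local Notation F := (scalars R k).
Context {P : submodClosed (E -> F)}.

Definition ev (p : submod P) (x : E) : F := (val p : E -> F) x.

Definition constant (p : submod P) := exists c, forall x, ev p x = c.

Variable deg : submod P -> nat.

Definition polynomial_space :=
  (forall c : F, (fun=> c : F) \in P) /\
  (forall p q : submod P, (deg (p + q)%R <= maxn (deg p) (deg q))%N) /\
  (forall (a : F) p, a != 0 -> deg (a *: p) = deg p) /\
  (forall p, deg p = 0%N <-> constant p).

Definition Pol (n : nat) : set (submod P) := [set p | (deg p <= n)%N].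

Definition complement01 (L : submodClosed (submod P)) :=
  (forall p : submod L, Pol 1 (val p)) /\
  (forall p : submod L, Pol 0 (val p) -> p = 0) /\
  (forall q, Pol 1 q -> exists p : submod L, Pol 0 (q - val p)).

Section projections.
Context {L : submodClosed (submod P)}.

(* the projections of P_1 = P_0 (+) L onto its summands *)
Definition Pi1 (q : submod P) : submod L :=
  xget 0 [set p : submod L | Pol 0 (q - val p)].

Definition Pi0 (q : submod P) : submod P := q - val (Pi1 q).

End projections.

Variable T : R -> {linear submod P -> submod P}.

Definition polynomial_action :=
  (forall h p, 0 <= h -> (deg (T h p) <= deg p)%N) /\
  (forall p, T 0 p = p) /\
  (forall h l p, 0 <= h -> 0 <= l -> T h (T l p) = T (h + l) p) /\
  (forall p x h, 0 <= h -> ev (T l p) x @[l --> h^'+] --> ev (T h p) x).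

Definition is_gen (p q : submod P) :=
  forall x : E,
    (ev (T h p) x - ev p x) / (mkS h 0 : F) @[h --> (0 : R)^'+] --> ev q x.

(* the generator, with value 0 outside its domain *)
Definition gen (p : submod P) : submod P := xget 0 (is_gen p).

Definition polynomial_process d (Omega : measurableType d)
    (Pr : probability Omega R) (Ft : R -> set (set Omega))
    (X : Omega -> R -> E) :=
  forall p : submod P,
    (forall t, 0 <= t -> sintegrable Pr (fun w => ev p (X w t))) /\
    (forall t h, 0 <= t -> 0 <= h ->
       cond_exp Pr (Ft t) (fun w => ev p (X w (t + h)))
                          (fun w => ev (T h p) (X w t))) /\
    (forall w, cadlag (fun t => ev p (X w t))) /\
    (forall t, 0 <= t -> smeasurable (Ft t) (fun w => ev p (X w t))).

Section complement.
Context {L : submodClosed (submod P)}.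

Definition T1 (h : R) (p : submod L) : submod L := Pi1 (T h (val p)).

Definition gen01 (p : submod L) : submod P := @Pi0 L (gen (val p)).

Definition gen1 (p : submod L) : submod L := Pi1 (gen (val p)).

(* the functional 1 on P_0, as evaluation at an arbitrary point *)
Definition one_functional (e : E) (c : submod P) : F := ev c e.

Definition assumptionF (V : submod L -> submodClosed (submod L)) :=
  forall p : submod L,
    fin_dim (submod (V p)) /\ p \in V p /\
    (forall h q, 0 <= h -> q \in V p -> T1 h q \in V p).

End complement.
End polynomials.

(* Main.v *)
(* On the span of 1 and a basis of V_p, the action is a right-continuous matrix
   semigroup a_h. With W_h its integral over [0, h], additivity of W yields
   a_h = 1 + W_h G = 1 + G W_h, where G is the matrix of the generator; thus P_1
   lies in the domain of the generator and T_h p - p is the integral of T_r Gp.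
   Integrating this identity against an event of F_s and exchanging the integrals
   gives the martingale property of M(p).
   The integrands U_(t-s) are deterministic and continuously differentiable, and
   M(p) is a cadlag path minus the primitive of a cadlag path. Their stochastic
   integral therefore exists path by path, as a limit of left-endpoint sums
   computed by partial summation, and a' = a G = G a makes it collapse to
   p(X_t) - T_t p(X_0). The P_0-part of T_t p is the integral of U_(t-s) b. *)

Require Import Defs.
From HB Require Import structures.
From mathcomp Require Import all_boot all_order all_algebra.
From mathcomp Require Import complex.
From mathcomp Require Import all_classical all_reals all_analysis.
From mathcomp Require Import measurable_realfun.
From mathcomp Require Import ring lra.
Set Implicit Arguments.
Unset Strict Implicit.
Unset Printing Implicit Defensive.
Import Order.TTheory GRing.Theory Num.Theory.
Import numFieldNormedType.Exports.
Local Open Scope classical_set_scope.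
Local Open Scope ring_scope.

(** * Real and complex scalars *)

(** The action is right-continuous only pointwise on E, and [T h 1 = 1] is not among its axioms. The
    coefficients of T_h inherit right-continuity by evaluation at finitely many points whose
    evaluation matrix is invertible; [T h 1 = 1] follows from the conditional expectation identity
    at time 0. As nothing is known at first about left limits of the semigroup, time integrals are
    handled through right-endpoint sums, which converge under right-continuity and boundedness alone
    ([tame]); the same sums give adaptedness, translation and reflection of integrals. G is found
    without differentiating a_h: W_h is invertible for some small h, which forces G = (a_h - 1)
    W_h^-1. The constant 1 joins the basis because T maps V_p only into P_0 + V_p. Since [stoch_int]
    asks for one approximating sequence of simple predictable processes, equidistant deterministic
    partitions suffice, and no general theory of stochastic integration is developed. All resulting
    identities hold on every path, so the almost sure clauses are met everywhere. *)

Section scalar_theory.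
Context {R : realType} {k : scalar_kind}.
Local Notation F := (scalars R k).

Lemma sRe_is_zmod_morphism : zmod_morphism (sRe : F -> R).
Proof. by case: k => // -[a b] [c e]. Qed.

HB.instance Definition _ :=
  GRing.isZmodMorphism.Build F R (@sRe R k) sRe_is_zmod_morphism.

Lemma sIm_is_zmod_morphism : zmod_morphism (sIm : F -> R).
Proof. by case: k => [x y|[a b] [c e]] //=; rewrite subr0. Qed.

HB.instance Definition _ :=
  GRing.isZmodMorphism.Build F R (@sIm R k) sIm_is_zmod_morphism.

Lemma sRe_mkS a b : sRe (mkS a b : F) = a.
Proof. by case: k. Qed.

Lemma sIm_mkS0 a : sIm (mkS a 0 : F) = 0.
Proof. by case: k. Qed.

Lemma mkS_sRe_sIm (z : F) : mkS (sRe z) (sIm z) = z.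
Proof. by case: k z => // -[]. Qed.

Lemma scalar_ext (x y : F) : sRe x = sRe y -> sIm x = sIm y -> x = y.
Proof. by move=> xy xy'; rewrite -[x]mkS_sRe_sIm xy xy' mkS_sRe_sIm. Qed.

Lemma sReM (x y : F) : sRe (x * y) = sRe x * sRe y - sIm x * sIm y.
Proof. by case: k x y => [x y|[a b] [c e]] //=; rewrite mulr0 subr0. Qed.

Lemma sImM (x y : F) : sIm (x * y) = sRe x * sIm y + sIm x * sRe y.
Proof. by case: k x y => [x y|[a b] [c e]] //=; rewrite mulr0 mul0r addr0. Qed.

Lemma mkS0_is_zmod_morphism : zmod_morphism (fun a => mkS a 0 : F).
Proof.
by move=> a b; apply: scalar_ext; rewrite raddfB/= ?sRe_mkS// !sIm_mkS0 subrr.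
Qed.

Lemma mkS0_is_monoid_morphism : monoid_morphism (fun a => mkS a 0 : F).
Proof.
split => [|a b]; first by case: k.
apply: scalar_ext; rewrite ?sReM ?sImM ?sRe_mkS !sIm_mkS0 ?sRe_mkS.
  by rewrite mulr0 subr0.
by rewrite mulr0 mul0r addr0.
Qed.

Definition rsc (a : R) : F := mkS a 0.

HB.instance Definition _ := GRing.isZmodMorphism.Build R F rsc
  mkS0_is_zmod_morphism.
HB.instance Definition _ := GRing.isMonoidMorphism.Build R F rsc
  mkS0_is_monoid_morphism.

Lemma sRe_rsc a : sRe (rsc a) = a. Proof. exact: sRe_mkS. Qed.
Lemma sIm_rsc a : sIm (rsc a) = 0. Proof. exact: sIm_mkS0. Qed.

Lemma sRe_rscM a (z : F) : sRe (rsc a * z) = a * sRe z.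
Proof. by rewrite sReM sRe_rsc sIm_rsc mul0r subr0. Qed.

Lemma sIm_rscM a (z : F) : sIm (rsc a * z) = a * sIm z.
Proof. by rewrite sImM sRe_rsc sIm_rsc mul0r addr0. Qed.

Lemma modulusE (z : F) : modulus z = Num.sqrt (sRe z ^+ 2 + sIm z ^+ 2).
Proof.
case: k z => [z|[a b]] //=.
by rewrite /modulus/= expr0n addr0 sqrtr_sqr.
Qed.

Lemma norm_rsc (z : F) : `|z| = rsc (modulus z).
Proof. by rewrite /rsc; case: k z => [z|[a b]]. Qed.

Lemma modulus_ge0 (z : F) : 0 <= modulus z.
Proof. by rewrite modulusE sqrtr_ge0. Qed.

Lemma rsc_inj : injective rsc.
Proof. by move=> a b ab; rewrite -(sRe_rsc a) ab sRe_rsc. Qed.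

Lemma rsc_le a b : (rsc a <= rsc b) = (a <= b).
Proof. by rewrite /rsc; case: k => //=; rewrite lecE/= eqxx. Qed.

Lemma rsc_lt a b : (rsc a < rsc b) = (a < b).
Proof. by rewrite lt_neqAle rsc_le (inj_eq rsc_inj) -lt_neqAle. Qed.

Lemma ler_modulusD (x y : F) : modulus (x + y) <= modulus x + modulus y.
Proof. by rewrite -rsc_le raddfD/= -!norm_rsc ler_normD. Qed.

Lemma modulusM (x y : F) : modulus (x * y) = modulus x * modulus y.
Proof. by apply: rsc_inj; rewrite rmorphM/= -!norm_rsc normrM. Qed.

Lemma modulusN (x : F) : modulus (- x) = modulus x.
Proof. by apply: rsc_inj; rewrite -!norm_rsc normrN. Qed.

Lemma modulusBC (x y : F) : modulus (x - y) = modulus (y - x).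
Proof. by rewrite -modulusN opprB. Qed.

Lemma modulus0 : modulus (0 : F) = 0.
Proof. by apply: rsc_inj; rewrite -!norm_rsc normr0 raddf0. Qed.

Lemma modulus_rsc a : modulus (rsc a) = `|a|.
Proof. by rewrite modulusE sRe_rsc sIm_rsc expr0n addr0 sqrtr_sqr. Qed.

Lemma ler_modulus_sum (I : finType) (f : I -> F) :
  modulus (\sum_i f i) <= \sum_i modulus (f i).
Proof.
elim/big_ind2 : _ => [|x x' y y' hx hy|//]; first by rewrite modulus0.
by apply: (le_trans (ler_modulusD _ _)); exact: lerD.
Qed.

Lemma sRe_le_modulus (z : F) : `|sRe z| <= modulus z.
Proof. by rewrite modulusE -sqrtr_sqr ler_wsqrtr// lerDl sqr_ge0. Qed.

Lemma sIm_le_modulus (z : F) : `|sIm z| <= modulus z.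
Proof. by rewrite modulusE -sqrtr_sqr ler_wsqrtr// lerDr sqr_ge0. Qed.

Lemma modulus_le (z : F) : modulus z <= `|sRe z| + `|sIm z|.
Proof.
rewrite modulusE -[leRHS]ger0_norm ?addr_ge0// -sqrtr_sqr ler_wsqrtr//.
rewrite sqrrD !real_normK ?num_real//.
by rewrite addrAC lerDl mulrn_wge0// mulr_ge0.
Qed.

(** Neighbourhoods in F are described by radii in F itself. A positive element of F equals its norm,
    hence is the image of a positive real, so real radii are enough. *)
Lemma scvg_modulusP {T : Type} (G : set_system T) {FG : Filter G}
    (f : T -> F) (l : F) :
  f x @[x --> G] --> l <->
  forall e : R, 0 < e -> \forall x \near G, modulus (l - f x) < e.
Proof.
split=> [/cvgrPdist_lt fl e e0|fl].
  have /fl : 0 < rsc e by rewrite -[0](raddf0 rsc) rsc_lt.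
  by apply: filterS => x; rewrite norm_rsc rsc_lt.
apply/cvgrPdist_lt => e e0.
have eE : e = rsc (sRe e).
  by rewrite -{2}(gtr0_norm e0) -/(modulus e) -norm_rsc gtr0_norm.
have e_gt0 : 0 < sRe e by rewrite -rsc_lt raddf0 -eE.
apply: filterS (fl _ e_gt0) => x.
by rewrite norm_rsc [in X in _ -> X]eE rsc_lt.
Qed.

Lemma scvgP {T : Type} (G : set_system T) {FG : Filter G}
    (f : T -> F) (l : F) :
  f x @[x --> G] --> l <->
  sRe (f x) @[x --> G] --> sRe l /\ sIm (f x) @[x --> G] --> sIm l.
Proof.
rewrite scvg_modulusP; split => [fl|[/cvgrPdist_lt fr /cvgrPdist_lt fi] e e0].
  by split; apply/cvgrPdist_lt => e /fl; apply: filterS => x; rewrite -raddfB;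
     apply: le_lt_trans; [exact: sRe_le_modulus|exact: sIm_le_modulus].
have e2 : 0 < e / 2 by rewrite divr_gt0.
move: (fr _ e2) (fi _ e2); apply: filterS2 => x hr hi.
apply: (le_lt_trans (modulus_le _)).
by rewrite [ltRHS](splitr e) !raddfB ltrD.
Qed.

End scalar_theory.

(** * Riemann sums of right-continuous functions *)

Section right_endpoint_sums.
Context {R : realType}.
Implicit Types (a b s : R).

Definition part a b n i : R := a + (b - a) * (i%:R / n.+1%:R).

Lemma part0 a b n : part a b n 0 = a.
Proof. by rewrite /part mul0r mulr0 addr0. Qed.

Lemma part_last a b n : part a b n n.+1 = b.
Proof. by rewrite /part divff ?mulr1 ?subrKC// pnatr_eq0. Qed.

Lemma partS a b n i : part a b n i.+1 = part a b n i + (b - a) / n.+1%:R.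
Proof. by rewrite /part -[i.+1%:R]natr1 [(_ + 1) / _]mulrDl mulrDr mul1r addrA. Qed.

Lemma le_part a b n i j : a <= b -> (i <= j)%N -> part a b n i <= part a b n j.
Proof.
by move=> ab ij; rewrite lerD2l ler_wpM2l ?subr_ge0// ler_wpM2r// ler_nat.
Qed.

Lemma part_itv a b n i : a <= b -> (i <= n.+1)%N -> a <= part a b n i <= b.
Proof.
move=> ab hi; have := le_part n ab (leq0n i); have := le_part n ab hi.
by rewrite part0 part_last => -> ->.
Qed.

Lemma part_locate a b n s : a <= s < b ->
  exists i : 'I_n.+1, part a b n i <= s < part a b n i.+1.
Proof.
move=> /andP[sa sb].
have : exists i, (i <= n.+1)%N && (s < part a b n i).
  by exists n.+1; rewrite leqnn part_last.
move=> /ex_minnP[[|i]]; first by rewrite part0 /= ltNge sa.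
move=> /andP[hi hs] hmin; exists (Ordinal hi); rewrite hs andbT leNgt.
by apply/negP => si; have := hmin i; rewrite si (ltnW hi) ltnn => /(_ isT).
Qed.

(* Sampling at right endpoints: right-continuity alone then gives pointwise
   convergence, see [cvg_rstep]. *)
Definition rstep (V : nmodType) (f : R -> V) a b n s : V :=
  \sum_(i < n.+1 | part a b n i <= s < part a b n i.+1) f (part a b n i.+1).

Lemma rstep_part (V : nmodType) (f : R -> V) a b n s (i : 'I_n.+1) : a <= b ->
  part a b n i <= s < part a b n i.+1 -> rstep f a b n s = f (part a b n i.+1).
Proof.
move=> ab si; rewrite /rstep (bigD1 i)//= big1 ?addr0// => j /andP[sj ji].
exfalso; move: si sj => /andP[i1 i2] /andP[j1 j2].
move: ji; rewrite neq_ltn => /orP[ij|ij].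
  by have := le_part n ab ij; rewrite leNgt (le_lt_trans i1 j2).
by have := le_part n ab ij; rewrite leNgt (le_lt_trans j1 i2).
Qed.

Lemma rstepE (V : nmodType) (f : R -> V) a b n s : a <= s < b ->
  exists t, [/\ s < t, t <= b, t - s <= (b - a) / n.+1%:R &
    rstep f a b n s = f t].
Proof.
move=> asb; have /andP[sa sb] := asb.
have ab : a <= b by apply: ltW; apply: le_lt_trans sb.
have [i si] := part_locate n asb; exists (part a b n i.+1).
split; first by case/andP: si.
- by have /andP[] := @part_itv a b n i.+1 ab (ltn_ord i).
- by rewrite partS lerBlDl lerD2r; case/andP: si.
- exact: rstep_part.
Qed.

Lemma cvg_mesh a b : (b - a) / n.+1%:R @[n --> \oo] --> (0 : R).
Proof.
rewrite -(mulr0 (b - a)); apply: cvgM; first exact: cvg_cst.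
exact: cvg_harmonic.
Qed.

Lemma cvg_rstep (f : R -> R) a b s : a <= s < b ->
  f r @[r --> s^'+] --> f s -> rstep f a b n s @[n --> \oo] --> f s.
Proof.
move=> asb /cvgrPdist_lt fs; apply/cvgrPdist_lt => e e0.
have [dl /= dl0 hdl] := fs e e0.
have /cvgrPdist_lt/(_ dl dl0) := cvg_mesh a b.
apply: filterS => n; rewrite sub0r normrN => hn.
have [t [st tb ts ->]] := rstepE f n asb.
apply: hdl => //=; rewrite distrC gtr0_norm ?subr_gt0//.
by apply: (le_lt_trans ts); apply: (le_lt_trans (ler_norm _)).
Qed.

Context d (T : measurableType d).

(** Each [rstep (Y w) a b n s] is a finite sum of products of a function of s and a function of w,
    hence jointly measurable, and right-continuity makes these steps converge pointwise. The
    interval is half-open because no cell lies to the right of b. *)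
Lemma measurable_rcont (Y : T -> R -> R) a b : a < b ->
  (forall s, a <= s <= b -> measurable_fun setT (Y^~ s)) ->
  (forall w s, a <= s < b -> Y w r @[r --> s^'+] --> Y w s) ->
  measurable_fun (setT `*` `[a, b[ : set (T * measurableTypeR R))
    (fun x => Y x.1 x.2).
Proof.
move=> ab mY rY.
apply: (@measurable_fun_cvg _ _ _ _ (fun n x => rstep (Y x.1) a b n x.2)).
  move=> n; apply: (@eq_measurable_fun _ _ _ _ _ (fun x : T * measurableTypeR R =>
     \sum_(i < n.+1) \1_(`[part a b n i, part a b n i.+1[) x.2 * Y x.1 (part a b n i.+1))).
    move=> x _; rewrite /rstep [RHS]big_mkcond/=; apply: eq_bigr => i _.
    rewrite indicE; have [si|si] := ifPn.
      by rewrite mem_set ?mul1r//= in_itv.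
    by rewrite memNset ?mul0r//= in_itv/=; apply/negP.
  apply: measurable_sum => i; apply: measurable_funM.
    apply: measurable_funTS; apply: measurableT_comp; last exact: measurable_snd.
    by apply: measurable_indic; exact: measurable_itv.
  apply: measurable_funTS.
  apply: (@measurableT_comp _ _ _ _ _ _ (Y^~ (part a b n i.+1))) => //.
  by apply: mY; rewrite part_itv// ltW.
by move=> [w s] [_ /=]; rewrite in_itv/= => asb; apply: cvg_rstep => //; exact: rY.
Qed.

End right_endpoint_sums.

(** * Scalar-valued integrals *)

Section real_integral.
Context d (T : measurableType d) {R : realType}.
Variable mu : {measure set T -> \bar R}.

Lemma Rintegral_sum (I : Type) (r : seq I) (D : set T) (f : I -> T -> R) :
  measurable D -> (forall i, mu.-integrable D (EFin \o f i)) ->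
  (\int[mu]_(x in D) (\sum_(i <- r) f i x) =
  \sum_(i <- r) \int[mu]_(x in D) f i x)%R.
Proof.
move=> mD hf; elim: r => [|i r ih].
  under eq_Rintegral do rewrite big_nil.
  by rewrite big_nil Rintegral_cst// mul0r.
under eq_Rintegral do rewrite big_cons.
rewrite big_cons -ih RintegralD//.
rewrite (_ : EFin \o _ = fun x => (\sum_(j <- r) (f j x)%:E)%E); last first.
  by apply/funext => x /=; rewrite sumEFin.
by apply: integrable_sum => // i0 _; exact: hf.
Qed.

End real_integral.

Section scalar_integral.
Context d (T : measurableType d) {R : realType} {k : scalar_kind}.
Local Notation F := (scalars R k).
Variable mu : {measure set T -> \bar R}.
Implicit Types (D : set T) (f g : T -> F).

Definition sL1 D f := mu.-integrable D (EFin \o (sRe \o f)) /\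
  mu.-integrable D (EFin \o (sIm \o f)).

Lemma sRe_sint D f : sRe (sint mu D f) = \int[mu]_(x in D) sRe (f x).
Proof. exact: sRe_mkS. Qed.

Lemma sIm_sint D f : sIm (sint mu D f) = \int[mu]_(x in D) sIm (f x).
Proof.
rewrite /sint; case: k f => //= f.
by rewrite /Rintegral (_ : (fun=> 0%:E) = cst 0%E)// integral0.
Qed.

Lemma eq_sint D f g : (forall x, D x -> f x = g x) -> sint mu D f = sint mu D g.
Proof.
by move=> fg; rewrite /sint; congr mkS; apply: eq_Rintegral => x /[!inE] /fg ->.
Qed.

Lemma eq_sL1 D f g : measurable D -> (forall x, D x -> f x = g x) -> sL1 D f -> sL1 D g.
Proof.
by move=> mD fg [f1 f2]; split; [move: f1|move: f2]; apply: eq_integrable => // x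
  /[!inE] Dx /=; rewrite fg.
Qed.

Lemma sL1S D D' f : measurable D -> measurable D' -> D' `<=` D ->
  sL1 D f -> sL1 D' f.
Proof.
by move=> mD mD' DD' [f1 f2]; split; [exact: integrableS f1|exact: integrableS f2].
Qed.

Lemma sL1D D f g : measurable D -> sL1 D f -> sL1 D g ->
  sL1 D (fun x => f x + g x).
Proof.
move=> mD [f1 f2] [g1 g2]; split.
  rewrite (_ : _ \o _ = (EFin \o (sRe \o f)) \+ (EFin \o (sRe \o g)))%E.
    exact: integrableD.
  by apply/funext => x /=; rewrite raddfD.
rewrite (_ : _ \o _ = (EFin \o (sIm \o f)) \+ (EFin \o (sIm \o g)))%E.
  exact: integrableD.
by apply/funext => x /=; rewrite raddfD.
Qed.

Lemma sintD D f g : measurable D -> sL1 D f -> sL1 D g ->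
  sint mu D (fun x => f x + g x) = sint mu D f + sint mu D g.
Proof.
move=> mD [f1 f2] [g1 g2]; apply: scalar_ext;
  rewrite raddfD/= !(sRe_sint, sIm_sint) -RintegralD//;
  by apply: eq_Rintegral => x _; rewrite raddfD.
Qed.

Lemma sL1Z D c f : measurable D -> sL1 D f -> sL1 D (fun x => c * f x).
Proof.
move=> mD [f1 f2]; split.
  rewrite (_ : _ \o _ = (fun x => (sRe c)%:E * (sRe (f x))%:E)
     \- (fun x => (sIm c)%:E * (sIm (f x))%:E))%E.
    by apply: integrableB => //; exact: integrableZl.
  by apply/funext => x /=; rewrite sReM.
rewrite (_ : _ \o _ = (fun x => (sRe c)%:E * (sIm (f x))%:E)
   \+ (fun x => (sIm c)%:E * (sRe (f x))%:E))%E.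
  by apply: integrableD => //; exact: integrableZl.
by apply/funext => x /=; rewrite sImM.
Qed.

Lemma sintZ D c f : measurable D -> sL1 D f ->
  sint mu D (fun x => c * f x) = c * sint mu D f.
Proof.
move=> mD [f1 f2].
have Z1 a : mu.-integrable D (EFin \o (fun x => a * sRe (f x))).
  by rewrite (_ : _ \o _ = (fun x => a%:E * (sRe (f x))%:E)%E)//; exact: integrableZl.
have Z2 a : mu.-integrable D (EFin \o (fun x => a * sIm (f x))).
  by rewrite (_ : _ \o _ = (fun x => a%:E * (sIm (f x))%:E)%E)//; exact: integrableZl.
apply: scalar_ext; rewrite ?(sReM, sImM) !sRe_sint !sIm_sint.
  rewrite -!RintegralZl// -RintegralB//.
  by apply: eq_Rintegral => x _; rewrite sReM.
rewrite -!RintegralZl// -RintegralD//.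
by apply: eq_Rintegral => x _; rewrite sImM.
Qed.

Lemma sL1N D f : measurable D -> sL1 D f -> sL1 D (fun x => - f x).
Proof.
move=> mD /(sL1Z (-1) mD); apply: eq_sL1 => // x _.
by rewrite mulN1r.
Qed.

Lemma sL1B D f g : measurable D -> sL1 D f -> sL1 D g ->
  sL1 D (fun x => f x - g x).
Proof. by move=> mD hf hg; apply: sL1D => //; exact: sL1N. Qed.

Lemma sintN D f : measurable D -> sL1 D f ->
  sint mu D (fun x => - f x) = - sint mu D f.
Proof.
by move=> mD hf; rewrite -mulN1r -sintZ//; apply: eq_sint => x _; rewrite mulN1r.
Qed.

Lemma sintB D f g : measurable D -> sL1 D f -> sL1 D g ->
  sint mu D (fun x => f x - g x) = sint mu D f - sint mu D g.
Proof. by move=> mD hf hg; rewrite sintD ?sintN//; exact: sL1N. Qed.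

Lemma sint0 D : sint mu D (fun=> 0 : F) = 0.
Proof.
by apply: scalar_ext; rewrite ?sRe_sint ?sIm_sint !raddf0 /Rintegral integral0.
Qed.

Lemma sL10 D : measurable D -> sL1 D (fun=> 0 : F).
Proof.
by move=> mD; split; rewrite [X in _.-integrable _ X](_ : _ = cst 0%E);
  [exact: integrable0| by apply/funext => x /=; rewrite raddf0
  |exact: integrable0| by apply/funext => x /=; rewrite raddf0].
Qed.

Lemma sL1_sum (I : Type) (r : seq I) D (f : I -> T -> F) :
  measurable D -> (forall i, sL1 D (f i)) -> sL1 D (fun x => \sum_(i <- r) f i x).
Proof.
move=> mD hf; elim: r => [|i r ih].
  by apply: (eq_sL1 mD _ (sL10 mD)) => x _; rewrite big_nil.
by apply: (eq_sL1 mD _ (sL1D mD (hf i) ih)) => x _; rewrite big_cons.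
Qed.

Lemma sint_sum (I : Type) (r : seq I) D (f : I -> T -> F) :
  measurable D -> (forall i, sL1 D (f i)) ->
  sint mu D (fun x => \sum_(i <- r) f i x) = \sum_(i <- r) sint mu D (f i).
Proof.
move=> mD hf; elim: r => [|i r ih].
  by rewrite big_nil -[RHS](sint0 D); apply: eq_sint => x _; rewrite big_nil.
rewrite big_cons -ih -sintD//; last exact: sL1_sum.
by apply: eq_sint => x _; rewrite big_cons.
Qed.

End scalar_integral.

(** * Riemann sums weighted by an integrable function *)

Section riemann_sums.
Context {R : realType}.
Local Notation mu := (@lebesgue_measure R).
Implicit Types (f g : R -> R) (a b : R).

Lemma integrable_rcont f a b :
  (forall s, a <= s < b -> f r @[r --> s^'+] --> f s) ->
  (exists K, forall s, a <= s <= b -> `|f s| <= K) ->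
  mu.-integrable `[a, b] (EFin \o f).
Proof.
move=> rf [K fK]; apply: measurable_bounded_integrable => //.
- by rewrite /= lebesgue_measure_itv/=; case: ifP => // _; rewrite -EFinB ltry.
- have [ab|ba] := ltP a b; last first.
    have [->|ab] := eqVneq a b; first by rewrite set_itv1; exact: measurable_fun_set1.
    rewrite set_itv_ge; first exact: measurable_fun_set0.
    by rewrite bnd_simp -ltNge lt_neqAle eq_sym ab.
  apply/measurable_fun_itv_bndo_bndcP.
  (* Joint measurability with the one-point space as parameter is measurability of f. *)
  have mF := @measurable_rcont R _ unit (fun _ : unit => f) a b ab
    (fun s _ => measurable_cst (f s)) (fun _ => rf).
  have -> : f = (fun x : unit * measurableTypeR R => f x.2) \o (pair tt) by [].
  apply: (measurable_comp _ _ mF).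
  - by apply: measurableX => //; exact: measurable_itv.
  - by move=> _ [s /= sab <-].
  - by apply: measurable_funTS; exact: pair1_measurable.
- exists K; split; first exact: num_real.
  move=> x Kx s /=; rewrite in_itv/= => sab.
  by apply: (le_trans _ (ltW Kx)); exact: fK.
Qed.

Lemma Rintegral_rstep f g a b n : a < b ->
  mu.-integrable `[a, b] (EFin \o g) ->
  \int[mu]_(s in `[a, b[) (rstep f a b n s * g s) =
  \sum_(i < n.+1) f (part a b n i.+1) *
    \int[mu]_(s in `[part a b n i, part a b n i.+1]) g s.
Proof.
move=> ab ig.
pose J i := `[part a b n i, part a b n i.+1[%classic.
have Jab (i : 'I_n.+1) : J i `<=` `[a, b[.
  move=> s; rewrite /J /= !in_itv/= => /andP[s1 s2].
  have /andP[_ ?] := @part_itv _ a b n i.+1 (ltW ab) (ltn_ord i).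
  have /andP[? _] := @part_itv _ a b n i (ltW ab) (ltnW (ltn_ord i)).
  by rewrite (le_trans _ s1)//= (lt_le_trans s2).
have ig' : mu.-integrable `[a, b[ (EFin \o g).
  by apply: integrableS ig => //; exact: subset_itv_co_cc.
have igJ (i : 'I_n.+1) : mu.-integrable (J i) (EFin \o g).
  by apply: integrableS ig' => //; exact: measurable_itv.
have igr (i : 'I_n.+1) : mu.-integrable `[a, b[ (EFin \o (g \_ (J i))).
  apply: (integrableS measurableT) => //.
  by rewrite -restrict_EFin; apply: (integrable_mkcond _ _).1;
    [exact: measurable_itv|exact: igJ].
transitivity (\int[mu]_(s in `[a, b[)
    (\sum_(i < n.+1) (f (part a b n i.+1) * (g \_ (J i)) s))).
  apply: eq_Rintegral => s _; rewrite /rstep big_mkcond mulr_suml.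
  apply: eq_bigr => i _; rewrite /restrict; case: ifPn => si.
    by rewrite mem_set.
  by rewrite memNset ?mulr0 ?mul0r//=; rewrite ?in_itv; exact/negP.
rewrite Rintegral_sum//; last first.
  move=> i; rewrite (_ : _ \o _ = fun s =>
    ((f (part a b n i.+1))%:E * (EFin \o (g \_ (J i))) s)%E)//.
  exact: integrableZl.
apply: eq_bigr => i _.
rewrite RintegralZl//; congr (_ * _).
rewrite -Rintegral_mkcondr (_ : _ `&` _ = J i).
2: by apply/seteqP; split => [s []//|s Js]; split => //; exact: (Jab _ _ Js).
exact: (Rintegral_itv_bndo_bndc (igJ i)).
Qed.

(** Dominated convergence for [rstep f] times g, with majorant K |g|. The weights are integrals of g
    over the cells because increments of a primitive appear in this form after partial summation; g
    = 1 gives ordinary Riemann sums. *)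
Lemma cvg_Rintegral_right_sum f g a b : a <= b ->
  (forall s, a <= s < b -> f r @[r --> s^'+] --> f s) ->
  (exists K, forall s, a <= s <= b -> `|f s| <= K) ->
  mu.-integrable `[a, b] (EFin \o g) ->
  \sum_(i < n.+1) f (part a b n i.+1) *
    \int[mu]_(s in `[part a b n i, part a b n i.+1]) g s @[n --> \oo] -->
  \int[mu]_(s in `[a, b]) (f s * g s).
Proof.
rewrite le_eqVlt => /predU1P[<-|ab] rf [K fK] ig.
  rewrite set_itv1 Rintegral_set1; under eq_cvg => n.
    rewrite big1; last first.
      by move=> i _; rewrite /part subrr !mul0r addr0 set_itv1 Rintegral_set1 mulr0.
    over.
  exact: cvg_cst.
have mf : measurable_fun `[a, b] f.
  apply/measurable_EFinP.
  exact: (measurable_int mu (integrable_rcont rf (ex_intro _ K fK))).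
have mg : measurable_fun `[a, b] g.
  by apply/measurable_EFinP; exact: (measurable_int mu ig).
have sub := @subset_itv_co_cc _ R a b.
have mg' : measurable_fun `[a, b[ g by apply: measurable_funS mg.
have mf' : measurable_fun `[a, b[ f by apply: measurable_funS mf.
have ig' : mu.-integrable `[a, b[ (EFin \o g) by apply: integrableS ig.
have mr n : measurable_fun `[a, b[ (rstep f a b n).
  apply: (@eq_measurable_fun _ _ _ _ _ (fun s =>
     \sum_(i < n.+1) \1_(`[part a b n i, part a b n i.+1[) s * f (part a b n i.+1))).
    move=> x _; rewrite /rstep [RHS]big_mkcond/=; apply: eq_bigr => i _.
    rewrite indicE; have [si|si] := ifPn.
      by rewrite mem_set ?mul1r//= in_itv.
    by rewrite memNset ?mul0r//= in_itv/=; apply/negP.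
  apply: measurable_sum => i; apply: measurable_funM => //.
have dom n s : `[a, b[%classic s ->
    (`|(rstep f a b n s * g s)%:E| <= (K * `|g s|)%:E)%E.
  rewrite /= in_itv/= => sab; have [t [st tb _ ->]] := rstepE f n sab.
  rewrite lee_fin normrM ler_wpM2r//; apply: fK; rewrite tb andbT.
  by case/andP: sab => sa _; rewrite (le_trans sa)// ltW.
have [|||||_ _] := @dominated_convergence _ _ R mu `[a, b[%classic
    (measurable_itv _) (fun n s => (rstep f a b n s * g s)%:E)
    (fun s => (f s * g s)%:E) (fun s => (K * `|g s|)%:E).
- by move=> n; apply/measurable_EFinP; apply: measurable_funM; [exact: mr|exact: mg'].
- by apply/measurable_EFinP; exact: measurable_funM.
- apply: aeW => s /=; rewrite in_itv/= => sab.
  by apply: cvg_EFin; [exact: nearW|apply: cvgM; [exact: cvg_rstep (rf _ _)|exact: cvg_cst]].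
- rewrite (_ : (fun s => _) = (fun s => K%:E * (`|g s|)%:E)%E)//.
  by apply: integrableZl => //; exact: (integrable_norm ig').
- by apply: aeW => s n; exact: dom.
move=> h.
have ifg : mu.-integrable `[a, b[ (EFin \o (fun s => f s * g s)).
  apply: (@le_integrable _ _ _ mu _ _ _ (fun s => (K * `|g s|)%:E)) => //.
  - by apply/measurable_EFinP; exact: measurable_funM.
  - move=> s /=; rewrite in_itv/= => /andP[sa sb].
    rewrite lee_fin normrM [leRHS]ger0_norm ?mulr_ge0//.
      by rewrite ler_wpM2r// fK// sa ltW.
    by apply: le_trans (fK s _); rewrite // sa ltW.
  - rewrite (_ : (fun s => _) = (fun s => K%:E * (`|g s|)%:E)%E)//.
    by apply: integrableZl => //; exact: (integrable_norm ig').
rewrite -Rintegral_itv_bndo_bndc//.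
move: h; rewrite -[X in _ --> X]fineK; last exact: integrable_fin_num.
move=> /fine_cvg; apply: cvg_trans; apply: near_eq_cvg; apply: nearW => n.
by rewrite -Rintegral_rstep.
Qed.

End riemann_sums.

(** * Bounded right-continuous integrands *)

Section tame.
Context {R : realType} {k : scalar_kind}.
Local Notation F := (scalars R k).
Local Notation mu := (@lebesgue_measure R).
Implicit Types (f g : R -> F) (a b c h : R).

(** Weak enough for the entries of a right-continuous semigroup and for cadlag paths, strong enough
    for right-endpoint sums to converge to the integral; stable under sums and products. Nothing is
    asked to the left of a point, so reversing time may leave the class. *)
Definition tame a b f :=
  (forall s, a <= s < b -> f r @[r --> s^'+] --> f s) /\
  exists K, forall s, a <= s <= b -> modulus (f s) <= K.

Lemma tame_cst a b (c : F) : tame a b (fun=> c).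
Proof. by split=> [s _|]; [exact: cvg_cst|exists (modulus c)]. Qed.

Lemma tameD a b f g : tame a b f -> tame a b g -> tame a b (fun s => f s + g s).
Proof.
move=> [rf [K fK]] [rg [K' gK]]; split=> [s sab|].
  by apply: cvgD; [exact: rf|exact: rg].
exists (K + K') => s sab.
by apply: (le_trans (ler_modulusD _ _)); rewrite lerD ?fK ?gK.
Qed.

Lemma tameM a b f g : tame a b f -> tame a b g -> tame a b (fun s => f s * g s).
Proof.
move=> [rf [K fK]] [rg [K' gK]]; split=> [s sab|].
  by apply: cvgM; [exact: rf|exact: rg].
exists (K * K') => s sab.
by rewrite modulusM ler_pM ?modulus_ge0 ?fK ?gK.
Qed.

Lemma tame_sum (I : Type) (r : seq I) a b (f : I -> R -> F) :
  (forall i, tame a b (f i)) -> tame a b (fun s => \sum_(i <- r) f i s).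
Proof.
move=> tf; elim: r => [|i r ih].
  rewrite (_ : (fun s => _) = fun=> 0); first exact: tame_cst.
  by apply/funext => s; rewrite big_nil.
rewrite (_ : (fun s => _) = fun s => f i s + \sum_(j <- r) f j s).
  exact: tameD.
by apply/funext => s; rewrite big_cons.
Qed.

Lemma tameS a b a' b' f : a <= a' -> b' <= b -> tame a b f -> tame a' b' f.
Proof.
move=> aa bb [rf [K fK]]; split=> [s /andP[s1 s2]|].
  by apply: rf; rewrite (le_trans aa)// (lt_le_trans s2).
by exists K => s /andP[s1 s2]; apply: fK; rewrite (le_trans aa)// (le_trans s2).
Qed.

Lemma eq_tame a b f g : (forall s, a <= s <= b -> f s = g s) ->
  tame a b f -> tame a b g.
Proof.
move=> fg [rf [K fK]]; split=> [s /andP[sa sb]|].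
  rewrite -fg ?sa ?ltW//; apply: cvg_trans (rf s _); last by rewrite sa.
  apply: near_eq_cvg; near=> r; rewrite fg//.
  have sr : s < r by near: r; exact: nbhs_right_gt.
  by rewrite (le_trans sa (ltW sr))/=; near: r; exact: nbhs_right_le.
by exists K => s sab; rewrite -fg// fK.
Unshelve. all: by end_near. Qed.

Lemma cvg_right_shift (V : topologicalType) (f : R -> V) h s (l : V) :
  f r @[r --> (s + h)^'+] --> l -> f (r + h) @[r --> s^'+] --> l.
Proof.
move=> fl; apply: (@cvg_comp _ _ _ (fun r => r + h) f) fl => A [e /= e0 hA].
exists e => //= r /= sr rs; apply: hA => /=; last by rewrite ltrD2r.
by rewrite opprD addrACA subrr addr0.
Qed.

Lemma tame_shift a b h f : tame (a + h) (b + h) f -> tame a b (fun s => f (s + h)).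
Proof.
move=> [rf [K fK]]; split=> [s /andP[s1 s2]|].
  by apply: cvg_right_shift; apply: rf; rewrite lerD2r s1 ltrD2r.
by exists K => s /andP[s1 s2]; apply: fK; rewrite !lerD2r s1.
Qed.

Lemma tame_sRe a b f : tame a b f ->
  (forall s, a <= s < b -> sRe (f r) @[r --> s^'+] --> sRe (f s)) /\
  exists K, forall s, a <= s <= b -> `|sRe (f s)| <= K.
Proof.
move=> [rf [K fK]]; split=> [s /rf/scvgP[]//|].
by exists K => s /fK; apply: le_trans; exact: sRe_le_modulus.
Qed.

Lemma tame_sIm a b f : tame a b f ->
  (forall s, a <= s < b -> sIm (f r) @[r --> s^'+] --> sIm (f s)) /\
  exists K, forall s, a <= s <= b -> `|sIm (f s)| <= K.
Proof.
move=> [rf [K fK]]; split=> [s /rf/scvgP[]//|].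
by exists K => s /fK; apply: le_trans; exact: sIm_le_modulus.
Qed.

Lemma tame_rsc a b (u : R -> R) :
  (forall s, a <= s < b -> u r @[r --> s^'+] --> u s) ->
  (exists K, forall s, a <= s <= b -> `|u s| <= K) ->
  tame a b (fun s => rsc (u s) : F).
Proof.
move=> ru [K uK]; split; last by exists K => s sab; rewrite modulus_rsc uK.
move=> s sab; apply/scvgP; rewrite sRe_rsc sIm_rsc; split.
  by under eq_cvg do rewrite sRe_rsc; exact: ru.
by under eq_cvg do rewrite sIm_rsc; exact: cvg_cst.
Qed.

Lemma tame_modulus a b f : tame a b f -> tame a b (fun s => rsc (modulus (f s)) : F).
Proof.
move=> [rf [K fK]]; apply: tame_rsc; last first.
  by exists K => s sab; rewrite ger0_norm ?modulus_ge0// fK.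
move=> s sab.
have /scvgP[+ _] : `|f r| @[r --> s^'+] --> `|f s| by apply: cvg_norm; exact: rf.
by apply: cvg_trans.
Qed.

Lemma sL1_tame a b f : tame a b f -> sL1 mu `[a, b] f.
Proof.
move=> tf; split.
  by have [rf bf] := tame_sRe tf; exact: (integrable_rcont rf bf).
by have [rf bf] := tame_sIm tf; exact: (integrable_rcont rf bf).
Qed.

(** Only boundedness needs an argument: one-sided limits bound f near each point of the segment, and
    compactness, in near-covering form with the bound sent to +oo, makes the bound uniform. *)
Lemma cadlag_tame a b f : 0 <= a -> cadlag f -> tame a b f.
Proof.
move=> a0 [rf lf]; split=> [s /andP[sa _]|]; first exact/rf/(le_trans a0).
have : near_covering (`[a, b] : set R).
  by rewrite -compact_near_coveringP; exact: segment_compact.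
move=> /(_ R (+oo%R) (fun K s => a <= s -> modulus (f s) <= K) _).
have locb (G : set_system R) (l : F) : Filter G -> f r @[r --> G] --> l ->
    \forall r \near G, modulus (f r) <= modulus l + 1.
  move=> FG /scvg_modulusP/(_ 1 ltr01); apply: filterS => r rl.
  rewrite -[f r](subrK l) addrC; apply: (le_trans (ler_modulusD _ _)).
  by rewrite lerD2l modulusBC ltW.
case=> [s|K [_ hK]].
  rewrite /= in_itv/= => /andP[as_ sb].
  have hr := locb _ _ _ (rf s (le_trans a0 as_)).
  have [K hl] : exists K, \forall r \near s^'-, a <= r -> modulus (f r) <= K.
    move: as_; rewrite le_eqVlt => /predU1P[->|as_].
      (* At s = a the guard [a <= r] excludes every point on the left, so any bound will do. *)
      exists 0; apply: filterS (nbhs_left_lt s) => r rs.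
      by rewrite leNgt rs.
    have /cvg_ex[l /locb hl] := lf s (le_lt_trans a0 as_).
    by exists (modulus l + 1); apply: filterS hl => r + _.
  pose K' := Num.max (modulus (f s) + 1) K.
  have : \forall r \near s, a <= r -> modulus (f r) <= K'.
    have {}hr : \forall r \near s, s < r -> modulus (f r) <= modulus (f s) + 1.
      exact: hr.
    have {}hl : \forall r \near s, r < s -> a <= r -> modulus (f r) <= K.
      exact: hl.
    apply: filterS2 hr hl => r hr hl ra.
    have [rs|rs|->] := ltgtP r s.
    - by rewrite le_max; apply/orP; right; exact: hl.
    - by rewrite le_max hr.
    - by rewrite le_max lerDl ler01.
  move=> hK'; exists ((fun r => a <= r -> modulus (f r) <= K'), [set K0 | K' < K0]) => /=.
    by split => //; apply: nbhs_pinfty_gt; exact: num_real.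
  by move=> [r K0] /= [h1 h2] /h1 /le_trans; apply; exact: ltW.
exists (K + 1) => s sab; apply: (hK (K + 1)); first by rewrite ltrDl.
  by rewrite /= in_itv.
by case/andP: sab.
Unshelve. all: by end_near. Qed.

End tame.

(** * Calculus of integrals over compact intervals *)

Section interval_integral.
Context {R : realType} {k : scalar_kind}.
Local Notation F := (scalars R k).
Local Notation mu := (@lebesgue_measure R).
Implicit Types (f g : R -> F) (a b c h : R).

Lemma sint_itvZ a b (z : F) f : tame a b f ->
  sint mu `[a, b] (fun s => z * f s) = z * sint mu `[a, b] f.
Proof. by move=> tf; apply: sintZ => //; exact: sL1_tame. Qed.

Lemma sint_itvD a b f g : tame a b f -> tame a b g ->
  sint mu `[a, b] (fun s => f s + g s) = sint mu `[a, b] f + sint mu `[a, b] g.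
Proof. by move=> tf tg; apply: sintD => //; exact: sL1_tame. Qed.

Lemma sint_itv_sum (I : Type) (r : seq I) a b (f : I -> R -> F) :
  (forall i, tame a b (f i)) ->
  sint mu `[a, b] (fun s => \sum_(i <- r) f i s) =
  \sum_(i <- r) sint mu `[a, b] (f i).
Proof. by move=> tf; apply: sint_sum => // i; exact: sL1_tame. Qed.

(** The product in F expands into four real products, each covered by the real weighted sums. *)
Lemma sint_right_sum a b f g : a <= b -> tame a b f -> tame a b g ->
  \sum_(i < n.+1) f (part a b n i.+1) *
    sint mu `[part a b n i, part a b n i.+1] g @[n --> \oo] -->
  sint mu `[a, b] (fun s => f s * g s).
Proof.
move=> ab tf tg.
have [rf1 bf1] := tame_sRe tf; have [rf2 bf2] := tame_sIm tf.
have [rg1 bg1] := tame_sRe tg; have [rg2 bg2] := tame_sIm tg.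
have ig1 := integrable_rcont rg1 bg1; have ig2 := integrable_rcont rg2 bg2.
have c11 := cvg_Rintegral_right_sum ab rf1 bf1 ig1.
have c12 := cvg_Rintegral_right_sum ab rf1 bf1 ig2.
have c21 := cvg_Rintegral_right_sum ab rf2 bf2 ig1.
have c22 := cvg_Rintegral_right_sum ab rf2 bf2 ig2.
have int (u v : R -> F) : tame a b u -> tame a b v -> [/\
    mu.-integrable `[a, b] (EFin \o (fun s => sRe (u s) * sRe (v s))),
    mu.-integrable `[a, b] (EFin \o (fun s => sRe (u s) * sIm (v s))),
    mu.-integrable `[a, b] (EFin \o (fun s => sIm (u s) * sRe (v s))) &
    mu.-integrable `[a, b] (EFin \o (fun s => sIm (u s) * sIm (v s)))].
  have prod (p q : R -> R) :
      (forall s, a <= s < b -> p r @[r --> s^'+] --> p s) ->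
      (exists K, forall s, a <= s <= b -> `|p s| <= K) ->
      (forall s, a <= s < b -> q r @[r --> s^'+] --> q s) ->
      (exists K, forall s, a <= s <= b -> `|q s| <= K) ->
      mu.-integrable `[a, b] (EFin \o (fun s => p s * q s)).
    move=> rp [K pK] rq [K' qK]; apply: integrable_rcont.
      by move=> s sab; apply: cvgM; [exact: rp|exact: rq].
    by exists (K * K') => s sab; rewrite normrM ler_pM// ?pK ?qK.
  move=> tu tv; have [ru1 bu1] := tame_sRe tu; have [ru2 bu2] := tame_sIm tu.
  have [rv1 bv1] := tame_sRe tv; have [rv2 bv2] := tame_sIm tv.
  by split; apply: prod.
have [i11 i12 i21 i22] := int _ _ tf tg.
apply/scvgP; split.
  rewrite sRe_sint; under eq_Rintegral do rewrite sReM.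
  rewrite RintegralB//; apply: cvg_trans (cvgB c11 c22).
  apply: near_eq_cvg; apply: nearW => n /=.
  rewrite raddf_sum [LHS]/= -[LHS]sumrB; apply: eq_bigr => i _.
  by rewrite /= sReM sRe_sint sIm_sint.
rewrite sIm_sint; under eq_Rintegral do rewrite sImM.
rewrite RintegralD//; apply: cvg_trans (cvgD c12 c21).
apply: near_eq_cvg; apply: nearW => n /=.
rewrite raddf_sum [LHS]/= -[LHS]big_split; apply: eq_bigr => i _.
by rewrite /= sImM sRe_sint sIm_sint.
Qed.

Lemma sint_itv1 a f : sint mu `[a, a] f = 0.
Proof.
rewrite set_itv1; apply: scalar_ext.
  by rewrite sRe_sint Rintegral_set1 raddf0.
by rewrite sIm_sint Rintegral_set1 raddf0.
Qed.

Lemma sint_cst a b (c : F) : a <= b -> sint mu `[a, b] (fun=> c) = rsc (b - a) * c.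
Proof.
move=> ab; have E r : \int[mu]_(x in `[a, b]) (cst r x) = (b - a) * r.
  rewrite Rintegral_cst//= mulrC; congr (_ * _).
  rewrite lebesgue_measure_itv/= lte_fin.
  by move: ab; rewrite le_eqVlt => /predU1P[->|->//]; rewrite ltxx subrr.
apply: scalar_ext.
  by rewrite sRe_sint sRe_rscM -E.
by rewrite sIm_sint sIm_rscM -E.
Qed.

Lemma sint_right_riemann a b f : a <= b -> tame a b f ->
  \sum_(i < n.+1) f (part a b n i.+1) * rsc ((b - a) / n.+1%:R) @[n --> \oo] -->
  sint mu `[a, b] f.
Proof.
move=> ab tf.
have := sint_right_sum ab tf (tame_cst a b 1).
rewrite (@eq_sint _ _ _ _ mu _ (fun s => f s * 1) f) => [|s _]; last by rewrite mulr1.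
apply: cvg_trans; apply: near_eq_cvg; apply: nearW => n.
apply: eq_bigr => i _; rewrite sint_cst ?mulr1 ?le_part//.
by rewrite partS [part _ _ _ _ + _]addrC addrK.
Qed.

(** Translation carries the partition of one interval to that of the other, so both integrals are
    limits of the same Riemann sums. *)
Lemma sint_shift a b h f : a <= b -> tame (a + h) (b + h) f ->
  sint mu `[a + h, b + h] f = sint mu `[a, b] (fun s => f (s + h)).
Proof.
move=> ab tf.
have c1 : \sum_(i < n.+1) f (part (a + h) (b + h) n i.+1) *
    rsc ((b + h - (a + h)) / n.+1%:R) @[n --> \oo] --> sint mu `[a + h, b + h] f.
  have abh : a + h <= b + h by rewrite lerD2r.
  exact: (sint_right_riemann abh tf).
have c2 := sint_right_riemann ab (tame_shift tf).
have E : b + h - (a + h) = b - a by ring.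
apply: (norm_cvg_unique c1); apply: cvg_trans c2.
apply: near_eq_cvg; apply: nearW => n.
apply: eq_bigr => i _; rewrite E; congr (f _ * _).
by rewrite /part E addrAC.
Qed.

Lemma sint_cat a b c f : a <= b -> b <= c -> tame a c f ->
  sint mu `[a, c] f = sint mu `[a, b] f + sint mu `[b, c] f.
Proof.
move=> ab bc tf.
have [i1 i2] := sL1_tame tf.
have E (u : R -> R) : mu.-integrable `[a, c] (EFin \o u) ->
    \int[mu]_(x in `[a, c]) u x =
    \int[mu]_(x in `[a, b]) u x + \int[mu]_(x in `[b, c]) u x.
  move=> iu; have := @Rintegral_itvB R u (BLeft a) (BRight c) b iu.
  rewrite !bnd_simp => /(_ ab bc)/eqP; rewrite subr_eq => /eqP ->.
  rewrite addrC Rintegral_itv_obnd_cbnd//.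
  apply: integrableS iu => //; apply: subset_itvr.
  by rewrite bnd_simp.
apply: scalar_ext.
  by rewrite raddfD/= !sRe_sint E.
by rewrite raddfD/= !sIm_sint E.
Qed.

(** The factor 2 is the price of bounding the real and imaginary parts separately; only the order in
    b - a matters later. *)
Lemma modulus_sint_le a b f K : a <= b -> tame a b f ->
  (forall s, a <= s <= b -> modulus (f s) <= K) ->
  modulus (sint mu `[a, b] f) <= 2 * K * (b - a).
Proof.
move=> ab tf fK; have [i1 i2] := sL1_tame tf.
have E (u : R -> R) : mu.-integrable `[a, b] (EFin \o u) ->
    (forall s, a <= s <= b -> `|u s| <= K) ->
    `|\int[mu]_(x in `[a, b]) u x| <= K * (b - a).
  move=> iu uK; apply: (le_trans (le_normr_Rintegral _ iu)) => //.
  have -> : K * (b - a) = \int[mu]_(x in `[a, b]) (cst K x).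
    rewrite Rintegral_cst//= lebesgue_measure_itv/= lte_fin.
    by move: ab; rewrite le_eqVlt => /predU1P[->|->//]; rewrite ltxx subrr.
  apply: le_Rintegral => //; first exact: (integrable_norm iu).
  apply: (@integrable_rcont R (cst K)); first by move=> s _; exact: cvg_cst.
  by exists `|K|.
apply: (le_trans (modulus_le _)); rewrite sRe_sint sIm_sint -mulrA mulr_natl mulr2n.
apply: lerD; apply: E => // s sab; apply: (le_trans _ (fK s sab)).
  exact: sRe_le_modulus.
exact: sIm_le_modulus.
Qed.

Lemma sint_right_diff a b f : a < b -> tame a b f ->
  (rsc h)^-1 * sint mu `[a, a + h] f @[h --> (0 : R)^'+] --> f a.
Proof.
move=> ab tf; have [rf _] := tf.
apply/scvg_modulusP => e e0.
(* With the factor 2 of [modulus_sint_le], a quarter of e leaves e / 2, strictly below e. *)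
have e4 : 0 < e / 4 by rewrite divr_gt0.
have /rf/scvg_modulusP/(_ _ e4) : a <= a < b by rewrite lexx.
move=> [dl /= dl0 hdl].
have dab : 0 < Num.min dl (b - a) by rewrite lt_min dl0 subr_gt0.
near=> h.
have h0 : 0 < h by near: h; exact: nbhs_right_gt.
have : h < Num.min dl (b - a) by near: h; exact: nbhs_right_lt.
rewrite lt_min => /andP[hd hb].
have tfh : tame a (a + h) f by apply: tameS tf; rewrite // -lerBrDl ltW.
have rh0 : rsc h != 0 :> F by rewrite -[0](raddf0 rsc) (inj_eq rsc_inj) gt_eqF.
have ah : a <= a + h by rewrite lerDl ltW.
have -> : f a = (rsc h)^-1 * sint mu `[a, a + h] (fun=> f a).
  by rewrite sint_cst// addrC addKr mulrA mulVf// mul1r.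
rewrite -mulrBr -sintB//; [|exact/sL1_tame/tame_cst|exact: sL1_tame].
have : modulus (sint mu `[a, a + h] (fun s => f a - f s)) <= 2 * (e / 4) * (a + h - a).
  apply: modulus_sint_le => //.
    apply: tameD; first exact: tame_cst.
    rewrite (_ : (fun s => - f s) = fun s => (-1) * f s).
      by apply: tameM => //; exact: tame_cst.
    by apply/funext => s; rewrite mulN1r.
  move=> s /andP[]; rewrite le_eqVlt => /predU1P[<- _|as_ sh].
    by rewrite subrr modulus0 ltW.
  apply/ltW/hdl => //=; rewrite distrC gtr0_norm ?subr_gt0//.
  by rewrite ltrBlDl (le_lt_trans sh)// ltrD2l.
rewrite (addrC a h) addrK => hle; rewrite modulusM.
have -> : modulus ((rsc h)^-1 : F) = h^-1.
  by rewrite -fmorphV modulus_rsc gtr0_norm// invr_gt0.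
rewrite mulrC ltr_pdivrMr//; apply: (le_lt_trans hle); rewrite ltr_pM2r//.
lra.
Unshelve. all: by end_near. Qed.

End interval_integral.

(** * Right-continuous matrix semigroups *)

Section matrix_semigroup.
Context {R : realType} {k : scalar_kind}.
Local Notation F := (scalars R k).
Local Notation mu := (@lebesgue_measure R).
Variables (n : nat) (a : R -> 'M[F]_n).
Hypothesis a0 : a 0 = 1%:M.
Hypothesis aD : forall h l, 0 <= h -> 0 <= l -> a (h + l) = a h *m a l.
Hypothesis a_rcont : forall i j h, 0 <= h -> a r i j @[r --> h^'+] --> a h i j.

(** Right-continuity at 0 bounds the entries by K1 on some [0, e]. The semigroup law extends a bound
    K from [0, e m] to [0, e (m + 1)]: an entry of the product a_(s - e m) a_(e m) is a sum of n
    terms of size at most K1 K. *)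
Lemma semigroup_bounded t :
  exists K, forall s i j, 0 <= s <= t -> modulus (a s i j) <= K.
Proof.
(* A sum over all entries serves as one bound for each of them. *)
pose K1 := \sum_i \sum_j (modulus (a 0 i j) + 1).
have K1_ge0 i j : modulus (a 0 i j) + 1 <= K1.
  rewrite /K1 (bigD1 i)//= (bigD1 j)//= -addrA lerDl addr_ge0//.
    by apply: sumr_ge0 => j' _; rewrite addr_ge0 ?modulus_ge0.
  apply: sumr_ge0 => i' _; apply: sumr_ge0 => j' _.
  by rewrite addr_ge0 ?modulus_ge0.
have : \forall s \near 0^'+, forall i j, modulus (a s i j) <= K1.
  apply: filter_forall => i; apply: filter_forall => j.
  have /scvg_modulusP/(_ 1 ltr01) := @a_rcont i j 0 (lexx 0).
  apply: filterS => s hs; apply: le_trans (K1_ge0 i j).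
  rewrite -[a s i j](subrK (a 0 i j)) addrC.
  by apply: (le_trans (ler_modulusD _ _)); rewrite lerD2l modulusBC ltW.
move=> [dl /= dl0 hdl].
pose e := dl / 2.
have e0 : 0 < e by rewrite divr_gt0.
have he s i j : 0 <= s <= e -> modulus (a s i j) <= K1.
  move=> /andP[]; rewrite le_eqVlt => /predU1P[<- _|s0 se].
    by apply: le_trans (K1_ge0 i j); rewrite lerDl.
  apply: hdl => //=; rewrite sub0r normrN gtr0_norm//.
  by rewrite (le_lt_trans se)// /e ltr_pdivrMr// mulr2n mulrDr mulr1 ltrDl.
suff H m : exists K, forall s i j, 0 <= s <= e *+ m -> modulus (a s i j) <= K.
  have [K hK] := H (Num.truncn (t / e)).+1.
  exists K => s i j /andP[s0 st]; apply: hK; rewrite s0/=.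
  have te0 : 0 <= t / e by rewrite divr_ge0 ?(le_trans s0 st)// ltW.
  have /andP[_ /ltW] := truncn_itv te0.
  by rewrite ler_pdivrMr// mulr_natl => /(le_trans st).
elim: m => [|m [K hK]].
  exists K1 => s i j /andP[s0]; rewrite mulr0n => s1.
  by apply: he; rewrite s0 (le_trans s1)// ltW.
exists (Num.max K (\sum_(l < n) (K1 * K))) => s i j /andP[s0].
have [sm _|ms sm] := leP s (e *+ m).
  by rewrite le_max hK// s0.
have se0 : 0 <= s - e *+ m by rewrite subr_ge0 ltW.
rewrite le_max; apply/orP; right.
rewrite -[s](subrK (e *+ m)) aD//; last by rewrite mulrn_wge0// ltW.
rewrite mxE; apply: (le_trans (ler_modulus_sum _)); apply: ler_sum => l _.
rewrite modulusM ler_pM ?modulus_ge0//.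
  by apply: he; rewrite se0 lerBlDr -mulrS.
by apply: hK; rewrite lexx andbT mulrn_wge0// ltW.
Qed.

Lemma tame_semigroup t i j : tame 0 t (fun s => a s i j).
Proof.
split=> [s /andP[s0 _]|]; first exact: a_rcont.
by have [K hK] := semigroup_bounded t; exists K => s; exact: hK.
Qed.

Definition Wint h : 'M[F]_n := \matrix_(i, j) sint mu `[0, h] (fun s => a s i j).

Lemma mulmx_Wint (C : 'M[F]_n) h i j :
  (C *m Wint h) i j = sint mu `[0, h] (fun s => (C *m a s) i j).
Proof.
transitivity (sint mu `[0, h] (fun s => \sum_l C i l * a s l j)); last first.
  by apply: eq_sint => s _; rewrite mxE.
rewrite [LHS]mxE sint_itv_sum; last first.
  by move=> l; apply: tameM; [exact: tame_cst|exact: tame_semigroup].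
apply: eq_bigr => l _; rewrite [Wint h l j]mxE sint_itvZ//.
exact: tame_semigroup.
Qed.

Lemma Wint_mulmx (C : 'M[F]_n) h i j :
  (Wint h *m C) i j = sint mu `[0, h] (fun s => (a s *m C) i j).
Proof.
transitivity (sint mu `[0, h] (fun s => \sum_l C l j * a s i l)); last first.
  apply: eq_sint => s _; rewrite mxE; apply: eq_bigr => l _; exact: mulrC.
rewrite [LHS]mxE sint_itv_sum; last first.
  by move=> l; apply: tameM; [exact: tame_cst|exact: tame_semigroup].
apply: eq_bigr => l _; rewrite [Wint h i l]mxE sint_itvZ 1?mulrC//.
exact: tame_semigroup.
Qed.

Lemma WintD h l : 0 <= h -> 0 <= l -> Wint (l + h) = Wint h + a h *m Wint l.
Proof.
move=> h0 l0; apply/matrixP => i j; rewrite mxE [RHS]mxE mulmx_Wint mxE.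
have tl := tame_semigroup (l + h) i j.
rewrite (@sint_cat _ _ 0 h (l + h))// ?lerDr//; congr (_ + _).
rewrite -{1}[h]add0r sint_shift//; last by apply: tameS tl; rewrite ?add0r.
apply: eq_sint => s; rewrite /= in_itv/= => /andP[s0 _].
by rewrite addrC aD.
Qed.

Lemma semigroup_comm h l : 0 <= h -> 0 <= l -> a h *m a l = a l *m a h.
Proof. by move=> h0 l0; rewrite -aD// addrC aD. Qed.

Lemma Wint_semigroup_comm h l : 0 <= h -> Wint l *m a h = a h *m Wint l.
Proof.
move=> h0; apply/matrixP => i j; rewrite mulmx_Wint Wint_mulmx.
apply: eq_sint => s; rewrite /= in_itv/= => /andP[s0 _].
by rewrite semigroup_comm.
Qed.

Lemma Wint_comm h l : Wint h *m Wint l = Wint l *m Wint h.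
Proof.
apply/matrixP => i j; rewrite mulmx_Wint Wint_mulmx.
apply: eq_sint => s; rewrite /= in_itv/= => /andP[s0 _].
by rewrite Wint_semigroup_comm.
Qed.

(* W_h / h tends to a_0 = 1, so its determinant is eventually nonzero. *)
Lemma Wint_unitmx : exists2 h, 0 < h & Wint h \in unitmx.
Proof.
have cW i j : (rsc h)^-1 * Wint h i j @[h --> (0 : R)^'+] --> a 0 i j.
  have := sint_right_diff ltr01 (tame_semigroup 1 i j).
  apply: cvg_trans; apply: near_eq_cvg; apply: nearW => h.
  by rewrite mxE add0r.
have : \det ((rsc h)^-1 *: Wint h) @[h --> (0 : R)^'+] --> \det (a 0).
  rewrite /determinant; apply: cvg_big => //.
    by move=> x; apply: continuousD; [exact: cvg_fst|exact: cvg_snd].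
  move=> s _; apply: cvgM; first exact: cvg_cst.
  apply: cvg_big => //.
    by move=> x; apply: continuousM; [exact: cvg_fst|exact: cvg_snd].
  move=> i _; set j := (X in a 0 i X); apply: cvg_trans (cW i j).
  by apply: near_eq_cvg; apply: nearW => h; rewrite [RHS]mxE.
rewrite a0 det1 => /cvgr_neq0/(_ (oner_neq0 _)) hd.
have [h [h0 hu]] : exists h : R, 0 < h /\ \det ((rsc h)^-1 *: Wint h) != 0.
  near (0 : R)^'+ => h; exists h; split; first by near: h; exact: nbhs_right_gt.
  by near: h.
exists h => //; rewrite unitmxE unitfE.
by move: hu; rewrite detZ mulf_eq0 negb_or => /andP[].
Unshelve. all: by end_near. Qed.

(** The wanted identity at a single e with W_e invertible leaves no choice for G. Its validity at
    every h comes from the symmetry of W_(e+h) in e and h, and the two sides on which G may stand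
    from the commutation of the matrices W_h with each other and with a_e. *)
Lemma semigroup_generator : exists G : 'M[F]_n, forall h, 0 <= h ->
  a h = 1%:M + G *m Wint h /\ a h = 1%:M + Wint h *m G.
Proof.
have [e e0 We] := Wint_unitmx; have e0' := ltW e0.
pose G := (a e - 1%:M) *m invmx (Wint e); exists G => h h0.
(* Both sides equal W_(e+h) - W_e - W_h. *)
have E : (a h - 1%:M) *m Wint e = (a e - 1%:M) *m Wint h.
  have WE : Wint e + a e *m Wint h = Wint h + a h *m Wint e.
    by rewrite -!WintD// addrC.
  have aWE : a h *m Wint e = Wint e + (a e *m Wint h - Wint h).
    by rewrite addrA WE addrAC subrr add0r.
  by rewrite !mulmxBl !mul1mx aWE addrC addKr.
have IW : invmx (Wint e) *m Wint h = Wint h *m invmx (Wint e).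
  by rewrite -{1}[Wint h](mulmxK We) -!mulmxA (mulmxA (Wint h)) Wint_comm
    -(mulmxA (Wint e)) mulKmx.
have a1E : a h - 1%:M = (a e - 1%:M) *m Wint h *m invmx (Wint e).
  by rewrite -E mulmxK.
split; apply/eqP; rewrite -subr_eq; last 1 first.
- rewrite subr_eq addrC -subr_eq a1E /G mulmxA.
  by rewrite mulmxBl mulmxBr mulmx1 mul1mx Wint_semigroup_comm.
- rewrite subr_eq addrC -subr_eq a1E /G -!mulmxA IW.
  exact: eqxx.
Qed.

End matrix_semigroup.

(** * The generator on polynomials of degree one *)

(* The evaluation vectors span K^m: otherwise a nonzero functional vanishing on
   all of them would be a linear relation between the f_j. *)
Lemma separating_points (K : fieldType) (E : Type) m (f : 'I_m -> E -> K) :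
  (forall c : 'I_m -> K, (forall x, \sum_i c i * f i x = 0) -> forall i, c i = 0) ->
  exists x : 'I_m -> E, \matrix_(i, j) f j (x i) \in unitmx.
Proof.
move=> fI.
suff H r : (r <= m)%N -> exists x : 'I_r -> E, row_free (\matrix_(i < r, j < m) f j (x i)).
  by have [x] := H m (leqnn m); rewrite row_free_unit; exists x.
elim: r => [_|r ih rm].
  have x : 'I_0 -> E by case.
  by exists x; rewrite /row_free; apply/eqP/eqP; rewrite -leqn0 rank_leq_row.
have [x /eqP xfree] := ih (ltnW rm).
set A := matrix_of_fun _ _ in xfree.
pose u y := (\row_j f j y) : 'rV[K]_m.
have [y uy] : exists y, ~~ (u y <= A)%MS.
  apply: contrapT => hu.
  have uA y : (u y <= A)%MS.
    by apply: contrapT => /negP h; apply: hu; exists y.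
  (* Each column of the cokernel matrix is a linear relation between the f_j at every point, hence
     zero; but the cokernel of r < m rows has rank m - r. *)
  have c0 : cokermx A = 0.
    apply/matrixP => j l; rewrite [RHS]mxE.
    apply: (@fI (fun j => cokermx A j l)) => y.
    have /submxP[D uD] := uA y.
    have : (u y *m cokermx A) 0 l = 0.
      by rewrite uD -mulmxA mulmx_coker mulmx0 mxE.
    rewrite [LHS]mxE => uc; rewrite -[RHS]uc; apply: eq_bigr => i _.
    by rewrite [u y 0 i]mxE mulrC.
  have := mxrank_coker A; rewrite c0 mxrank0 xfree => /esym/eqP.
  by rewrite subn_eq0 leqNgt rm.
pose x' (i : 'I_(1 + r)) := match fintype.split i with inl _ => y | inr j => x j end.
exists x'; rewrite (_ : \matrix_(_, _) _ = col_mx (u y) A); last first.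
  apply/matrixP => i j; rewrite !mxE /x'.
  by case: (fintype.split i) => i'; rewrite mxE.
have rE : \rank (col_mx (u y) A) = \rank (u y + A)%MS.
  by rewrite (addsmxE (u y) A).
rewrite /row_free eqn_leq rank_leq_row andTb rE.
have rA : (r <= \rank (u y + A)%MS)%N.
  by apply: leq_trans (mxrankS (addsmxSr (u y) A)); rewrite xfree.
rewrite ltn_neqAle rA andbT; apply/eqP => rE'; case/negP: uy.
have : (A == u y + A)%MS.
  by rewrite -(geq_leqif (mxrank_leqif_eq (addsmxSr (u y) A))) -rE' xfree.
by case/andP => _; apply: submx_trans; exact: addsmxSl.
Qed.

Section polynomial_generator.
Context {R : realType} {k : scalar_kind} {E : Type}.
Local Notation F := (scalars R k).
Local Notation mu := (@lebesgue_measure R).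
Context {P : submodClosed (E -> F)}.
Implicit Types (p q : submod P).

Lemma evD p q x : ev (p + q) x = ev p x + ev q x.
Proof. by rewrite /ev raddfD. Qed.

Lemma ev0 x : ev (0 : submod P) x = 0.
Proof. by rewrite /ev raddf0. Qed.

Lemma evZ c p x : ev (c *: p) x = c * ev p x.
Proof. by rewrite /ev linearZ. Qed.

Lemma evB p q x : ev (p - q) x = ev p x - ev q x.
Proof. by rewrite -scaleN1r evD evZ mulN1r. Qed.

Lemma ev_sum (I : Type) (r : seq I) (f : I -> submod P) x :
  ev (\sum_(i <- r) f i) x = \sum_(i <- r) ev (f i) x.
Proof.
elim: r => [|i r ih]; first by rewrite !big_nil ev0.
by rewrite !big_cons evD ih.
Qed.

Lemma ev_ext p q : (forall x, ev p x = ev q x) -> p = q.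
Proof. by move=> pq; apply/val_inj/funext => x; exact: pq. Qed.

Variable deg : submod P -> nat.
Variable T : R -> {linear submod P -> submod P}.
Hypothesis hT : polynomial_action deg T.

Lemma is_gen_uniq p q q' : is_gen T p q -> is_gen T p q' -> q = q'.
Proof. by move=> h h'; apply: ev_ext => x; exact: norm_cvg_unique (h x) (h' x). Qed.

Lemma is_genE p q : is_gen T p q -> gen T p = q.
Proof.
move=> h; rewrite /gen; case: xgetP => [q' _ h'|/(_ q)//].
exact: is_gen_uniq h' h.
Qed.

Lemma is_gen_lin c p p' q q' : is_gen T p q -> is_gen T p' q' ->
  is_gen T (c *: p + p') (c *: q + q').
Proof.
move=> h h' x; rewrite evD evZ.
have lim : c * ((ev (T r p) x - ev p x) / mkS r 0)
    + (ev (T r p') x - ev p' x) / mkS r 0 @[r --> (0 : R)^'+] -->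
    c * ev q x + ev q' x.
  by apply: cvgD (h' x); apply: cvgM (h x); exact: cvg_cst.
apply: cvg_trans lim; apply: near_eq_cvg; apply: nearW => r /=.
by rewrite linearD linearZ/= !evD !evZ; ring.
Qed.

(** An independent family with T-invariant span carries the action as a matrix semigroup on rows of
    coordinates. Independence is used twice: for uniqueness of coordinates and for points at which
    the evaluation matrix is invertible. *)
Lemma invariant_family_generator n (f : 'I_n -> submod P) :
  (forall c : 'I_n -> F, \sum_i c i *: f i = 0 -> forall i, c i = 0) ->
  (forall h i, 0 <= h -> exists c : 'I_n -> F, T h (f i) = \sum_j c j *: f j) ->
  exists (a : R -> 'M[F]_n) (G : 'M[F]_n),
    [/\ forall h i, 0 <= h -> T h (f i) = \sum_j a h i j *: f j,
        forall t i j, tame 0 t (fun s => a s i j),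
        forall h, 0 <= h -> a h = 1%:M + G *m Wint a h /\ a h = 1%:M + Wint a h *m G &
        forall i, is_gen T (f i) (\sum_j G i j *: f j)].
Proof.
move=> fI fT; have [_ [T0 [TD T_rcont]]] := hT.
have [x xu] : exists x : 'I_n -> E, \matrix_(i, j) ev (f j) (x i) \in unitmx.
  apply: (@separating_points F E n (fun j x => ev (f j) x)) => c hc.
  apply: fI; apply: ev_ext => x.
  by rewrite ev_sum ev0 -[RHS](hc x); apply: eq_bigr => i _; rewrite evZ.
set B := matrix_of_fun _ _ in xu.
pose N h : 'M[F]_n := \matrix_(i, l) ev (T h (f i)) (x l).
pose a h := N h *m invmx B^T.
have BTu : B^T \in unitmx by rewrite unitmx_tr.
(* The coefficients of T_h f_i are linear combinations of its values at the
   points x_l, hence right-continuous in h. *)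
have aE h i (c : 'I_n -> F) : T h (f i) = \sum_j c j *: f j -> forall j, a h i j = c j.
  move=> hc j; transitivity (((\row_j c j) *m B^T *m invmx B^T) 0 j); last first.
    by rewrite mulmxK// mxE.
  rewrite !mxE; apply: eq_bigr => l _; congr (_ * _).
  by rewrite !mxE hc ev_sum; apply: eq_bigr => j' _; rewrite !mxE evZ.
have aT h i : 0 <= h -> T h (f i) = \sum_j a h i j *: f j.
  move=> h0; have [c hc] := fT h i h0; rewrite hc; apply: eq_bigr => j _.
  by rewrite (aE _ _ _ hc).
have a0 : a 0 = 1%:M.
  apply/matrixP => i j; rewrite (aE _ _ (fun j => (i == j)%:R))// ?mxE// T0.
  by rewrite (bigD1 i)//= eqxx scale1r big1 ?addr0// => j' ij; rewrite eq_sym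
    (negbTE ij) scale0r.
have aD h l : 0 <= h -> 0 <= l -> a (h + l) = a h *m a l.
  (* Rows of coordinates reverse composition: T_l after T_h has matrix a_h a_l. Hence the swap of h
     and l. *)
  move=> h0 l0; rewrite (addrC h); apply/matrixP => i j.
  rewrite (aE _ _ (fun j => (a h *m a l) i j))// -TD// (aT h i h0) linear_sum.
  under eq_bigr => j' _ do rewrite linearZ/= (aT l j' l0) scaler_sumr.
  rewrite exchange_big; apply: eq_bigr => j' _; rewrite mxE scaler_suml.
  by apply: eq_bigr => l' _; rewrite scalerA.
have a_rcont i j h : 0 <= h -> a r i j @[r --> h^'+] --> a h i j.
  move=> h0; rewrite /a [in X in _ --> X]mxE.
  rewrite [X in X @ _](_ : _ = fun r => \sum_l N r i l * invmx B^T l j); last first.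
    by apply/funext => r; rewrite mxE.
  apply: cvg_big => //.
    by move=> y; apply: continuousD; [exact: cvg_fst|exact: cvg_snd].
  move=> l _; apply: cvgM; last exact: cvg_cst.
  rewrite [in X in _ --> X]mxE.
  rewrite [X in X @ _](_ : _ = fun r => ev (T r (f i)) (x l)); last first.
    by apply/funext => r; rewrite mxE.
  exact: T_rcont.
have [G GE] := semigroup_generator a0 aD a_rcont.
exists a, G; split => //; first exact: tame_semigroup.
move=> i y.
have cW l j : (rsc h)^-1 * Wint a h l j @[h --> (0 : R)^'+] --> a 0 l j.
  have := sint_right_diff ltr01 (tame_semigroup aD a_rcont 1 l j).
  apply: cvg_trans; apply: near_eq_cvg; apply: nearW => h.
  by rewrite mxE add0r.
(* The difference quotient of T_h f_i has as coordinates row i of G (W_h / h), which tends to row i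
   of G a_0 = G. *)
have : \sum_j \sum_l G i l * ((rsc h)^-1 * Wint a h l j) * ev (f j) y
    @[h --> (0 : R)^'+] --> \sum_j \sum_l G i l * a 0 l j * ev (f j) y.
  have cadd : continuous (fun z : F * F => z.1 + z.2).
    by move=> z; apply: continuousD; [exact: cvg_fst|exact: cvg_snd].
  apply: cvg_big => // j _; apply: cvg_big => // l _.
  by apply: cvgM; [apply: cvgM; [exact: cvg_cst|exact: cW]|exact: cvg_cst].
have -> : \sum_j \sum_l G i l * a 0 l j * ev (f j) y = ev (\sum_j G i j *: f j) y.
  rewrite ev_sum; apply: eq_bigr => j _; rewrite evZ -mulr_suml a0.
  by have /matrixP/(_ i j) := mulmx1 G; rewrite mxE => ->.
apply: cvg_trans; apply: near_eq_cvg; near=> h.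
have h0 : 0 < h by near: h; exact: nbhs_right_gt.
rewrite aT ?(ltW h0)// ev_sum.
have -> : ev (f i) y = \sum_j (1%:M : 'M[F]_n) i j * ev (f j) y.
  rewrite (bigD1 i)//= mxE eqxx mul1r big1 ?addr0// => j ij.
  by rewrite mxE eq_sym (negbTE ij) mul0r.
rewrite -sumrB mulr_suml; apply: eq_bigr => j _.
rewrite evZ -mulrBl (GE h (ltW h0)).1 [(_ + _ *m _) i j]mxE.
rewrite [X in X - _]addrC addrK.
rewrite [(_ *m _) i j]mxE !mulr_suml; apply: eq_bigr => l _.
by rewrite /rsc; ring.
Unshelve. all: by end_near. Qed.

End polynomial_generator.

Lemma val_sumZ (K : fieldType) (W : lmodType K) (S : submodClosed W) (I : Type)
    (r : seq I) (c : I -> K) (b : I -> submod S) :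
  val (\sum_(i <- r) c i *: b i) = \sum_(i <- r) c i *: val (b i).
Proof.
elim: r => [|i r ih]; first by rewrite !big_nil raddf0.
by rewrite !big_cons -ih linearP.
Qed.

(** * Polynomials of degree one: decomposition and generator *)

Section first_degree.
Context {R : realType} {k : scalar_kind} {E : Type}.
Local Notation F := (scalars R k).
Local Notation mu := (@lebesgue_measure R).
Context {P : submodClosed (E -> F)}.
Implicit Types (p q : submod P).
Variable deg : submod P -> nat.
Hypothesis hdeg : polynomial_space deg.

Definition const_poly (c : F) : submod P := insubd 0 (fun=> c).

Lemma ev_const_poly c x : ev (const_poly c) x = c.
Proof. by rewrite /ev /const_poly insubdK//; exact: (hdeg.1 c). Qed.

Lemma Pol0P p : Pol deg 0 p <-> Defs.constant p.
Proof.
have [_ [_ [_ h]]] := hdeg; rewrite -h /Pol /= leqn0.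
by split => [/eqP|/eqP].
Qed.

Lemma constantE p x : Defs.constant p -> p = ev p x *: const_poly 1.
Proof.
move=> [c pc]; apply: ev_ext => y.
by rewrite evZ ev_const_poly mulr1 !pc.
Qed.

Lemma Pol_lin n c p q : Pol deg n p -> Pol deg n q -> Pol deg n (c *: p + q).
Proof.
have [_ [hD [hZ _]]] := hdeg; rewrite /Pol /= => pn qn.
apply: (leq_trans (hD _ _)); rewrite geq_max qn andbT.
(* The degree axiom speaks of nonzero scalars; for c = 0 the product is the constant 0, of degree
   0. *)
have [->|c0] := eqVneq c 0; last by rewrite hZ.
rewrite scale0r; apply: leq_trans (leq0n n).
by apply/(Pol0P 0); exists 0 => x; rewrite ev0.
Qed.

Lemma PolN n p : Pol deg n p -> Pol deg n (- p).
Proof.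
have [_ [hD [hZ _]]] := hdeg; rewrite /Pol /= => pn.
by rewrite -scaleN1r hZ// oppr_eq0 oner_neq0.
Qed.

Context {L : submodClosed (submod P)}.
Hypothesis hL : complement01 deg L.
Implicit Types l : submod L.

Lemma PolB n p q : Pol deg n p -> Pol deg n q -> Pol deg n (p - q).
Proof. by move=> pn qn; rewrite -[p]scale1r; apply: Pol_lin => //; exact: PolN. Qed.

Lemma Pol0_Pol1 p : Pol deg 0 p -> Pol deg 1 p.
Proof. by rewrite /Pol /= leqn0 => /eqP ->. Qed.

(** Pins down the choice made in [Pi1]: two candidates differ by an element of L of degree 0, which
    vanishes. *)
Lemma Pi1_uniq q l : Pol deg 0 (q - val l) -> Pi1 deg q = l.
Proof.
move=> ql; rewrite /Pi1; case: xgetP => [l' _ /= ql'|/(_ l)//].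
apply/eqP; rewrite -subr_eq0; apply/eqP; apply: hL.2.1.
rewrite raddfB /= (_ : val l' - val l = (q - val l) - (q - val l')).
  exact: PolB.
by rewrite opprB [RHS]addrC addrA subrK.
Qed.

Lemma Pi1P q : Pol deg 1 q -> Pol deg 0 (q - val (@Pi1 _ _ _ _ deg L q)).
Proof. by move=> /hL.2.2[l ql]; rewrite (Pi1_uniq ql). Qed.

Lemma Pi1_lin c q q' : Pol deg 1 q -> Pol deg 1 q' ->
  @Pi1 _ _ _ _ deg L (c *: q + q') = c *: Pi1 deg q + Pi1 deg q'.
Proof.
move=> /Pi1P hq /Pi1P hq'; apply: Pi1_uniq.
rewrite [val _]linearP/= opprD addrACA -scalerBr; exact: Pol_lin.
Qed.

(** Two different points are allowed because [Pi0 q] is constant. This matches the theorem, where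
    the functional 1 is evaluation at the fixed [e] while the L-part is evaluated along the
    process. *)
Lemma ev_Pi0_Pi1 q x y : Pol deg 1 q ->
  ev (@Pi0 _ _ _ _ deg L q) x + ev (val (@Pi1 _ _ _ _ deg L q)) y = ev q y.
Proof.
move=> /Pi1P/Pol0P[c hc]; rewrite (hc x) -(hc y).
by rewrite evB subrK.
Qed.

Variable T : R -> {linear submod P -> submod P}.
Hypothesis hT : polynomial_action deg T.

Lemma Pol_T n h p : 0 <= h -> Pol deg n p -> Pol deg n (T h p).
Proof. by move=> h0; apply: leq_trans; exact: hT.1. Qed.

Lemma T1_linear h : 0 <= h -> linear (@T1 _ _ _ _ deg T L h).
Proof.
move=> h0 c l l'; rewrite /T1 !linearP/=.
by apply: Pi1_lin; apply: Pol_T => //; exact: hL.1.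
Qed.

Variable V : submod L -> submodClosed (submod L).
Hypothesis hF : assumptionF deg T V.

(** Only the projection of T_h to L preserves W. Since T_h differs from it by constants, putting 1
    in position 0 yields a span that T_h itself preserves. *)
Definition extended_basis n (W : submodClosed (submod L))
    (b : 'I_n -> submod W) (i : 'I_n.+1) : submod P :=
  if unlift ord0 i is Some j then val (val (b j)) else const_poly 1.

Lemma extended_basis0 n W (b : 'I_n -> submod W) :
  extended_basis b ord0 = const_poly 1.
Proof. by rewrite /extended_basis unlift_none. Qed.

Lemma extended_basisS n W (b : 'I_n -> submod W) j :
  extended_basis b (lift ord0 j) = val (val (b j)).
Proof. by rewrite /extended_basis liftK. Qed.

Lemma extended_basis_sum n W (b : 'I_n -> submod W) (c : 'I_n.+1 -> F) :
  \sum_i c i *: extended_basis b i =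
  c ord0 *: const_poly 1 + val (val (\sum_j c (lift ord0 j) *: b j)).
Proof.
rewrite big_ord_recl extended_basis0; congr (_ + _).
by rewrite !val_sumZ; apply: eq_bigr => j _; rewrite extended_basisS.
Qed.

Lemma basis_free n (W : lmodType F) (b : 'I_n -> W) (c : 'I_n -> F) :
  is_basis b -> \sum_i c i *: b i = 0 -> forall i, c i = 0.
Proof.
move=> bb c0 i; have [c' [_ uc']] := bb 0.
have h1 := uc' c (esym c0).
have h2 : c' = fun=> 0.
  by apply: uc'; rewrite big1// => j _; rewrite scale0r.
by rewrite -h1 h2.
Qed.

Lemma dual_basisE n (W : lmodType F) (b : 'I_n -> W) (c : 'I_n -> F) w j :
  is_basis b -> w = \sum_i c i *: b i -> dual_basis b j w = c j.
Proof.
move=> bb wc; rewrite /dual_basis; have [c' [_ uc']] := bb w.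
case: xgetP => [c'' _ /= hc''|/(_ c)//].
by rewrite -(uc' _ hc'') (uc' _ wc).
Qed.

(** In a vanishing combination the part in L equals a constant, and L meets P_0 in 0 only;
    evaluation at [e] then kills the coefficient of 1. *)
Lemma extended_basis_free n W (b : 'I_n -> submod W) (c : 'I_n.+1 -> F) (e : E) :
  is_basis b -> \sum_i c i *: extended_basis b i = 0 -> forall i, c i = 0.
Proof.
move=> bb; rewrite extended_basis_sum => c0.
have w0 : val (\sum_j c (lift ord0 j) *: b j) = 0.
  apply: hL.2.1; apply/Pol0P; exists (- c ord0) => x.
  have := congr1 (fun q => ev q x) c0; rewrite /= evD evZ ev_const_poly ev0 mulr1.
  by move=> /eqP; rewrite addrC addr_eq0 => /eqP.
have hj : forall j, c (lift ord0 j) = 0.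
  by apply: basis_free bb _; apply: val_inj; rewrite w0 raddf0.
move=> i; case: (unliftP ord0 i) => [j ->//|->].
move: c0; rewrite w0 raddf0 addr0 => /(congr1 (fun q => ev q e)).
by rewrite /= evZ ev_const_poly ev0 mulr1.
Qed.

Lemma Pol1_extended_basis n W (b : 'I_n -> submod W) i :
  Pol deg 1 (extended_basis b i).
Proof.
case: (unliftP ord0 i) => [j ->|->]; first by rewrite extended_basisS; exact: hL.1.
rewrite extended_basis0; apply: Pol0_Pol1; apply/Pol0P.
by exists 1 => x; rewrite ev_const_poly.
Qed.

Lemma T1_basis h (p : submod L) n (b : 'I_n -> submod (V p)) i : 0 <= h -> is_basis b ->
  exists c : 'I_n -> F, T1 deg T h (val (b i)) = \sum_j c j *: val (b j).
Proof.
move=> h0 bb; have [_ [_ VT]] := hF p.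
have [c [hc _]] := bb (Submod (VT h _ h0 (valP (b i)))).
by exists c; have /(congr1 val) := hc; rewrite val_sumZ.
Qed.

Lemma extended_basis_generator (e : E) (p : submod L) n (b : 'I_n -> submod (V p)) :
  is_basis b ->
  let f := extended_basis b in
  exists (a : R -> 'M[F]_n.+1) (G : 'M[F]_n.+1),
    [/\ forall h i, 0 <= h -> T h (f i) = \sum_j a h i j *: f j,
        forall t i j, tame 0 t (fun s => a s i j),
        forall h, 0 <= h -> a h = 1%:M + G *m Wint a h /\ a h = 1%:M + Wint a h *m G &
        forall i, is_gen T (f i) (\sum_j G i j *: f j)].
Proof.
move=> bb f; apply: (invariant_family_generator hT).
  by move=> c; apply: extended_basis_free.
move=> h i h0; rewrite /f; case: (unliftP ord0 i) => [j ->|->].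
  rewrite extended_basisS.
  have [c hc] := T1_basis j h0 bb.
  have /Pi1P/Pol0P/constantE hq : Pol deg 1 (T h (val (val (b j)))).
    by apply: Pol_T => //; exact: hL.1.
  (* The coefficient of 1 is the value, read off at [e], of the constant by which T_h b_j and its
     projection to L differ. *)
  exists (fun i => if unlift ord0 i is Some j then c j else
    ev (T h (val (val (b j))) - val (@Pi1 _ _ _ _ deg L (T h (val (val (b j)))))) e).
  rewrite extended_basis_sum unlift_none -hq.
  under eq_bigr do rewrite liftK.
  rewrite (_ : val (\sum_j _) = T1 deg T h (val (b j))) ?subrK//.
  by rewrite hc val_sumZ.
rewrite extended_basis0.
(* The action alone gives that T_h 1 is constant; that this constant is 1 comes from the process. *)
have /Pol0P/constantE hq : Pol deg 0 (T h (const_poly 1)).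
  by apply: Pol_T => //; apply/Pol0P; exists 1 => x; rewrite ev_const_poly.
exists (fun i => if i == ord0 then ev (T h (const_poly 1)) e else 0).
rewrite extended_basis_sum eqxx -hq big1 ?raddf0 ?addr0// => j _.
by rewrite scale0r.
Qed.

(** [gen] is a choice with default 0, so its values mean something only on the domain. Membership is
    obtained by expanding l in a basis of V_l and letting G act; the image is a combination of the
    extended basis, hence in P_1. *)
Lemma gen_spec (e : E) l :
  is_gen T (val l) (gen T (val l)) /\ Pol deg 1 (gen T (val l)).
Proof.
have [[n [b bb]] [Vl _]] := hF l.
have [a [G [_ _ _ hG]]] := extended_basis_generator e bb.
have [c [hc _]] := bb (Submod Vl).
have fE : val l = \sum_j c j *: extended_basis b (lift ord0 j).
  have /(congr1 val)/(congr1 val) := hc; rewrite !val_sumZ /= => ->.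
  by apply: eq_bigr => j _; rewrite extended_basisS.
pose q := \sum_j c j *: \sum_i G (lift ord0 j) i *: extended_basis b i.
have f1 i : Pol deg 1 (extended_basis b i) by exact: Pol1_extended_basis.
have z1 : Pol deg 1 (0 : submod P).
  by apply: Pol0_Pol1; apply/Pol0P; exists 0 => x; rewrite ev0.
have [g1 g2] : is_gen T (val l) q /\ Pol deg 1 q.
  rewrite fE /q; elim: (index_enum _) => [|j r [ih1 ih2]].
    rewrite !big_nil; split => // x; rewrite ev0.
    rewrite [X in X @ _ --> _](_ : _ = fun=> 0); first exact: cvg_cst.
    by apply/funext => h; rewrite linear0 !ev0 subrr mul0r.
  rewrite !big_cons; split; first exact: is_gen_lin.
  apply: Pol_lin => //; elim: (index_enum _) => [|i r' ih]; first by rewrite big_nil.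
  by rewrite big_cons; exact: Pol_lin.
by rewrite (is_genE g1).
Qed.

Lemma gen_linear (e : E) c l l' :
  gen T (val (c *: l + l')) = c *: gen T (val l) + gen T (val l').
Proof.
apply: is_genE; rewrite linearP/=.
by apply: is_gen_lin; exact: (gen_spec e _).1.
Qed.

End first_degree.

(** * Measurability and Fubini along paths *)

Section smeasurability.
Context {R : realType} {k : scalar_kind} d (Omega : measurableType d).
Local Notation F := (scalars R k).
Implicit Types (G : set (set Omega)) (f g : Omega -> F).

(** Each F_t is a bare set of sets. Viewing it as the sigma-algebra it generates gives access to the
    closure properties of measurable functions. *)
Lemma smeasurableP G f : sigma_algebra [set: Omega] G -> smeasurable G f <->
  measurable_fun [set: g_sigma_algebraType G] (sRe \o f) /\
  measurable_fun [set: g_sigma_algebraType G] (sIm \o f).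
Proof.
move=> sG; have GE : @measurable _ (g_sigma_algebraType G) = G.
  exact: sigma_algebra_id.
split=> [fG|[f1 f2] B mB].
  by split=> _ B mB; rewrite setTI GE; have [] := fG B mB.
by rewrite -GE -[X in measurable X /\ _]setTI -[X in _ /\ measurable X]setTI; split;
  [exact: f1|exact: f2].
Qed.

Lemma smeasurableE f : smeasurable measurable f <->
  measurable_fun setT (sRe \o f) /\ measurable_fun setT (sIm \o f).
Proof.
split=> [fG|[f1 f2] B mB].
  by split=> _ B mB; rewrite setTI; have [] := fG B mB.
by rewrite -[X in measurable X /\ _]setTI -[X in _ /\ measurable X]setTI; split;
  [exact: f1|exact: f2].
Qed.

Lemma smeasurableS G G' f : G `<=` G' -> smeasurable G f -> smeasurable G' f.
Proof. by move=> GG' fG B /fG[? ?]; split; exact: GG'. Qed.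

Lemma smeasurable_cst G (c : F) : sigma_algebra [set: Omega] G ->
  smeasurable G (fun=> c).
Proof. by move=> sG; apply/smeasurableP => //; split; exact: measurable_cst. Qed.

Lemma smeasurableD G f g : sigma_algebra [set: Omega] G ->
  smeasurable G f -> smeasurable G g -> smeasurable G (fun w => f w + g w).
Proof.
move=> sG /(smeasurableP _ sG)[f1 f2] /(smeasurableP _ sG)[g1 g2].
apply/smeasurableP => //; split.
  rewrite (_ : _ \o _ = (sRe \o f) \+ (sRe \o g)); first exact: measurable_funD.
  by apply/funext => w /=; rewrite raddfD.
rewrite (_ : _ \o _ = (sIm \o f) \+ (sIm \o g)); first exact: measurable_funD.
by apply/funext => w /=; rewrite raddfD.
Qed.

Lemma smeasurableM G f g : sigma_algebra [set: Omega] G ->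
  smeasurable G f -> smeasurable G g -> smeasurable G (fun w => f w * g w).
Proof.
move=> sG /(smeasurableP _ sG)[f1 f2] /(smeasurableP _ sG)[g1 g2].
apply/smeasurableP => //; split.
  rewrite (_ : _ \o _ = ((sRe \o f) \* (sRe \o g)) \- ((sIm \o f) \* (sIm \o g))).
    by apply: measurable_funB; exact: measurable_funM.
  by apply/funext => w /=; rewrite sReM.
rewrite (_ : _ \o _ = ((sRe \o f) \* (sIm \o g)) \+ ((sIm \o f) \* (sRe \o g))).
  by apply: measurable_funD; exact: measurable_funM.
by apply/funext => w /=; rewrite sImM.
Qed.

Lemma smeasurableB G f g : sigma_algebra [set: Omega] G ->
  smeasurable G f -> smeasurable G g -> smeasurable G (fun w => f w - g w).
Proof.
move=> sG mf mg; rewrite (_ : (fun w => _) = fun w => f w + (-1) * g w).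
  by apply: smeasurableD => //; apply: smeasurableM => //; exact: smeasurable_cst.
by apply/funext => w; rewrite mulN1r.
Qed.

Lemma smeasurable_sum G (I : Type) (r : seq I) (f : I -> Omega -> F) :
  sigma_algebra [set: Omega] G -> (forall i, smeasurable G (f i)) ->
  smeasurable G (fun w => \sum_(i <- r) f i w).
Proof.
move=> sG mf; elim: r => [|i r ih].
  rewrite (_ : (fun w => _) = fun=> 0); first exact: smeasurable_cst.
  by apply/funext => w; rewrite big_nil.
rewrite (_ : (fun w => _) = fun w => f i w + \sum_(j <- r) f j w).
  exact: smeasurableD.
by apply/funext => w; rewrite big_cons.
Qed.

Lemma smeasurable_cvg G (h : nat -> Omega -> F) f : sigma_algebra [set: Omega] G ->
  (forall n, smeasurable G (h n)) -> (forall w, h n w @[n --> \oo] --> f w) ->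
  smeasurable G f.
Proof.
move=> sG mh hf; apply/smeasurableP => //; split.
  apply: (@measurable_fun_cvg _ (g_sigma_algebraType G) R setT (fun n => sRe \o h n)).
    by move=> n; have /(smeasurableP _ sG)[] := mh n.
  by move=> w _; have /scvgP[] := hf w.
apply: (@measurable_fun_cvg _ (g_sigma_algebraType G) R setT (fun n => sIm \o h n)).
  by move=> n; have /(smeasurableP _ sG)[] := mh n.
by move=> w _; have /scvgP[] := hf w.
Qed.

(** The integral is a pointwise limit of Riemann sums, and these stay measurable for G itself, not
    just for the ambient sigma-algebra. This is what makes the compensator adapted. *)
Lemma smeasurable_sint G (a b : R) (Y : Omega -> R -> F) :
  sigma_algebra [set: Omega] G -> a <= b ->
  (forall s, a <= s <= b -> smeasurable G (Y^~ s)) ->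
  (forall w, tame a b (Y w)) ->
  smeasurable G (fun w => sint lebesgue_measure `[a, b] (Y w)).
Proof.
move=> sG ab mY tY.
apply: (smeasurable_cvg sG _ (fun w => sint_right_riemann ab (tY w))) => n.
apply: smeasurable_sum => // i; apply: smeasurableM => //.
  by apply: mY; apply: part_itv.
exact: smeasurable_cst.
Qed.

Lemma measurable_modulus f :
  measurable_fun setT (sRe \o f) -> measurable_fun setT (sIm \o f) ->
  measurable_fun setT (fun w => modulus (f w)).
Proof.
move=> f1 f2.
rewrite (_ : (fun w => _) = (@Num.sqrt R) \o
    (((sRe \o f) \* (sRe \o f)) \+ ((sIm \o f) \* (sIm \o f)))).
  apply: measurableT_comp.
    by apply: continuous_measurable_fun; exact: sqrt_continuous.
  by apply: measurable_funD; exact: measurable_funM.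
by apply/funext => w /=; rewrite modulusE !expr2.
Qed.

Variable Pr : probability Omega R.

Lemma sintegrableP f : sintegrable Pr f <-> sL1 Pr setT f.
Proof.
split=> [[/smeasurableE[f1 f2] fi]|[i1 i2]].
  have le_int (u : Omega -> R) : measurable_fun setT u ->
      (forall w, `|u w| <= modulus (f w)) -> Pr.-integrable setT (EFin \o u).
    move=> mu uf; apply/integrableP; split; first exact/measurable_EFinP.
    apply: le_lt_trans fi; apply: ge0_le_integral => //=.
    - by apply/measurable_EFinP; apply: measurableT_comp.
    - by apply/measurable_EFinP; exact: measurable_modulus.
    - by move=> w _; rewrite lee_fin uf.
  split; apply: le_int => // w; first exact: sRe_le_modulus.
  exact: sIm_le_modulus.
have m1 : measurable_fun setT (sRe \o f) by apply/measurable_EFinP; exact: measurable_int i1.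
have m2 : measurable_fun setT (sIm \o f) by apply/measurable_EFinP; exact: measurable_int i2.
split; first exact/smeasurableE.
have : Pr.-integrable setT (fun w => (`|sRe (f w)|%:E + `|sIm (f w)|%:E)%E).
  by apply: integrableD => //; [exact: (integrable_norm i1)|exact: (integrable_norm i2)].
move=> /integrableP[_]; apply: le_lt_trans; apply: ge0_le_integral => //=.
- by move=> w _; rewrite lee_fin modulus_ge0.
- by apply/measurable_EFinP; exact: measurable_modulus.
- apply/measurable_EFinP; apply: measurableT_comp => //.
  by apply: measurable_funD; apply: measurableT_comp.
- by move=> w _; rewrite lee_fin ger0_norm ?addr_ge0// modulus_le.
Qed.

End smeasurability.

(** * Exchange of expectation and path integral *)

Section fubini_path.
Context {R : realType} d (Omega : measurableType d) (Pr : probability Omega R).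
Local Notation mu := (@lebesgue_measure R).
Variables (Y : Omega -> R -> R) (a b : R).
Hypothesis ab : a < b.
Hypothesis Y_meas : forall s, a <= s <= b -> measurable_fun setT (Y^~ s).
Hypothesis Y_rcont : forall w s, a <= s < b -> Y w r @[r --> s^'+] --> Y w s.
Hypothesis Y_bnd : forall w, exists K, forall s, a <= s <= b -> `|Y w s| <= K.
Hypothesis Y_int : (\int[Pr]_w \int[mu]_(s in `[a, b]) `|Y w s|%:E < +oo)%E.

(** Extension by 0 puts the integrand on the whole product space. The interval is half-open because
    joint measurability comes from right-continuity; the missing endpoint is a null set. *)
Let f A : Omega * measurableTypeR R -> \bar R :=
  (fun x => (Y x.1 x.2)%:E) \_ (A `*` `[a, b[).

Let fE A w s : f A (w, s) = ((fun w => ((EFin \o Y w) \_ `[a, b[) s) \_ A) w.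
Proof.
by rewrite /f !patchE in_setX /=; case: (w \in A); rewrite //= patchE.
Qed.

Let mf A : measurable A -> measurable_fun setT (f A).
Proof.
move=> mA; apply: (measurable_restrictT _ _).1.
  by apply: measurableX => //; exact: measurable_itv.
apply/measurable_EFinP; apply: measurable_funS (measurable_rcont ab Y_meas Y_rcont) => //.
  by apply: measurableX => //; exact: measurable_itv.
by move=> [w s] [_ ?].
Qed.

Let Y_itv w : mu.-integrable `[a, b] (EFin \o Y w).
Proof. by apply: integrable_rcont => //; exact: Y_rcont. Qed.

Let Y_itv' w : mu.-integrable `[a, b[ (EFin \o Y w).
Proof. by apply: integrableS (Y_itv w) => //; exact: subset_itv_co_cc. Qed.

Let f_intT : (Pr \x mu)%E.-integrable setT (f setT).
Proof.
apply/integrable12ltyP; first exact: mf.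
apply: le_lt_trans Y_int; rewrite le_eqVlt; apply/orP; left; apply/eqP.
apply: eq_integral => w _.
transitivity (\int[mu]_(s in `[a, b[) `|Y w s|%:E)%E.
  rewrite [RHS]integral_mkcond; apply: eq_integral => s _.
  rewrite fE !patchE in_setT; case: ifPn => //= _.
  by rewrite normr0.
rewrite integral_itv_bndo_bndc//.
apply/measurable_EFinP; apply: measurableT_comp => //.
by apply/measurable_EFinP; exact: (measurable_int mu (Y_itv' w)).
Qed.

Let f_int A : measurable A -> (Pr \x mu)%E.-integrable setT (f A).
Proof.
move=> mA; rewrite (_ : f A = (f setT) \_ (A `*` setT)).
  apply: (integrable_mkcond _ _).1; first exact: measurableX.
  by apply: (integrableS measurableT _ _ f_intT) => //; exact: measurableX.
apply/funext => -[w s]; rewrite !fE !patchE in_setX !in_setT /= andbT.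
by case: (w \in A); rewrite // fE !patchE in_setT.
Qed.

Let f_intr A w : (\int[mu]_s f A (w, s) =
  ((fun w => (\int[mu]_(s in `[a, b]) Y w s)%:E) \_ A) w)%E.
Proof.
under eq_integral do rewrite fE.
rewrite [RHS]patchE; case: ifPn => wA; last first.
  by under eq_integral do rewrite patchE (negbTE wA); rewrite integral0.
under eq_integral do rewrite patchE wA.
rewrite -integral_mkcond integral_itv_bndo_bndc; last exact: (measurable_int mu (Y_itv' w)).
rewrite /Rintegral fineK//; apply: integrable_fin_num => //; exact: Y_itv.
Qed.

Lemma integrable_path_integral :
  Pr.-integrable setT (EFin \o (fun w => \int[mu]_(s in `[a, b]) Y w s)).
Proof.
have := integrable_fubini_F f_intT; apply: eq_integrable => // w _.
by rewrite /fubini_F f_intr patchE in_setT.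
Qed.

Lemma Rintegral_path_exchange A : measurable A ->
  (forall s, a <= s <= b -> Pr.-integrable setT (EFin \o Y^~ s)) ->
  \int[Pr]_(w in A) \int[mu]_(s in `[a, b]) Y w s =
  \int[mu]_(s in `[a, b]) \int[Pr]_(w in A) Y w s.
Proof.
move=> mA iY; rewrite /Rintegral.
congr fine.
transitivity (\int[Pr]_w \int[mu]_s f A (w, s))%E.
  rewrite integral_mkcond; apply: eq_integral => w _.
  by rewrite f_intr.
(* Integrability of Y_s for each fixed s makes the inner expectation finite, so [fine] loses
   nothing. *)
have fG s : s \in `[a, b[%classic -> (\int[Pr]_w f A (w, s) =
    (fine (\int[Pr]_(w in A) (Y w s)%:E))%:E)%E.
  move=> sab; have sab' : a <= s <= b.
    by move: sab; rewrite inE /= in_itv/= => /andP[-> /ltW ->].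
  rewrite fineK; last by apply: integrable_fin_num => //; apply: integrableS (iY s sab').
  rewrite [RHS]integral_mkcond; apply: eq_integral => w _.
  by rewrite fE !patchE sab.
rewrite (Fubini (f_int mA)) -[RHS]integral_itv_bndo_bndc.
  rewrite [RHS]integral_mkcond; apply: eq_integral => s _.
  rewrite patchE; case: ifPn => sab; first exact: fG.
  rewrite -[RHS](integral0 Pr setT); apply: eq_integral => w _.
  by rewrite fE !patchE (negbTE sab); case: ifP.
apply: (@eq_measurable_fun _ _ _ _ _ (fun s => \int[Pr]_w f A (w, s)))%E.
  by move=> s; exact: fG.
apply: measurable_funTS; exact: (measurable_fubini_G (f_int mA)).
Qed.

End fubini_path.

Section scalar_fubini_path.
Context {R : realType} {k : scalar_kind} d (Omega : measurableType d).
Variable Pr : probability Omega R.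
Local Notation F := (scalars R k).
Local Notation mu := (@lebesgue_measure R).
Variables (Y : Omega -> R -> F) (a b : R).
Hypothesis ab : a <= b.
Hypothesis Y_int : forall s, a <= s <= b -> sintegrable Pr (Y^~ s).
Hypothesis Y_tame : forall w, tame a b (Y w).
Hypothesis Y_int2 :
  (\int[Pr]_w \int[mu]_(s in `[a, b]) (modulus (Y w s))%:E < +oo)%E.

Let Y_meas s : a <= s <= b -> measurable_fun setT (sRe \o Y^~ s) /\
  measurable_fun setT (sIm \o Y^~ s).
Proof. by move=> /Y_int[/smeasurableE]. Qed.

Let modulus_tame w : tame a b (fun s => rsc (modulus (Y w s)) : F).
Proof. exact: tame_modulus. Qed.

(** A generic N covers the modulus and the absolute values of both parts. Embedding N(Y) in F
    reduces the claim to measurability of a scalar-valued path integral. *)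
Let measurable_path_integral (N : F -> R) :
  (forall s, a <= s <= b -> measurable_fun setT (fun w => N (Y w s))) ->
  (forall w, tame a b (fun s => rsc (N (Y w s)) : F)) ->
  measurable_fun setT (fun w => \int[mu]_(s in `[a, b]) (N (Y w s))%:E)%E.
Proof.
move=> mN tN.
have : smeasurable measurable
    (fun w => sint mu `[a, b] (fun s => rsc (N (Y w s)) : F)).
  apply: smeasurable_sint => //; first exact: sigma_algebra_measurable.
  move=> s sab; apply/smeasurableE; split.
    apply: eq_measurable_fun (mN s sab) => w _ /=.
    by rewrite sRe_rsc.
  rewrite (_ : _ \o _ = cst 0); first exact: measurable_cst.
  by apply/funext => w /=; rewrite sIm_rsc.
move=> /smeasurableE[+ _] => /measurable_EFinP; apply: eq_measurable_fun => w _ /=.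
rewrite sRe_sint /Rintegral; under eq_integral do rewrite sRe_rsc.
rewrite fineK//; have [+ _] := sL1_tame (tN w).
move=> /integrable_fin_num => /(_ (measurable_itv _)).
by under eq_integral do rewrite /= sRe_rsc.
Qed.

Lemma measurable_path_modulus :
  measurable_fun setT (fun w => \int[mu]_(s in `[a, b]) (modulus (Y w s))%:E)%E.
Proof.
apply: (@measurable_path_integral modulus) => //.
by move=> s /Y_meas[? ?]; exact: measurable_modulus.
Qed.

Let part_int (u : F -> R) : (forall z, `|u z| <= modulus z) ->
  (forall s, a <= s <= b -> measurable_fun setT (fun w => u (Y w s))) ->
  (forall w, tame a b (fun s => rsc (u (Y w s)) : F)) ->
  (\int[Pr]_w \int[mu]_(s in `[a, b]) `|u (Y w s)|%:E < +oo)%E.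
Proof.
move=> ule mu_ tu; apply: le_lt_trans Y_int2.
have tn w : tame a b (fun s => rsc `|u (Y w s)| : F).
  have [ru [K uK]] := tame_sRe (tu w); apply: tame_rsc.
    move=> s sab; have := ru s sab; rewrite sRe_rsc.
    by under eq_cvg do rewrite sRe_rsc; apply: cvg_norm.
  by exists K => s sab; rewrite normr_id; have := uK s sab; rewrite sRe_rsc.
have mn s : a <= s <= b -> measurable_fun setT (fun w => `|u (Y w s)|).
  by move=> sab; apply: measurableT_comp => //; exact: mu_.
have mm s : a <= s <= b -> measurable_fun setT (fun w => modulus (Y w s)).
  by move=> /Y_meas[? ?]; exact: measurable_modulus.
apply: ge0_le_integral => //.
- by move=> w _; exact: integral_ge0.
- exact: (@measurable_path_integral (fun z => `|u z|)).
- exact: (@measurable_path_integral modulus).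
move=> w _; apply: ge0_le_integral => //.
- have [/(measurable_int mu) + _] := sL1_tame (tn w); apply: eq_measurable_fun.
  by move=> s _ /=; rewrite sRe_rsc.
- have [/(measurable_int mu) + _] := sL1_tame (modulus_tame w); apply: eq_measurable_fun.
  by move=> s _ /=; rewrite sRe_rsc.
- by move=> s _; rewrite lee_fin.
Qed.

Let part_tame w : tame a b (fun s => rsc (sRe (Y w s)) : F) /\
  tame a b (fun s => rsc (sIm (Y w s)) : F).
Proof.
split.
  by have [rY bY] := tame_sRe (Y_tame w); exact: tame_rsc.
by have [rY bY] := tame_sIm (Y_tame w); exact: tame_rsc.
Qed.

Let sRe_int : (\int[Pr]_w \int[mu]_(s in `[a, b]) `|sRe (Y w s)|%:E < +oo)%E.
Proof.
apply: part_int; first exact: sRe_le_modulus.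
  by move=> s /Y_meas[].
by move=> w; have [] := part_tame w.
Qed.

Let sIm_int : (\int[Pr]_w \int[mu]_(s in `[a, b]) `|sIm (Y w s)|%:E < +oo)%E.
Proof.
apply: part_int; first exact: sIm_le_modulus.
  by move=> s /Y_meas[].
by move=> w; have [] := part_tame w.
Qed.

Lemma sintegrable_path_integral :
  sintegrable Pr (fun w => sint mu `[a, b] (Y w)).
Proof.
apply/sintegrableP; have [E|ab'] := leP b a.
  have -> : (fun w => sint mu `[a, b] (Y w)) = fun=> 0.
    have -> : a = b by apply/eqP; rewrite eq_le ab E.
    by apply/funext => w; rewrite sint_itv1.
  exact: sL10.
split.
  rewrite (_ : _ \o _ = EFin \o (fun w => \int[mu]_(s in `[a, b]) sRe (Y w s))).
    apply: integrable_path_integral => // [s /Y_meas[]//| |].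
      by move=> w s; have [rY _] := tame_sRe (Y_tame w); exact: rY.
    by move=> w; have [_] := tame_sRe (Y_tame w).
  by apply/funext => w /=; rewrite sRe_sint.
rewrite (_ : _ \o _ = EFin \o (fun w => \int[mu]_(s in `[a, b]) sIm (Y w s))).
  apply: integrable_path_integral => // [s /Y_meas[]//| |].
    by move=> w s; have [rY _] := tame_sIm (Y_tame w); exact: rY.
  by move=> w; have [_] := tame_sIm (Y_tame w).
by apply/funext => w /=; rewrite sIm_sint.
Qed.

Lemma sint_path_exchange A : measurable A ->
  sint Pr A (fun w => sint mu `[a, b] (Y w)) =
  sint mu `[a, b] (fun s => sint Pr A (Y^~ s)).
Proof.
move=> mA; have [E|ab'] := leP b a.
  have -> : a = b by apply/eqP; rewrite eq_le ab E.
  rewrite sint_itv1 -[RHS](sint0 Pr A); apply: eq_sint => w _.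
  exact: sint_itv1.
apply: scalar_ext; rewrite !(sRe_sint, sIm_sint).
  under eq_Rintegral do rewrite sRe_sint.
  under [RHS]eq_Rintegral do rewrite sRe_sint.
  apply: Rintegral_path_exchange => // [s /Y_meas[]//| | |s /Y_int/sintegrableP[]//].
    by move=> w s; have [rY _] := tame_sRe (Y_tame w); exact: rY.
  by move=> w; have [_] := tame_sRe (Y_tame w).
under eq_Rintegral do rewrite sIm_sint.
under [RHS]eq_Rintegral do rewrite sIm_sint.
apply: Rintegral_path_exchange => // [s /Y_meas[]//| | |s /Y_int/sintegrableP[]//].
  by move=> w s; have [rY _] := tame_sIm (Y_tame w); exact: rY.
by move=> w; have [_] := tame_sIm (Y_tame w).
Qed.

End scalar_fubini_path.

(** * Primitives *)

Section primitives.
Context {R : realType} {k : scalar_kind}.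
Local Notation F := (scalars R k).
Local Notation mu := (@lebesgue_measure R).
Implicit Types (f g H : R -> F) (b s t K : R).

Lemma cvg_right_lipschitz H s b K : s < b ->
  (forall r, s <= r <= b -> modulus (H s - H r) <= K * (r - s)) ->
  H r @[r --> s^'+] --> H s.
Proof.
move=> sb hH; apply/scvg_modulusP => e e0.
have K0 : 0 < `|K| + 1 by rewrite ltr_pwDr.
near=> r.
have sr : s < r by near: r; exact: nbhs_right_gt.
have rb : r <= b by near: r; exact: nbhs_right_le.
have rs : r - s < e / (`|K| + 1).
  by near: r; apply: nbhs_right_ltDr; rewrite divr_gt0.
apply: le_lt_trans (hH r _) _; first by rewrite (ltW sr).
apply: (@le_lt_trans _ _ ((`|K| + 1) * (r - s))).
  by rewrite ler_wpM2r ?subr_ge0 ?(ltW sr)// (le_trans (ler_norm K))// lerDl.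
by rewrite mulrC -ltr_pdivlMr.
Unshelve. all: by end_near. Qed.

Lemma cvg_left_lipschitz H s b K : b < s ->
  (forall r, b <= r <= s -> modulus (H s - H r) <= K * (s - r)) ->
  H r @[r --> s^'-] --> H s.
Proof.
move=> sb hH; apply/scvg_modulusP => e e0.
have K0 : 0 < `|K| + 1 by rewrite ltr_pwDr.
near=> r.
have sr : r < s by near: r; exact: nbhs_left_lt.
have rb : b <= r by near: r; exact: nbhs_left_ge.
have rs : s - r < e / (`|K| + 1).
  by near: r; apply: nbhs_left_ltBl; rewrite divr_gt0.
apply: le_lt_trans (hH r _) _; first by rewrite rb ltW.
apply: (@le_lt_trans _ _ ((`|K| + 1) * (s - r))).
  by rewrite ler_wpM2r ?subr_ge0 ?(ltW sr)// (le_trans (ler_norm K))// lerDl.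
by rewrite mulrC -ltr_pdivlMr.
Unshelve. all: by end_near. Qed.

(** The source of every regularity of primitives below: cadlag paths, bounded variation, and errors
    proportional to the mesh. *)
Lemma sint_lipschitz b f : tame 0 b f -> exists2 K, 0 <= K &
  forall s t, 0 <= s -> s <= t -> t <= b ->
    modulus (sint mu `[0, t] f - sint mu `[0, s] f) <= K * (t - s).
Proof.
move=> tf; have [_ [K fK]] := tf; exists (2 * `|K|); first by rewrite mulr_ge0.
move=> s t s0 st tb.
rewrite (@sint_cat _ _ 0 s t)//; last exact: tameS tf.
rewrite addrC addKr; apply: modulus_sint_le => //; first exact: tameS tf.
move=> r /andP[sr rt]; apply: le_trans (ler_norm K); apply: fK.
by rewrite (le_trans s0)//= (le_trans rt).
Qed.

Lemma cadlag_sint f : (forall t, tame 0 t f) -> cadlag (fun t => sint mu `[0, t] f).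
Proof.
move=> tf; split=> t t0.
  have [K _ hK] := sint_lipschitz (tf (t + 1)).
  apply: (@cvg_right_lipschitz _ t (t + 1) K); first by rewrite ltrDl.
  by move=> r /andP[tr rt]; rewrite modulusBC hK.
have [K _ hK] := sint_lipschitz (tf t).
apply/cvg_ex; exists (sint mu `[0, t] f).
apply: (@cvg_left_lipschitz _ t 0 K) => //.
by move=> r /andP[r0 rt]; rewrite hK.
Qed.

Lemma cadlagD f g : cadlag f -> cadlag g -> cadlag (fun t => f t + g t).
Proof.
move=> [rf lf] [rg lg]; split=> t t0; first by apply: cvgD; [exact: rf|exact: rg].
by apply: is_cvgD; [exact: lf|exact: lg].
Qed.

Lemma cadlagN f : cadlag f -> cadlag (fun t => - f t).
Proof.
move=> [rf lf]; split=> t t0; first by apply: cvgN; exact: rf.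
by apply: is_cvgN; exact: lf.
Qed.

Lemma cadlag_cst (c : F) : cadlag (fun=> c).
Proof. by split=> t t0; [exact: cvg_cst|exact: is_cvg_cst]. Qed.

Lemma cadlagB f g : cadlag f -> cadlag g -> cadlag (fun t => f t - g t).
Proof. by move=> cf cg; apply: cadlagD => //; exact: cadlagN. Qed.

(** u is the difference of the nondecreasing functions u(s) + K s and K s. *)
Lemma lipschitz_bounded_variation (u : R -> R) K t :
  (forall r s, 0 <= r -> r <= s -> s <= t -> `|u s - u r| <= K * (s - r)) ->
  0 <= t -> bounded_variation 0 t u.
Proof.
move=> uK; rewrite le_eqVlt => /predU1P[<-|t0]; first exact: bounded_variationxx.
rewrite (_ : u = (fun s => u s + K * s) \+ (\- (fun s => K * s))); last first.
  by apply/funext => s /=; rewrite addrK.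
have K0 : 0 <= K.
  have := uK 0 t (lexx _) (ltW t0) (lexx _); rewrite subr0.
  by move=> /(le_trans (normr_ge0 _)); rewrite pmulr_lge0.
apply: bounded_variationD => //.
  apply: nondecreasing_bounded_variation => r s; rewrite !in_itv/=.
  move=> /andP[r0 rt] /andP[s0 st] rs.
  rewrite -subr_ge0 opprD addrACA -mulrBr -lerBlDl sub0r.
  apply: le_trans (uK _ _ r0 rs st).
  by rewrite -normrN ler_norm.
apply: bounded_variationN; apply: nondecreasing_bounded_variation => r s _ _ rs.
by rewrite ler_wpM2l.
Qed.

Lemma bounded_variation_sint b f : tame 0 b f -> 0 <= b ->
  bounded_variation 0 b (sRe \o (fun t => sint mu `[0, t] f)) /\
  bounded_variation 0 b (sIm \o (fun t => sint mu `[0, t] f)).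
Proof.
move=> tf b0; have [K _ hK] := sint_lipschitz tf.
split; apply: (@lipschitz_bounded_variation _ K) => // r s r0 rs sb /=;
  apply: le_trans (hK r s r0 rs sb); rewrite -raddfB.
  exact: sRe_le_modulus.
exact: sIm_le_modulus.
Qed.

Lemma tame_sint (b : R) (f : R -> F) : tame 0 b f ->
  tame 0 b (fun t => sint mu `[0, t] f).
Proof.
move=> tf; have [K K0 hK] := sint_lipschitz tf; split.
  move=> s /andP[s0 sb]; apply: (@cvg_right_lipschitz _ s b K) => //.
  by move=> r /andP[sr rb]; rewrite modulusBC hK.
exists (K * b) => s /andP[s0 sb].
have := hK 0 s (lexx 0) s0 sb; rewrite sint_itv1 !subr0 => /le_trans; apply.
by rewrite ler_wpM2l.
Qed.

Lemma tame_sint_rev (b : R) (f : R -> F) : tame 0 b f ->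
  tame 0 b (fun t => sint mu `[0, b - t] f).
Proof.
move=> tf; have [K K0 hK] := sint_lipschitz tf; split.
  move=> s /andP[s0 sb]; apply: (@cvg_right_lipschitz _ s b K) => //.
  move=> r /andP[sr rb].
  have -> : r - s = (b - s) - (b - r) by ring.
  by apply: hK; rewrite ?subr_ge0// ?lerD2l ?lerN2// gerBl.
exists (K * b) => s /andP[s0 sb].
have bs : 0 <= b - s by rewrite subr_ge0.
have := hK 0 _ (lexx 0) bs; rewrite sint_itv1 !subr0 gerBl => /(_ s0)/le_trans; apply.
by rewrite ler_wpM2l// gerBl.
Qed.

Lemma part_rev (a b : R) n i : (i <= n.+1)%N ->
  a + b - part a b n i = part a b n (n.+1 - i).
Proof.
move=> hi; have n0 : n.+1%:R != 0 :> R by rewrite pnatr_eq0.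
rewrite /part natrB//; field.
by rewrite -natr1 in n0 *.
Qed.

Lemma cvg_mesh_bound (C t : R) (u : nat -> F) (l : F) :
  (forall n, modulus (l - u n) <= C * (t / n.+1%:R)) -> u n @[n --> \oo] --> l.
Proof.
move=> uC; apply/scvg_modulusP => e e0.
have : C * (t / n.+1%:R) @[n --> \oo] --> (0 : R).
  rewrite -(mulr0 C); apply: cvgM; first exact: cvg_cst.
  by have := @cvg_mesh R 0 t; rewrite subr0.
move=> /cvgrPdist_lt/(_ e e0); apply: filterS => n; rewrite sub0r normrN.
by apply: le_lt_trans; apply: le_trans (uC n) (ler_norm _).
Qed.

(** Reflection turns right-endpoint sums into left-endpoint sums, and the two differ by (f b - f a)
    times the mesh after telescoping. The reflected function must be assumed [tame], since
    reflection exchanges left and right continuity. *)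
Lemma sint_reflect (a b : R) (f : R -> F) : a <= b -> tame a b f ->
  tame a b (fun s => f (a + b - s)) ->
  sint mu `[a, b] (fun s => f (a + b - s)) = sint mu `[a, b] f.
Proof.
move=> ab tf tf'.
have c1 := sint_right_riemann ab tf; have c2 := sint_right_riemann ab tf'.
set S1 := (fun n => _) in c1; set S2 := (fun n => _) in c2.
have E n : S1 n - (f b - f a) * rsc ((b - a) / n.+1%:R) = S2 n.
  rewrite /S1 /S2 -!mulr_suml -mulrBl; congr (_ * _).
  rewrite [RHS](reindex_inj rev_ord_inj).
  transitivity (\sum_(i < n.+1) f (part a b n i)); last first.
    apply: eq_bigr => i _; have -> : (rev_ord i).+1 = (n.+1 - i)%N.
      by rewrite /= -subSn// ltnW.
    by rewrite part_rev ?leq_subr// subKn// ltnW.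
  have := telescope_sumr (fun i => f (part a b n i)) (leq0n n.+1).
  rewrite big_mkord part0 part_last sumrB => <-.
  by rewrite opprB addrC subrK.
have c3 : (f b - f a) * rsc ((b - a) / n.+1%:R) @[n --> \oo] --> (0 : F).
  apply: (@cvg_mesh_bound (modulus (f b - f a)) (b - a)) => n.
  rewrite sub0r modulusN modulusM modulus_rsc ger0_norm// divr_ge0//.
  by rewrite subr_ge0.
have c4 : S2 n @[n --> \oo] --> sint mu `[a, b] f.
  rewrite -[X in _ --> X]subr0; apply: cvg_trans (cvgB c1 c3).
  by apply: near_eq_cvg; apply: nearW => n; rewrite -E.
exact: (norm_cvg_unique c2 c4).
Qed.

(** The reflected piece is the integral of f over [t - s, t], written as a difference of integrals
    from 0 so as to match W_t - W_(t-s). It is reached by removing [s, t], shifting that interval to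
    0 and reflecting it. *)
Lemma sint_reflect_sub (t s : R) (f : R -> F) : 0 <= s -> s <= t -> tame 0 t f ->
  tame 0 t (fun r => f (t - r)) ->
  sint mu `[0, s] (fun r => f (t - r)) = sint mu `[0, t] f - sint mu `[0, t - s] f.
Proof.
move=> s0 st tf tf'; have t0 := le_trans s0 st.
have := @sint_reflect 0 t f t0 tf; rewrite add0r => <-//.
rewrite (@sint_cat _ _ 0 s t)//.
suff -> : sint mu `[s, t] (fun r => f (t - r)) = sint mu `[0, t - s] f.
  by rewrite addrK.
have ts0 : 0 <= t - s by rewrite subr_ge0.
have tf1 : tame 0 (t - s) f by apply: tameS tf; rewrite // gerBl.
have tf1' : tame (0 + s) (t - s + s) (fun r => f (t - r)).
  by rewrite add0r subrK; apply: tameS tf'.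
have := sint_shift ts0 tf1'; rewrite add0r subrK => ->.
have tE r : t - (r + s) = 0 + (t - s) - r by ring.
transitivity (sint mu `[0, t - s] (fun r => f (0 + (t - s) - r))).
  by apply: eq_sint => r _; rewrite tE.
apply: sint_reflect => //.
by apply: eq_tame (tame_shift tf1') => r _; rewrite tE.
Qed.

(** Right-continuity of a does not survive time reversal, but a_h = 1 + G W_h is affine in
    primitives, which are Lipschitz and therefore stay right-continuous when reversed. *)
Lemma tame_semigroup_rev n (a : R -> 'M[F]_n) (G : 'M[F]_n) t i j :
  (forall i j, tame 0 t (fun s => a s i j)) ->
  (forall h, 0 <= h -> a h = 1%:M + G *m Wint a h) ->
  tame 0 t (fun s => a (t - s) i j).
Proof.
move=> ta aE.
have : tame 0 t (fun s => (1%:M : 'M[F]_n) i j + \sum_l G i l *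
    sint mu `[0, t - s] (fun r => a r l j)).
  apply: tameD; first exact: tame_cst.
  apply: tame_sum => l; apply: tameM; first exact: tame_cst.
  by apply: tame_sint_rev; exact: ta.
apply: eq_tame => s /andP[_ st]; rewrite [in RHS]aE ?subr_ge0// [RHS]mxE; congr (_ + _).
by rewrite [RHS]mxE; apply: eq_bigr => l _; rewrite [Wint _ _ _ _]mxE.
Qed.

End primitives.

(** * Martingales as semimartingales *)

Section martingale_semimartingale.
Context {R : realType} {k : scalar_kind} d (Omega : measurableType d).
Local Notation F := (scalars R k).
Variable Pr : probability Omega R.
Variable Ft : R -> set (set Omega).
Hypothesis hFt : filtration Ft.

Lemma finite_variation0 : finite_variation Ft (fun (_ : Omega) (_ : R) => 0 : F).
Proof.
have [sF _] := hFt.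
split; first by move=> t t0; apply: smeasurable_cst; exact: sF.
split; first by move=> w; exact: cadlag_cst.
by move=> w t t0; split; apply: (@lipschitz_bounded_variation R _ 0) => // r s _ _ _;
  rewrite /= subrr normr0 mul0r.
Qed.

Lemma martingale_local (Y : Omega -> R -> F) :
  martingale Pr Ft Y -> local_martingale Pr Ft Y.
Proof.
move=> mY; have [aY [cY _]] := mY; split => //; split => //.
(* Stopping at +oo changes nothing, so a constant localizing sequence is admissible. *)
exists (fun _ _ => +oo%E); split.
  move=> n; split=> [w|t t0]; first by rewrite leey.
  have [s0 _ _] := hFt.1 t t0.
  by rewrite [X in Ft t X](_ : _ = set0)//; apply/seteqP; split.
split; first by move=> n w.
split; first by apply: aeW => w; exact: cvg_cst.
move=> n; rewrite (_ : stopped Y _ = Y)//.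
by apply/funext => w; apply/funext => t; rewrite /stopped miney.
Qed.

Lemma martingale_semimartingale (Y : Omega -> R -> F) :
  martingale Pr Ft Y -> (forall w, Y w 0 = 0) -> semimartingale Pr Ft Y.
Proof.
move=> mY Y0; split; first by have [aY _] := mY; exact: aY.
exists Y, (fun _ _ => 0); split; first exact: martingale_local.
split => //; split; first exact: finite_variation0.
by split => // w t t0; rewrite Y0 add0r addr0.
Qed.

End martingale_semimartingale.

(** * Stochastic integrals of deterministic integrands *)

Section deterministic_integrand.
Context {R : realType} {k : scalar_kind} d (Omega : measurableType d).
Local Notation F := (scalars R k).

Variables (Pr : probability Omega R) (Ft : R -> set (set Omega)).
Hypothesis hFt : filtration Ft.

(** An event that ignores the outcome is empty or everything. This makes deterministic times
    stopping times and deterministic coefficients measurable at them. *)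
Lemma filtration_cst t (Q : Prop) : 0 <= t -> Ft t [set _ | Q].
Proof.
move=> /hFt.1[F0 FC _]; have [q|q] := pselect Q.
  rewrite [X in Ft t X](_ : _ = setT `\` set0); first exact: FC.
  by rewrite setD0; apply/seteqP; split.
by rewrite [X in Ft t X](_ : _ = set0)//; apply/seteqP; split.
Qed.

Lemma stopping_time_cst (c : R) : 0 <= c -> stopping_time Ft (fun _ => c%:E).
Proof.
by move=> c0; split=> [w|t t0]; [rewrite lee_fin|exact: filtration_cst].
Qed.

Lemma stopped_smeasurable_cst (tau : R) (c : F) :
  smeasurable (stopped_sigma_algebra Ft (fun _ => tau%:E)) (fun=> c).
Proof.
have H (Q : Prop) : stopped_sigma_algebra Ft (fun _ => tau%:E) [set _ | Q].
  split.
    have [q|q] := pselect Q.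
      by rewrite [X in measurable X](_ : _ = setT)//; apply/seteqP; split.
    by rewrite [X in measurable X](_ : _ = set0)//; apply/seteqP; split.
  move=> t t0; rewrite [X in Ft t X](_ : _ = [set _ | Q /\ (tau%:E <= t%:E)%E]).
    exact: filtration_cst.
  by apply/seteqP; split.
by move=> B mB; split; [exact: (H (B (sRe c)))|exact: (H (B (sIm c)))].
Qed.

(** The indicators of the exceptional events tend to 0 pointwise and are dominated by 1. *)
Lemma cvg_in_probability (f : nat -> Omega -> F) (z : Omega -> F) (eps : R) :
  (forall n, smeasurable measurable (f n)) -> smeasurable measurable z ->
  (forall w, f n w @[n --> \oo] --> z w) -> 0 < eps ->
  Pr [set w | eps < modulus (f n w - z w)] @[n --> \oo] --> 0%E.
Proof.
move=> mf mz fz eps0.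
pose A n := [set w | eps < modulus (f n w - z w)].
have sM := @sigma_algebra_measurable _ Omega.
have mA n : measurable (A n).
  have := smeasurableB sM (mf n) mz => /smeasurableE[m1 m2].
  have := measurable_modulus m1 m2 => mm.
  rewrite (_ : A n = (fun w => modulus (f n w - z w)) @^-1` `]eps, +oo[).
    by rewrite -[X in measurable X]setTI; exact: mm.
  by apply/seteqP; split => w; rewrite /A /= in_itv/= andbT.
have [|||||_ _] := @dominated_convergence _ Omega R Pr setT measurableT
  (fun n w => (\1_(A n) w)%:E) (cst 0%E) (cst 1%E).
- by move=> n; apply/measurable_EFinP; exact: measurable_indic.
- exact: measurable_cst.
- apply: aeW => w _; apply: cvg_near_cst.
  have /scvg_modulusP/(_ eps eps0) := fz w; apply: filterS => n hn.
  by rewrite indicE memNset// /A /= modulusBC => /(lt_trans hn); rewrite ltxx.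
- exact: (finite_measure_integrable_cst Pr 1).
- apply: aeW => w n _; rewrite indicE gee0_abs ?lee_fin//.
  by case: (_ \in _).
rewrite integral0; apply: cvg_trans; apply: near_eq_cvg; apply: nearW => n.
by rewrite /= integral_indic// setIT.
Qed.

End deterministic_integrand.

(** * Integration of a deterministic primitive by partial summation *)

Section deterministic_stochastic_integral.
Context {R : realType} {k : scalar_kind} d (Omega : measurableType d).
Local Notation F := (scalars R k).
Local Notation mu := (@lebesgue_measure R).
Variables (Pr : probability Omega R) (Ft : R -> set (set Omega)).
Hypothesis hFt : filtration Ft.

(** Simple predictable processes live on cells open on the left, in contrast with the cells of
    [part_locate] used for right-continuous functions. *)
Lemma part_locate_left (a b : R) n s : a < s <= b ->
  exists i : 'I_n.+1, part a b n i < s <= part a b n i.+1.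
Proof.
move=> /andP[sa sb].
have : exists i, (i <= n.+1)%N && (s <= part a b n i).
  by exists n.+1; rewrite leqnn part_last.
move=> /ex_minnP[[|i]]; first by rewrite part0 /= leNgt sa.
move=> /andP[hi hs] hmin; exists (Ordinal hi); rewrite hs andbT ltNge.
by apply/negP => si; have := hmin i; rewrite si (ltnW hi) ltnn => /(_ isT).
Qed.

Variables (H phi : R -> F) (t : R).
Hypothesis t0 : 0 <= t.
Hypothesis phi_tame : tame 0 t phi.
Hypothesis H_prim : forall s, 0 <= s <= t -> H s = H 0 + sint mu `[0, s] phi.

Let H_tame : tame 0 t H.
Proof.
have : tame 0 t (fun s => H 0 + sint mu `[0, s] phi).
  by apply: tameD; [exact: tame_cst|exact: tame_sint].
by apply: eq_tame => s st; rewrite -H_prim.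
Qed.

Let H_diff r s : 0 <= r -> r <= s -> s <= t ->
  H s - H r = sint mu `[0, s] phi - sint mu `[0, r] phi.
Proof.
move=> r0 rs st.
have -> : H s = H 0 + sint mu `[0, s] phi by apply: H_prim; rewrite st (le_trans r0).
have -> : H r = H 0 + sint mu `[0, r] phi by apply: H_prim; rewrite r0 (le_trans rs).
by rewrite opprD addrACA subrr add0r.
Qed.

Let H_incr r s : 0 <= r -> r <= s -> s <= t ->
  H s - H r = sint mu `[r, s] phi.
Proof.
move=> r0 rs st; have tp : tame 0 s phi by exact: tameS phi_tame.
by rewrite H_diff// (sint_cat r0 rs tp) addrC addKr.
Qed.

Let H_lip : exists2 K, 0 <= K & forall r s, 0 <= r -> r <= s -> s <= t ->
  modulus (H s - H r) <= K * (s - r).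
Proof.
have [K K0 hK] := sint_lipschitz phi_tame; exists K => // r s r0 rs st.
by rewrite H_diff//; exact: hK.
Qed.

(** H is sampled at left endpoints of deterministic cells. The construction is transparent so that
    [simple_int] reduces to an explicit sum. *)
Let simple_approx (n : nat) : @simple_predictable R k d Omega Ft.
Proof.
apply: (@SimplePredictable R k d Omega Ft n.+1 (fun i _ => part 0 t n i)
  (fun i _ => H (part 0 t n i))).
- by move=> i hi; apply: stopping_time_cst => //; have /andP[] := part_itv t0 hi.
- by move=> i _ _; exact: le_part.
- by move=> i hi; exact: stopped_smeasurable_cst.
Defined.

Let simple_approx_at n w s : 0 < s <= t -> exists r,
  [/\ 0 <= r, r <= s, s - r <= t / n.+1%:R & simple_at (simple_approx n) w s = H r].
Proof.
move=> st; have [i /andP[i1 i2]] := part_locate_left n st.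
have /andP[ri0 _] := part_itv t0 (ltnW (ltn_ord i)).
exists (part 0 t n i); split => //; first exact: ltW.
  by move: i2; rewrite partS subr0 lerBlDl.
rewrite /simple_at (bigD1 i) ?i1//= big1 ?addr0// => j /andP[/andP[j1 j2] ji].
exfalso; move: ji; rewrite neq_ltn => /orP[ij|ij].
  by have := le_part n t0 ij; rewrite leNgt (lt_le_trans i1 j2).
by have := le_part n t0 ij; rewrite leNgt (lt_le_trans j1 i2).
Qed.

(** The right-endpoint sums are known to converge. Moving H to the left endpoint costs, on each of
    the n + 1 cells, a Lipschitz increment of H times an integral of g, both of the order of the
    mesh. *)
Let left_sum (g : R -> F) : tame 0 t g ->
  \sum_(i < n.+1) H (part 0 t n i) * sint mu `[part 0 t n i, part 0 t n i.+1] g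
    @[n --> \oo] --> sint mu `[0, t] (fun s => H s * g s).
Proof.
move=> tg; have c1 := sint_right_sum t0 H_tame tg.
have [K K0 hK] := H_lip; have [_ [C hC]] := tg.
have c2 : \sum_(i < n.+1) (H (part 0 t n i.+1) - H (part 0 t n i)) *
    sint mu `[part 0 t n i, part 0 t n i.+1] g @[n --> \oo] --> (0 : F).
  (* K is the Lipschitz constant of H and 2 |C| that of the primitive of g; one factor t / (n + 1)
     is absorbed by the n + 1 cells and leaves the t in the constant. *)
  apply: (@cvg_mesh_bound _ _ (K * (2 * `|C|) * t) t) => n.
  rewrite sub0r modulusN; apply: (le_trans (ler_modulus_sum _)).
  have n0 : n.+1%:R != 0 :> R by rewrite pnatr_eq0.
  have mesh0 : 0 <= t / n.+1%:R by rewrite divr_ge0.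
  apply: (@le_trans _ _ (\sum_(i < n.+1) (K * (t / n.+1%:R)) * (2 * `|C| * (t / n.+1%:R)))).
    apply: ler_sum => i _.
    have ile := le_part n t0 (leqnSn i).
    have /andP[ri0 rit] := part_itv t0 (ltnW (ltn_ord i)).
    have /andP[_ rSt] := @part_itv R 0 t n i.+1 t0 (ltn_ord i).
    have inc : part 0 t n i.+1 - part 0 t n i = t / n.+1%:R.
      by rewrite partS subr0 addrC addKr.
    rewrite modulusM ler_pM ?modulus_ge0// -inc; first exact: hK.
    apply: modulus_sint_le => //; first exact: tameS tg.
    move=> s /andP[s1 s2]; apply: le_trans (ler_norm C); apply: hC.
    by rewrite (le_trans ri0)//= (le_trans s2).
  rewrite sumr_const card_ord -[X in X <= _]mulr_natr.
  rewrite le_eqVlt; apply/orP; left; apply/eqP; field.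
  by rewrite -natr1 in n0 *.
rewrite -[X in _ --> X]subr0; apply: cvg_trans (cvgB c1 c2).
apply: near_eq_cvg; apply: nearW => n /=.
rewrite -[LHS]sumrB; apply: eq_bigr => i _.
by rewrite -mulrBl opprB addrC subrK.
Qed.

Variables y g : Omega -> R -> F.
Hypothesis y_tame : forall w, tame 0 t (y w).
Hypothesis g_tame : forall w, tame 0 t (g w).
Hypothesis y_meas : forall s, 0 <= s <= t -> smeasurable measurable (y^~ s).
Hypothesis g_meas : forall s, 0 <= s <= t -> smeasurable measurable (g^~ s).
Variable Y : Omega -> R -> F.
Hypothesis Y_semi : semimartingale Pr Ft Y.
Hypothesis YE : forall w s, 0 <= s <= t -> Y w s = y w s - y w 0 - sint mu `[0, s] (g w).

(* Since H has bounded variation, partial summation turns the left-endpoint sums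
   of H against Y into Riemann sums that converge path by path. *)
Definition deterministic_int w : F := H t * y w t - H 0 * y w 0
  - sint mu `[0, t] (fun s => y w s * phi s) - sint mu `[0, t] (fun s => H s * g w s).

Let sM : sigma_algebra [set: Omega] measurable.
Proof. exact: sigma_algebra_measurable. Qed.

Lemma smeasurable_deterministic_int : smeasurable measurable deterministic_int.
Proof.
have c0 (c : F) : smeasurable measurable (fun _ : Omega => c) by exact: smeasurable_cst.
apply: smeasurableB => //; [apply: smeasurableB => //; [apply: smeasurableB => //|]|].
- by apply: smeasurableM => //; apply: y_meas; rewrite t0 lexx.
- by apply: smeasurableM => //; apply: y_meas; rewrite lexx.
- apply: smeasurable_sint => //.
    by move=> s st; apply: smeasurableM => //; exact: y_meas.
  by move=> w; exact: tameM.
- apply: smeasurable_sint => //.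
    by move=> s st; apply: smeasurableM => //; exact: g_meas.
  by move=> w; exact: tameM.
Qed.

(** On a cell from r to s, H_r (y_s - y_r) = H_s y_s - H_r y_r - y_s (H_s - H_r), and the first two
    terms telescope. Thus y is sampled on the right, where it is continuous, while H, being
    Lipschitz, may stay on the left. *)
Let simple_intE n w : simple_int (simple_approx n) Y w t =
  H t * y w t - H 0 * y w 0
  - \sum_(i < n.+1) y w (part 0 t n i.+1) * sint mu `[part 0 t n i, part 0 t n i.+1] phi
  - \sum_(i < n.+1) H (part 0 t n i) * sint mu `[part 0 t n i, part 0 t n i.+1] (g w).
Proof.
have := telescope_sumr (fun i => H (part 0 t n i) * y w (part 0 t n i)) (leq0n n.+1).
rewrite big_mkord part0 part_last => <-.
rewrite -!sumrB; apply: eq_bigr => i _ /=.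
have ile := le_part n t0 (leqnSn i).
have /andP[ri0 rit] := part_itv t0 (ltnW (ltn_ord i)).
have /andP[rS0 rSt] := @part_itv R 0 t n i.+1 t0 (ltn_ord i).
rewrite !min_l// !YE ?ri0 ?rS0// -H_incr//.
rewrite (@sint_cat _ _ 0 (part 0 t n i) (part 0 t n i.+1))//; last exact: tameS (g_tame w).
ring.
Qed.

Let cvg_simple_int w :
  simple_int (simple_approx n) Y w t @[n --> \oo] --> deterministic_int w.
Proof.
have c1 := sint_right_sum t0 (y_tame w) phi_tame.
have c2 := left_sum (g_tame w).
apply: cvg_trans (cvgB (cvgB (cvg_cst (H t * y w t - H 0 * y w 0)) c1) c2).
by apply: near_eq_cvg; apply: nearW => n; rewrite simple_intE.
Qed.

Lemma stoch_int_deterministic :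
  stoch_int Pr Ft (fun _ s => H s) Y t deterministic_int.
Proof.
have [K K0 hK] := H_lip.
split => //; split.
  by move=> s /andP[s0 _]; apply: smeasurable_cst; apply: hFt.1; exact: ltW.
split.
  move=> w; split => s /andP[s1 s2].
    apply: (@cvg_left_lipschitz _ _ _ s 0 K) => // r /andP[r0 rs].
    by rewrite hK.
  apply/cvg_ex; exists (H s); apply: (@cvg_right_lipschitz _ _ _ s t K) => //.
  by move=> r /andP[sr rt]; rewrite modulusBC hK.
split; first exact: smeasurable_deterministic_int.
exists simple_approx => eps eps0; split.
  (* The approximation of H is uniform with error at most K t / (n + 1), so the exceptional set is
     eventually empty. *)
  apply: cvg_near_cst.
  have : K * (t / n.+1%:R) @[n --> \oo] --> (0 : R).
    rewrite -(mulr0 K); apply: cvgM; first exact: cvg_cst.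
    by have := @cvg_mesh R 0 t; rewrite subr0.
  move=> /cvgrPdist_lt/(_ eps eps0); apply: filterS => n; rewrite sub0r normrN => hn.
  rewrite [X in Pr X](_ : _ = set0) ?measure0//; apply/seteqP; split => // w [s [st hs]].
  have [r [r0 rs sr rE]] := simple_approx_at n w st.
  move: hs; rewrite rE modulusBC ltNge => /negP; apply.
  apply: (le_trans (hK r s r0 rs _)); first by case/andP: st.
  apply: (le_trans _ (ltW hn)); apply: (le_trans _ (ler_norm _)).
  by rewrite ler_wpM2l.
apply: cvg_in_probability => //; last exact: smeasurable_deterministic_int.
move=> n.
have c0 (c : F) : smeasurable measurable (fun _ : Omega => c) by exact: smeasurable_cst.
rewrite (funext (simple_intE n)).
apply: smeasurableB => //; [apply: smeasurableB => //; [apply: smeasurableB => //|]|].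
- by apply: smeasurableM => //; apply: y_meas; rewrite t0 lexx.
- by apply: smeasurableM => //; apply: y_meas; rewrite lexx.
- apply: smeasurable_sum => // i; apply: smeasurableM => //.
  by apply: y_meas; rewrite part_itv.
- apply: smeasurable_sum => // i; apply: smeasurableM => //.
  have /andP[ri0 rit] := part_itv t0 (ltnW (ltn_ord i)).
  have /andP[rS0 rSt] := @part_itv R 0 t n i.+1 t0 (ltn_ord i).
  apply: smeasurable_sint => //; first exact: le_part.
    move=> s /andP[s1 s2]; apply: g_meas.
    by rewrite (le_trans ri0)//= (le_trans s2).
  by move=> w; exact: tameS (g_tame w).
Qed.

End deterministic_stochastic_integral.

(** * The compensated process *)

Section polynomial_martingale.
Context {R : realType} {k : scalar_kind} {E : Type} (e : E).
Local Notation F := (scalars R k).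
Local Notation mu := (@lebesgue_measure R).
Context {P : submodClosed (E -> F)} {deg : submod P -> nat}.
Hypothesis hdeg : polynomial_space deg.
Context {L : submodClosed (submod P)}.
Hypothesis hL : complement01 deg L.
Context {T : R -> {linear submod P -> submod P}}.
Hypothesis hT : polynomial_action deg T.
Context {V : submod L -> submodClosed (submod L)}.
Hypothesis hF : assumptionF deg T V.
Implicit Types (p q : submod P) (l : submod L).

(** Hides the extended basis behind row vectors: T_h acts by right multiplication with a_h and the
    generator with G, so later arguments become matrix identities. Entries are [tame] in both time
    directions, since convolutions run time backwards. *)
Lemma generator_coordinates l :
  exists n (f : 'I_n -> submod P) (a : R -> 'M[F]_n) (G : 'M[F]_n) (u : 'rV[F]_n),
  [/\ forall i, Pol deg 1 (f i),
      forall h (v : 'rV_n), 0 <= h ->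
        T h (\sum_i v 0 i *: f i) = \sum_i (v *m a h) 0 i *: f i,
      forall v : 'rV_n, is_gen T (\sum_i v 0 i *: f i) (\sum_i (v *m G) 0 i *: f i),
      forall t i j, tame 0 t (fun s => a s i j) /\ tame 0 t (fun s => a (t - s) i j) &
      (forall h, 0 <= h -> a h = 1%:M + G *m Wint a h /\ a h = 1%:M + Wint a h *m G) /\
      val l = \sum_i u 0 i *: f i].
Proof.
have [[n [b bb]] [Vl _]] := hF l.
have [a [G [aT ta aE hG]]] := extended_basis_generator hdeg hL hT hF e bb.
have [c [hc _]] := bb (Submod Vl).
pose f := extended_basis b.
exists n.+1, f, a, G, (\row_i if unlift ord0 i is Some j then c j else 0); split.
- move=> i; exact: Pol1_extended_basis.
- move=> h v h0; rewrite linear_sum.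
  under eq_bigr => i _ do rewrite linearZ/= (aT h i h0) scaler_sumr.
  rewrite exchange_big; apply: eq_bigr => j _; rewrite mxE scaler_suml.
  by apply: eq_bigr => i _; rewrite scalerA.
- move=> v; pose q i := \sum_j G i j *: f j.
  have -> : \sum_i (v *m G) 0 i *: f i = \sum_i v 0 i *: q i.
    under [RHS]eq_bigr => i _ do rewrite /q scaler_sumr.
    rewrite [RHS]exchange_big; apply: eq_bigr => j _; rewrite mxE scaler_suml.
    by apply: eq_bigr => i _; rewrite scalerA.
  elim: (index_enum _) => [|i r ih].
    rewrite !big_nil => x; rewrite ev0.
    rewrite [X in X @ _ --> _](_ : _ = fun=> 0); first exact: cvg_cst.
    by apply/funext => r; rewrite linear0 !ev0 subrr mul0r.
  rewrite !big_cons; exact: (is_gen_lin (hG i) ih).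
- move=> t i j; split; first exact: ta.
  by apply: (@tame_semigroup_rev _ _ _ a G); [exact: ta|move=> h /aE[]].
split => //.
rewrite big_ord_recl mxE unlift_none scale0r add0r.
have /(congr1 val)/(congr1 val) := hc; rewrite !val_sumZ /= => ->.
by apply: eq_bigr => j _; rewrite mxE liftK /f extended_basisS.
Qed.

(* Only finitely many coefficients depend on r, so the integral commutes with
   every functional, without any continuity of phi. *)
Lemma dynkin_functional (phi : submod P -> F) l h :
  (forall c p q, Pol deg 1 p -> Pol deg 1 q -> phi (c *: p + q) = c * phi p + phi q) ->
  0 <= h ->
  [/\ tame 0 h (fun r => phi (T r (gen T (val l)))),
      tame 0 h (fun r => phi (T (h - r) (gen T (val l)))) &
      phi (T h (val l)) - phi (val l) =
        sint mu `[0, h] (fun r => phi (T r (gen T (val l))))].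
Proof.
move=> phi_lin h0.
have [n [f [a [G [u [f1 TE gE ta [aE uE]]]]]]] := generator_coordinates l.
have z1 : Pol deg 1 (0 : submod P).
  by apply: Pol0_Pol1; apply/Pol0P => //; exists 0 => x; rewrite ev0.
have phi_sum (v : 'rV[F]_n) : phi (\sum_i v 0 i *: f i) = \sum_i v 0 i * phi (f i).
  have phi0 : phi 0 = 0.
    have := phi_lin 1 0 0 z1 z1; rewrite scale1r addr0 mul1r => /eqP.
    by rewrite -subr_eq subrr eq_sym => /eqP.
  (* [phi] is linear on P_1 only, so the induction carries the degree bound along. *)
  suff [] : phi (\sum_i v 0 i *: f i) = \sum_i v 0 i * phi (f i) /\
      Pol deg 1 (\sum_i v 0 i *: f i) by [].
  elim: (index_enum _) => [|i r [ih1 ih2]]; first by rewrite !big_nil.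
  by rewrite !big_cons phi_lin// ih1; split => //; exact: Pol_lin.
pose g r := \sum_j (\sum_i (u *m G) 0 i * a r i j) * phi (f j).
have gphi r : 0 <= r -> phi (T r (gen T (val l))) = g r.
  move=> r0; rewrite uE (is_genE (gE u)) TE// phi_sum.
  by apply: eq_bigr => j _; rewrite mxE.
have tuGa j : tame 0 h (fun r => \sum_i (u *m G) 0 i * a r i j).
  by apply: tame_sum => i; apply: tameM; [exact: tame_cst|have [] := ta h i j].
have tg : tame 0 h g.
  by apply: tame_sum => j; apply: tameM; [exact: tuGa|exact: tame_cst].
split.
- by apply: eq_tame tg => r /andP[r0 _]; rewrite gphi.
- have : tame 0 h (fun r => g (h - r)).
    apply: tame_sum => j; apply: tameM; last exact: tame_cst.
    by apply: tame_sum => i; apply: tameM; [exact: tame_cst|have [] := ta h i j].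
  by apply: eq_tame => r /andP[_ rh]; rewrite gphi// subr_ge0.
transitivity (sint mu `[0, h] g); last first.
  by apply: eq_sint => r; rewrite /= in_itv/= => /andP[r0 _]; rewrite gphi.
rewrite /g sint_itv_sum; last by move=> j; apply: tameM; [exact: tuGa|exact: tame_cst].
rewrite uE TE// !phi_sum -sumrB; apply: eq_bigr => j _.
(* Here u a_h - u = u G W_h, that is, the integral of the coordinates u G a_r of T_r applied to the
   generator of l. *)
rewrite -mulrBl (aE h h0).1 mulmxDr mulmx1 [(u + _ *m _) 0 j]mxE [X in X - _]addrC addrK.
transitivity (sint mu `[0, h]
    (fun s => phi (f j) * \sum_i (u *m G) 0 i * a s i j)); last first.
  by apply: eq_sint => s _; rewrite mulrC.
rewrite sint_itvZ// mulrC; congr (_ * _).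
have tai i : tame 0 h (fun s => a s i j) by have [] := ta h i j.
rewrite mulmxA mxE sint_itv_sum; last first.
  by move=> i; apply: tameM; [exact: tame_cst|exact: tai].
by apply: eq_bigr => i _; rewrite [Wint a h i j]mxE sint_itvZ.
Qed.

Context d (Omega : measurableType d).
Variables (Pr : probability Omega R) (Ft : R -> set (set Omega)).
Hypothesis hFt : filtration Ft.
Variable X : Omega -> R -> E.
Hypothesis hX : polynomial_process T Pr Ft X.
Hypothesis hint : forall (t : R) l, 0 <= t ->
  (\int[Pr]_w \int[mu]_(r in `[0%R, t])
     (modulus (ev (gen T (val l)) (X w r)))%:E < +oo)%E.

Let X_int p t : 0 <= t -> sintegrable Pr (fun w => ev p (X w t)).
Proof. by have [h _] := hX p; exact: h. Qed.

Let X_cond p t h : 0 <= t -> 0 <= h ->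
  cond_exp Pr (Ft t) (fun w => ev p (X w (t + h))) (fun w => ev (T h p) (X w t)).
Proof. by have [_ [h' _]] := hX p; exact: h'. Qed.

Let X_cadlag p w : cadlag (fun t => ev p (X w t)).
Proof. by have [_ [_ [h _]]] := hX p; exact: h. Qed.

Let X_adapted p s t : 0 <= s -> s <= t -> smeasurable (Ft t) (fun w => ev p (X w s)).
Proof.
move=> s0 st; have [_ [_ [_ h]]] := hX p.
by apply: smeasurableS (h s s0); exact: hFt.2.2.
Qed.

Let X_tame p w a t : 0 <= a -> tame a t (fun t => ev p (X w t)).
Proof. by move=> a0; apply: cadlag_tame. Qed.

Definition compensator l w t := sint mu `[0, t] (fun s => ev (gen T (val l)) (X w s)).

Definition compensated l w t :=
  ev (val l) (X w t) - ev (val l) (X w 0) - compensator l w t.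

Lemma compensator_adapted l : adapted Ft (compensator l).
Proof.
move=> t t0; apply: smeasurable_sint => //.
- exact: hFt.1.
- by move=> s /andP[s0 st]; exact: X_adapted.
- by move=> w; exact: X_tame.
Qed.

Lemma compensator_cadlag l w : cadlag (compensator l w).
Proof. by apply: cadlag_sint => t; exact: X_tame. Qed.

Lemma compensator_finite_variation l : finite_variation Ft (compensator l).
Proof.
split; first exact: compensator_adapted.
split; first exact: compensator_cadlag.
by move=> w t t0; apply: bounded_variation_sint => //; exact: X_tame.
Qed.

Lemma compensated_cadlag l w : cadlag (compensated l w).
Proof.
apply: cadlagB; last exact: compensator_cadlag.
by apply: cadlagB; [exact: X_cadlag|exact: cadlag_cst].
Qed.

Lemma compensated_adapted l : adapted Ft (compensated l).
Proof.
move=> t t0; have sF := hFt.1 t t0.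
apply: smeasurableB => //; last exact: compensator_adapted.
by apply: smeasurableB => //; exact: X_adapted.
Qed.

Let compensator_int l t : 0 <= t -> sintegrable Pr (fun w => compensator l w t).
Proof.
move=> t0; apply: sintegrable_path_integral => //; last exact: hint.
  by move=> s /andP[s0 _]; exact: X_int.
by move=> w; exact: X_tame.
Qed.

Let compensated_int l t : 0 <= t -> sintegrable Pr (fun w => compensated l w t).
Proof.
move=> t0; apply/sintegrableP; apply: sL1B => //; last first.
  by apply/sintegrableP; exact: compensator_int.
by apply: sL1B => //; apply/sintegrableP; exact: X_int.
Qed.

Let hint_sub l s t : 0 <= s -> s <= t ->
  (\int[Pr]_w \int[mu]_(r in `[s, t])
     (modulus (ev (gen T (val l)) (X w r)))%:E < +oo)%E.
Proof.
move=> s0 st; apply: le_lt_trans (hint l (le_trans s0 st)).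
apply: ge0_le_integral => //.
- by move=> w _; apply: integral_ge0 => r _; rewrite lee_fin modulus_ge0.
- apply: measurable_path_modulus => // [r /andP[sr _]|w].
    by apply: X_int; exact: le_trans sr.
  exact: X_tame.
- apply: measurable_path_modulus => // [|r /andP[sr _]|w].
  + exact: le_trans st.
  + exact: X_int.
  + exact: X_tame.
move=> w _; apply: ge0_subset_integral => //.
- have tX := X_tame (gen T (val l)) w t (lexx 0).
  have [/(measurable_int mu) + _] := sL1_tame (tame_modulus tX).
  by apply: eq_measurable_fun => r _ /=; rewrite sRe_rsc.
- by move=> r _; rewrite lee_fin modulus_ge0.
- by move=> r; rewrite /= !in_itv/= => /andP[sr ->]; rewrite (le_trans s0).
Qed.

Lemma compensated_martingale l : martingale Pr Ft (compensated l).
Proof.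
split; first exact: compensated_adapted.
split; first exact: compensated_cadlag.
split; first exact: compensated_int.
move=> s t s0 st; have t0 := le_trans s0 st.
split; first exact: compensated_adapted.
split; first exact: compensated_int.
move=> A FA; have mA : measurable A by exact: hFt.2.1 FA.
have sL1A (f : Omega -> F) : sintegrable Pr f -> sL1 Pr A f.
  by move=> /sintegrableP; apply: sL1S.
(* Conditioning on F_s replaces p(X_r) by T_(r-s) p at X_s, so every expectation over A becomes this
   one functional, to which the integrated generator identity applies. *)
pose phi p := sint Pr A (fun w => ev p (X w s)).
have phi_lin c p q : Pol deg 1 p -> Pol deg 1 q ->
    phi (c *: p + q) = c * phi p + phi q.
  move=> _ _.
  have ip := sL1A _ (X_int p s0); have iq := sL1A _ (X_int q s0).
  rewrite /phi -(sintZ c mA ip) -(sintD mA (sL1Z c mA ip) iq).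
  by apply: eq_sint => w _; rewrite evD evZ.
have phiT r p : s <= r -> sint Pr A (fun w => ev p (X w r)) = phi (T (r - s) p).
  move=> sr; have rs0 : 0 <= r - s by rewrite subr_ge0.
  have [_ [_ /(_ A FA)]] := X_cond p s0 rs0.
  by rewrite subrKC.
have ts0 : 0 <= t - s by rewrite subr_ge0.
have [tphi _ dynkin] := dynkin_functional l phi_lin ts0.
have E1 : sint Pr A (fun w => sint mu `[s, t] (fun r => ev (gen T (val l)) (X w r))) =
    phi (T (t - s) (val l)) - phi (val l).
  rewrite sint_path_exchange//; last 3 first.
  - by move=> r /andP[sr _]; apply: X_int; exact: le_trans sr.
  - by move=> w; exact: X_tame.
  - exact: hint_sub.
  have := @sint_shift R k s t (- s) (fun r => phi (T r (gen T (val l)))) st.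
  rewrite subrr => /(_ tphi) shift; rewrite dynkin shift.
  apply: eq_sint => r; rewrite /= in_itv/= => /andP[sr _].
  exact: phiT.
(* M_t is M_s plus an increment; the two terms of the increment have the same integral over A by
   [E1]. *)
transitivity (sint Pr A (fun w => compensated l w s +
    ((ev (val l) (X w t) - ev (val l) (X w s)) -
    sint mu `[s, t] (fun r => ev (gen T (val l)) (X w r))))).
  apply: eq_sint => w _; rewrite /compensated /compensator.
  rewrite (@sint_cat _ _ 0 s t)//; last exact: X_tame.
  ring.
have i1 : sL1 Pr A (fun w => ev (val l) (X w t) - ev (val l) (X w s)).
  by apply: sL1B => //; apply/sL1A/X_int.
have i2 : sL1 Pr A (fun w => sint mu `[s, t] (fun r => ev (gen T (val l)) (X w r))).
  apply/sL1A/sintegrable_path_integral => //.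
  - by move=> r /andP[sr _]; apply: X_int; exact: le_trans sr.
  - by move=> w; exact: X_tame.
  - exact: hint_sub.
rewrite sintD//; [|exact/sL1A/compensated_int|exact: sL1B].
rewrite sintB// E1 sintB//; [|exact/sL1A/X_int|exact/sL1A/X_int].
by rewrite phiT// subrr addr0.
Qed.

Lemma compensated0 l w : compensated l w 0 = 0.
Proof. by rewrite /compensated /compensator sint_itv1 !subrr. Qed.

Lemma compensated_semimartingale l : semimartingale Pr Ft (compensated l).
Proof.
exact: (martingale_semimartingale hFt (compensated_martingale l) (compensated0 l)).
Qed.

(** Writing p = c + l with l in L, the constant cancels in p(X_t) - p(X_0), so M(l) and its
    compensator also decompose p(X). *)
Lemma Pol1_semimartingale p : Pol deg 1 p ->
  semimartingale Pr Ft (fun w t => ev p (X w t)).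
Proof.
move=> /hL.2.2[l /(Pol0P hdeg)[c hc]].
have pE x : ev p x = c + ev (val l) x by rewrite -(hc x) evB subrK.
split; first exact: X_adapted.
exists (compensated l), (compensator l).
split; first exact/martingale_local/compensated_martingale.
split; first exact: compensated0.
split; first exact: compensator_finite_variation.
split; first by move=> w; rewrite /compensator sint_itv1.
by move=> w t t0; rewrite !pE /compensated; ring.
Qed.

End polynomial_martingale.

(** * Variation of constants *)

Section drift.
Context {R : realType} {k : scalar_kind} {E : Type} (e : E).
Local Notation F := (scalars R k).
Local Notation mu := (@lebesgue_measure R).
Context {P : submodClosed (E -> F)} {deg : submod P -> nat}.
Hypothesis hdeg : polynomial_space deg.
Context {L : submodClosed (submod P)}.
Hypothesis hL : complement01 deg L.
Context {T : R -> {linear submod P -> submod P}}.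
Hypothesis hT : polynomial_action deg T.
Context {V : submod L -> submodClosed (submod L)}.
Hypothesis hF : assumptionF deg T V.
Hypothesis T_const : forall h, 0 <= h -> T h (const_poly 1) = const_poly 1.
Implicit Types (p q : submod P) (l : submod L).

Lemma is_gen_const (c : F) : is_gen T (c *: const_poly 1) 0.
Proof.
move=> x; rewrite ev0.
apply: cvg_near_cst; near=> h.
have h0 : 0 <= h by near: h; exact: nbhs_right_ge.
by rewrite linearZ/= T_const// subrr mul0r.
Unshelve. all: by end_near. Qed.

Lemma is_gen_T l h : 0 <= h -> is_gen T (T h (val l)) (T h (gen T (val l))).
Proof.
move=> h0.
have [n [f [a [G [u [_ TE gE _ [aE uE]]]]]]] := generator_coordinates e hdeg hL hT hF l.
(* Both products equal G + G W_h G, by the two expressions of a_h. *)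
have aG : a h *m G = G *m a h.
  rewrite {1}(aE h h0).1 (aE h h0).2.
  by rewrite mulmxDl mulmxDr mul1mx mulmx1 !mulmxA.
rewrite uE (is_genE (gE u)) !TE// -mulmxA -aG mulmxA.
exact: gE.
Qed.

(** The projected and the full action differ by a constant, which the generator kills because T
    fixes constants; and the generator commutes with T_h. *)
Lemma gen_T1 l h : 0 <= h ->
  gen T (val (T1 deg T h l)) = T h (gen T (val l)).
Proof.
move=> h0; apply: is_genE.
have T1h : Pol deg 1 (T h (val l)) by apply: (Pol_T hT) => //; exact: hL.1.
have [c hc] : exists c, val (T1 deg T h l) = - c *: const_poly 1 + T h (val l).
  have /(Pol0P hdeg)/(constantE hdeg e) E0 := Pi1P hdeg hL T1h.
  set c := ev _ e in E0; exists c.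
  by rewrite scaleNr -E0 opprB subrK.
rewrite hc -[T h (gen T _)]add0r -[0 in X in is_gen _ _ X](scaler0 _ (- c)).
rewrite -[X in is_gen _ (_ *: X + _) _]scale1r.
by apply: is_gen_lin; [exact: is_gen_const|exact: is_gen_T].
Qed.

Lemma Pi0_lin x c p q : Pol deg 1 p -> Pol deg 1 q ->
  ev (@Pi0 _ _ _ _ deg L (c *: p + q)) x =
  c * ev (@Pi0 _ _ _ _ deg L p) x + ev (@Pi0 _ _ _ _ deg L q) x.
Proof.
move=> p1 q1; rewrite /Pi0 (Pi1_lin hdeg hL)// -evZ -evD; congr (ev _ x).
by rewrite [val (_ + _)]linearP/= opprD addrACA scalerBr.
Qed.

(** By [gen_T1] the integrand is the P_0-part of T_(t-s) applied to the generator of l. Reflecting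
    time gives the integrated generator identity for the functional [Pi0] at [e], whose value at l
    is 0. *)
Lemma integral_drift l t : 0 <= t ->
  sint mu `[0, t] (fun s => ev (@Pi0 _ _ _ _ deg L (gen T (val (T1 deg T (t - s) l)))) e)
  = ev (@Pi0 _ _ _ _ deg L (T t (val l))) e.
Proof.
move=> t0; pose phi q := ev (@Pi0 _ _ _ _ deg L q) e.
have [tame1 tame2 dynkin] := dynkin_functional e hdeg hL hT hF l (@Pi0_lin e) t0.
have phil : phi (val l) = 0.
  rewrite /phi /Pi0 (_ : Pi1 deg (val l) = l) ?subrr ?ev0//.
  by apply: Pi1_uniq => //; apply/(Pol0P hdeg); exists 0 => x; rewrite subrr ev0.
rewrite -[RHS]subr0 -phil dynkin.
transitivity (sint mu `[0, t] (fun s => phi (T (0 + t - s) (gen T (val l))))).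
  apply: eq_sint => s; rewrite /= in_itv/= => /andP[_ st].
  by rewrite add0r gen_T1 ?subr_ge0.
apply: sint_reflect => //.
by apply: eq_tame tame2 => s _; rewrite add0r.
Qed.

End drift.

Section variation_of_constants.
Context {R : realType} {k : scalar_kind} {E : Type} (e : E).
Local Notation F := (scalars R k).
Local Notation mu := (@lebesgue_measure R).
Context {P : submodClosed (E -> F)} {deg : submod P -> nat}.
Hypothesis hdeg : polynomial_space deg.
Context {L : submodClosed (submod P)}.
Hypothesis hL : complement01 deg L.
Context {T : R -> {linear submod P -> submod P}}.
Hypothesis hT : polynomial_action deg T.
Context {V : submod L -> submodClosed (submod L)}.
Hypothesis hF : assumptionF deg T V.
Implicit Types (p q : submod P) (l : submod L).
Context d (Omega : measurableType d).
Variables (Pr : probability Omega R) (Ft : R -> set (set Omega)).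
Hypothesis hFt : filtration Ft.
Variable X : Omega -> R -> E.
Hypothesis hX : polynomial_process T Pr Ft X.
Hypothesis hint : forall (t : R) l, 0 <= t ->
  (\int[Pr]_w \int[mu]_(r in `[0%R, t])
     (modulus (ev (gen T (val l)) (X w r)))%:E < +oo)%E.

(** T_h 1 is a constant c by the degree bound. The conditional expectation identity at time 0,
    integrated over the whole space, reads 1 = c. *)
Lemma T_const_poly h : 0 <= h -> T h (const_poly 1) = const_poly 1.
Proof.
move=> h0; have [_ [hc _]] := hX (const_poly 1).
have [_ [_ /(_ setT)]] := hc 0 h (lexx 0) h0.
have [F0 FC _] := hFt.1 0 (lexx 0).
have /[swap] /[apply] : Ft 0 setT.
  by have := FC _ F0; rewrite setD0.
have /(Pol0P hdeg)[c Tc] : Pol deg 0 (T h (const_poly 1)).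
  by apply: (Pol_T hT) => //; apply/(Pol0P hdeg); exists 1 => x; rewrite (ev_const_poly hdeg).
have intc (z : F) : sint Pr setT (fun=> z) = z.
  apply: scalar_ext; rewrite ?sRe_sint ?sIm_sint Rintegral_cst//=;
  by rewrite probability_setT mulr1.
have -> : sint Pr setT (fun w => ev (const_poly 1 : submod P) (X w (0 + h))) = 1.
  by rewrite -[RHS]intc; apply: eq_sint => w _; rewrite (ev_const_poly hdeg).
have -> : sint Pr setT (fun w => ev (T h (const_poly 1)) (X w 0)) = c.
  by rewrite -[RHS]intc; apply: eq_sint => w _; rewrite Tc.
by move=> c1; apply: ev_ext => x; rewrite Tc (ev_const_poly hdeg).
Qed.

Let X_tame p w t : tame 0 t (fun s => ev p (X w s)).
Proof. by have [_ [_ [h _]]] := hX p; apply: cadlag_tame. Qed.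

Let X_meas p t : 0 <= t -> smeasurable measurable (fun w => ev p (X w t)).
Proof. by have [h _] := hX p; move=> /h[]. Qed.

(** Projecting T_h b_i to L discards its coefficient at 1, so the integrands of the stochastic
    integral are the entries of a_h without row and column 0. *)
Lemma dual_basis_T1 (l0 : submod L) n (b : 'I_n -> submod (V l0)) (a : R -> 'M[F]_n.+1) h i j :
  is_basis b ->
  (forall h i, 0 <= h -> T h (extended_basis b i) = \sum_j a h i j *: extended_basis b j) ->
  0 <= h ->
  adjoint (restr (T1 deg T h)) (dual_basis b j) (b i) = a h (lift ord0 i) (lift ord0 j).
Proof.
move=> bb aT h0; rewrite /adjoint /=.
apply: (dual_basisE (c := fun j => a h (lift ord0 i) (lift ord0 j)) _ bb).
apply: val_inj; rewrite val_sumZ.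
have [_ [_ VT]] := hF l0.
have -> : val (restr (T1 deg T h) (b i)) = T1 deg T h (val (b i)).
  by rewrite /restr insubdK//; apply: VT => //; exact: valP.
apply: (Pi1_uniq hdeg hL).
have := aT h (lift ord0 i) h0; rewrite extended_basisS => ->.
rewrite extended_basis_sum !val_sumZ addrK.
apply/(Pol0P hdeg); exists (a h (lift ord0 i) ord0) => x.
by rewrite evZ (ev_const_poly hdeg) mulr1.
Qed.

(** The integrals run over the basis of V_p, while the matrix identities need the index of 1 as
    well. The proof inserts that index at no cost; the identity then holds on every path because the
    integrals are defined path by path. *)
Lemma stoch_int_basis (l0 : submod L) n (b : 'I_n -> submod (V l0)) t :
  0 <= t -> is_basis b ->
  exists I : 'I_n -> 'I_n -> Omega -> F,
    (forall i j, stoch_int Pr Ft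
       (fun _ s => adjoint (restr (T1 deg T (t - s))) (dual_basis b j) (b i))
       (compensated (T := T) X (val (b j))) t (I i j)) /\
    forall w i, ev (val (val (b i))) (X w t) - ev (T t (val (val (b i)))) (X w 0) =
      \sum_j I i j w.
Proof.
move=> t0 bb.
have [a [G [aT ta aE hG]]] := extended_basis_generator hdeg hL hT hF e bb.
set f := extended_basis b in aT hG.
have aEG h : 0 <= h -> a h = 1%:M + G *m Wint a h by move=> /aE[].
have ta' i j : tame 0 t (fun s => a (t - s) i j).
  by apply: (@tame_semigroup_rev _ _ _ a G) => // i' j'; exact: ta.
have a0 : a 0 = 1%:M.
  rewrite (aEG 0 (lexx 0)) (_ : Wint a 0 = 0) ?mulmx0 ?addr0//.
  by apply/matrixP => i j; rewrite !mxE sint_itv1.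
have aG h : 0 <= h -> a h *m G = G *m a h.
  move=> h0; rewrite {1}(aE h h0).1 (aE h h0).2.
  by rewrite mulmxDl mulmxDr mul1mx mulmx1 !mulmxA.
(* d/ds a_(t-s) = - G a_(t-s) *)
pose Ga s : 'M[F]_n.+1 := G *m a (t - s).
have tGa i j : tame 0 t (fun s => Ga s i j).
  have : tame 0 t (fun s => \sum_m G i m * a (t - s) m j).
    by apply: tame_sum => m; apply: tameM; [exact: tame_cst|exact: ta'].
  by apply: eq_tame => s _; rewrite [RHS]mxE.
have Ga_int i j s : 0 <= s <= t ->
    sint mu `[0, s] (fun r => Ga r i j) = a t i j - a (t - s) i j.
  move=> /andP[s0 st].
  transitivity (sint mu `[0, s] (fun r => \sum_m G i m * a (t - r) m j)).
    by apply: eq_sint => r _; rewrite mxE.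
  have sub i' j' : tame 0 s (fun r => a (t - r) i' j') by apply: tameS (ta' i' j').
  rewrite sint_itv_sum; last by move=> m; apply: tameM; [exact: tame_cst|exact: sub].
  rewrite (aEG t t0) (aEG (t - s)) ?subr_ge0//.
  rewrite [(1%:M + G *m Wint a t) i j]mxE [(1%:M + G *m Wint a (t - s)) i j]mxE.
  rewrite opprD addrACA subrr add0r [(G *m Wint a t) i j]mxE.
  rewrite [(G *m Wint a (t - s)) i j]mxE -sumrB; apply: eq_bigr => m _.
  rewrite sint_itvZ; last exact: sub.
  rewrite (sint_reflect_sub s0 st (ta t m j) (ta' m j)) [Wint a t m j]mxE.
  by rewrite [Wint a (t - s) m j]mxE mulrBr.
pose H i j s := adjoint (restr (T1 deg T (t - s))) (dual_basis b j) (b i).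
have HE i j s : 0 <= s <= t -> H i j s = a (t - s) (lift ord0 i) (lift ord0 j).
  by move=> /andP[_ st]; rewrite /H (dual_basis_T1 _ _ bb aT)// subr_ge0.
pose phi i j s := - Ga s (lift ord0 i) (lift ord0 j).
have tphi i j : tame 0 t (phi i j).
  have : tame 0 t (fun s => (-1) * Ga s (lift ord0 i) (lift ord0 j)).
    by apply: tameM; [exact: tame_cst|exact: tGa].
  by apply: eq_tame => s _; rewrite mulN1r.
have H_prim i j s : 0 <= s <= t -> H i j s = H i j 0 + sint mu `[0, s] (phi i j).
  move=> st; have /andP[s0 st'] := st; rewrite !HE ?lexx ?t0// subr0.
  have -> : sint mu `[0, s] (phi i j) =
      - sint mu `[0, s] (fun r => Ga r (lift ord0 i) (lift ord0 j)).
    rewrite -mulN1r -sint_itvZ; last exact: tameS (tGa _ _).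
    by apply: eq_sint => r _; rewrite mulN1r.
  by rewrite Ga_int// opprB [RHS]addrC subrK.
pose y j w s := ev (val (val (b j))) (X w s).
pose g j w s := ev (gen T (val (val (b j)))) (X w s).
exists (fun i j => deterministic_int (H i j) (phi i j) t (y j) (g j)); split.
  move=> i j; apply: stoch_int_deterministic => //.
  - exact: H_prim.
  - by move=> w; exact: X_tame.
  - by move=> w; exact: X_tame.
  - by move=> s /andP[s0 _]; exact: X_meas.
  - by move=> s /andP[s0 _]; exact: X_meas.
  - exact: (compensated_semimartingale e hdeg hL hT hF hFt hX hint).
move=> w i; set i' := lift ord0 i.
pose v j s := ev (f j) (X w s).
have tv j : tame 0 t (v j) by exact: X_tame.
pose gv j s := \sum_m G j m * v m s.
have tgv j : tame 0 t (gv j).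
  by apply: tame_sum => m; apply: tameM; [exact: tame_cst|exact: tv].
(* J extends the integrals to the index 0 of the constant 1, where it vanishes. *)
pose J j := a 0 i' j * v j t - a t i' j * v j 0 + sint mu `[0, t] (fun s => v j s * Ga s i' j)
  - sint mu `[0, t] (fun s => a (t - s) i' j * gv j s).
have JI j : deterministic_int (H i j) (phi i j) t (y j) (g j) w = J (lift ord0 j).
  rewrite /deterministic_int /J !HE ?lexx ?t0// subrr subr0 /v /f extended_basisS.
  congr (_ - _ + _ - _).
    rewrite -mulN1r -sint_itvZ; last by apply: tameM; [exact: X_tame|exact: tphi].
    by apply: eq_sint => s _; rewrite /phi mulrN mulN1r opprK.
  apply: eq_sint => s; rewrite /= in_itv/= => st; rewrite HE//; congr (_ * _).
  rewrite /g; have := hG (lift ord0 j); rewrite /f extended_basisS => /is_genE ->.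
  by rewrite ev_sum; apply: eq_bigr => m _; rewrite evZ.
(* Row 0 of G holds the coordinates of the generator of the constant 1, which is 0. *)
have G0 m : G ord0 m = 0.
  apply: (extended_basis_free hdeg hL e bb (c := fun m => G ord0 m)).
  have := hG ord0; rewrite /f extended_basis0 => g1.
  apply: (is_gen_uniq g1); rewrite -[const_poly 1]scale1r.
  exact: (is_gen_const T_const_poly).
have v0 s : v ord0 s = 1 by rewrite /v /f extended_basis0 (ev_const_poly hdeg).
(* The boundary terms reduce to - a_t(i', 0), which the integral of G a_(t-s) compensates since
   a_0(i', 0) = 0; the last integral vanishes with row 0 of G. *)
have J0 : J ord0 = 0.
  rewrite /J a0 mxE /= mul0r !v0 mulr1 sub0r.
  have -> : sint mu `[0, t] (fun s => v ord0 s * Ga s i' ord0) = a t i' ord0.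
    transitivity (sint mu `[0, t] (fun s => Ga s i' ord0)).
      by apply: eq_sint => s _; rewrite v0 mul1r.
    by rewrite Ga_int ?t0 ?lexx// subrr a0 mxE /= subr0.
  rewrite addNr sub0r -[RHS]oppr0; congr (- _).
  rewrite -[RHS](sint0 mu `[0, t]); apply: eq_sint => s _.
  by rewrite /gv big1 ?mulr0// => m _; rewrite G0 mul0r.
under eq_bigr do rewrite JI.
have -> : \sum_j J (lift ord0 j) = \sum_j J j by rewrite big_ord_recl J0 add0r.
rewrite /J sumrB big_split /= sumrB -addrA -!sint_itv_sum; last 2 first.
- by move=> j; apply: tameM; [exact: ta'|exact: tgv].
- by move=> j; apply: tameM; [exact: tv|exact: tGa].
rewrite [X in _ = _ + X](_ : _ = 0) ?addr0.
  congr (_ - _).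
    rewrite (bigD1 i')//= a0 mxE eqxx mul1r big1 ?addr0 => [|j ij].
      by rewrite /v /f extended_basisS.
    by rewrite mxE eq_sym (negbTE ij) mul0r.
  have := aT t i' t0; rewrite {1}/f extended_basisS => ->.
  by rewrite ev_sum; apply: eq_bigr => j _; rewrite evZ.
(* The remaining integrands are G a_(t-s) and a_(t-s) G applied to the same vector of values, and
   these matrices agree. *)
apply/eqP; rewrite subr_eq0; apply/eqP; apply: eq_sint => s.
rewrite /= in_itv/= => /andP[_ st].
rewrite /gv /Ga -aG ?subr_ge0//.
under [RHS]eq_bigr do rewrite mulr_sumr.
rewrite exchange_big; apply: eq_bigr => j _ /=.
rewrite mxE mulr_sumr; apply: eq_bigr => m _.
by ring.
Qed.

End variation_of_constants.

(** * Weak*-martingale property and variation of constants in the dual of L *)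

Theorem theorem4p5 (R : realType) (k : scalar_kind)
    (d : measure_display) (Omega : measurableType d)
    (Pr : probability Omega R) (Ft : R -> set (set Omega))
    (hFt : filtration Ft)
    (E : Type) (e : E)
    (P : submodClosed (E -> scalars R k)) (deg : submod P -> nat)
    (hdeg : polynomial_space deg)
    (L : submodClosed (submod P)) (hL : complement01 deg L)
    (T : R -> {linear submod P -> submod P}) (hT : polynomial_action deg T)
    (X : Omega -> R -> E) (hX : polynomial_process T Pr Ft X)
    (V : submod L -> submodClosed (submod L)) (hF : assumptionF deg T V)
    (hint : forall (t : R) (p : submod L), 0 <= t ->
      (\int[Pr]_w \int[lebesgue_measure]_(r in `[0%R, t])
         (modulus (ev (gen T (val p)) (X w r)))%:E < +oo)%E) :
  let b : submod L -> scalars R k :=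
    adjoint (gen01 deg T) (one_functional e) in
  let A : (submod L -> scalars R k) -> (submod L -> scalars R k) :=
    adjoint (gen1 deg T) in
  let U (h : R) : (submod L -> scalars R k) -> (submod L -> scalars R k) :=
    adjoint (T1 deg T h) in
  let Xt (w : Omega) (t : R) (p : submod L) : scalars R k :=
    ev (val p) (X w t) in
  let M (w : Omega) (t : R) : submod L -> scalars R k :=
    Xt w t - Xt w 0 - weak_int (fun s => b + A (Xt w s)) t in
  linear b /\
  (forall phi : submod L -> scalars R k, linear phi -> linear (A phi)) /\
  (forall (h : R) (phi : submod L -> scalars R k),
     0 <= h -> linear phi -> linear (U h phi)) /\
  dual_valued M /\
  weak_martingale Pr Ft M /\
  (forall (w : Omega) (t : R) (p : submod L), 0 <= t ->
     M w t p = ev (val p) (X w t) - ev (val p) (X w 0)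
       - sint lebesgue_measure `[0, t]
           (fun s => ev (gen T (val p)) (X w s))) /\
  (exists Z : Omega -> R -> submod L -> scalars R k,
     weak_stoch_int Pr Ft (T1 deg T) V M Z /\
     (forall (w : Omega) (t : R), 0 <= t ->
        Xt w t = U t (Xt w 0) + weak_int (fun s => U (t - s) b) t + Z w t)) /\
  (forall p : submod P, Pol deg 1 p ->
     semimartingale Pr Ft (fun w t => ev p (X w t))).
Proof.
move=> b A U Xt M.
have T_const h : 0 <= h -> T h (const_poly 1) = const_poly 1.
  exact: (T_const_poly hdeg hT hFt hX).
have gen_lin c (p q : submod L) :
    gen T (val (c *: p + q)) = c *: gen T (val p) + gen T (val q).
  exact: (gen_linear hdeg hL hT hF e).
have genP1 (p : submod L) : Pol deg 1 (gen T (val p)).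
  exact: (gen_spec hdeg hL hT hF e p).2.
have X_tame (p : submod P) w t : tame 0 t (fun s => ev p (X w s)).
  by have [_ [_ [h _]]] := hX p; apply: cadlag_tame.
have ME w t p : M w t p = compensated (T := T) X p w t.
  congr (_ - _); apply: eq_sint => s _.
  (* The constant part, read at [e] by b, and the L-part, read at X_s by A, recombine to the
     generator of p at X_s. *)
  exact: (ev_Pi0_Pi1 hdeg hL e (X w s) (genP1 p)).
have b_lin : linear b.
  by move=> c p q; rewrite /b /adjoint /= /gen01 /one_functional gen_lin (Pi0_lin hdeg hL).
have MC p : (fun w t => M w t p) = compensated (T := T) X p.
  by apply/funext => w; apply/funext => t; exact: ME.
split; first exact: b_lin.
split.
  move=> phi phi_lin c p q.
  by rewrite /A /adjoint /= /gen1 gen_lin (Pi1_lin hdeg hL)// phi_lin.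
split.
  by move=> h phi h0 phi_lin c p q; rewrite /U /adjoint /= (T1_linear hdeg hL hT h0) phi_lin.
split.
  move=> w t t0 c p q; rewrite !ME /compensated /compensator gen_lin.
  transitivity (c * (ev (val p) (X w t) - ev (val p) (X w 0)) +
      (ev (val q) (X w t) - ev (val q) (X w 0)) -
    (c * sint lebesgue_measure `[0, t] (fun s => ev (gen T (val p)) (X w s)) +
     sint lebesgue_measure `[0, t] (fun s => ev (gen T (val q)) (X w s)))); last first.
    rewrite /GRing.scale/=; ring.
  congr (_ - _).
    by rewrite [val _]linearP !evD !evZ; ring.
  have tp := X_tame (gen T (val p)) w t; have tq := X_tame (gen T (val q)) w t.
  rewrite -(sint_itvZ c tp) -(sint_itvD (tameM (tame_cst 0 t c) tp) tq).
  by apply: eq_sint => s _; rewrite evD evZ.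
split.
  by move=> p; rewrite MC; exact: (compensated_martingale e hdeg hL hT hF hFt hX hint).
split; first by move=> w t p t0; rewrite ME.
split; last first.
  by move=> p p1; exact: (Pol1_semimartingale e hdeg hL hT hF hFt hX hint).
(* The identity forces Z_t(p) = p(X_t) - T_t p(X_0). *)
exists (fun w t p => ev (val p) (X w t) - ev (T t (val p)) (X w 0)); split.
  split.
    by move=> p; rewrite MC; exact: (compensated_semimartingale e hdeg hL hT hF hFt hX hint).
  split.
    move=> w t t0 c p q; rewrite [val _]linearP/= linearP/= !evD !evZ /GRing.scale/=.
    ring.
  split.
    have X_meas (p : submod P) s : 0 <= s -> smeasurable measurable (fun w => ev p (X w s)).
      by have [h _] := hX p; move=> /h[].
    move=> p t t0; apply: smeasurableB; first exact: sigma_algebra_measurable.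
      exact: X_meas.
    exact: X_meas.
  move=> p t t0; split; first by have [] := hF p.
  move=> n bb hbb.
  have [I [HI IE]] := stoch_int_basis e hdeg hL hT hF hFt hX hint t0 hbb.
  exists I; split.
    by move=> i j; have := HI i j; rewrite -MC.
  by apply: aeW => w i; rewrite IE.
move=> w t t0; apply/funext => p.
have E1 : weak_int (fun s => U (t - s) b) t p = ev (@Pi0 _ _ _ _ deg L (T t (val p))) e.
  exact: (integral_drift e hdeg hL hT hF T_const).
(* The drift term supplies the P_0-part of T_t p and the initial term its L-part at X_0; together
   they cancel what [Z] subtracts from p(X_t). *)
have E2 : ev (@Pi0 _ _ _ _ deg L (T t (val p))) e + U t (Xt w 0) p = ev (T t (val p)) (X w 0).
  apply: (ev_Pi0_Pi1 hdeg hL).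
  by apply: (Pol_T hT) => //; exact: hL.1.
rewrite !fctE E1 [U t _ p + _]addrC E2 subrKC //.
Qed.
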